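(* Let $p$ be a prime and $G$ a $d$-generated ($p$-adic) analytic pro-$p$-group, with invariants $r_k$, $a_n=a_n(G)$, $c_n$, $e_n$ as described in the context. Then $$\sum_{k=2}^\infty r_kt^k-dt+1=\prod_{n=1}^\infty P_n(t)^{a_n}+\frac{\sum_{n=1}^\infty e_nt^n}{\sum_{n=1}^\infty c_nt^n},\qquad P_n(t)=\frac{1-t^n}{1-t^{np}},$$ for all $0<t<1$.
   Context: For a pro-$p$-group $H$, $\mathbb{F}_p[H]$ is the completed group algebra over $\mathbb{F}_p$, $I(H)$ its augmentation ideal (kernel of $\sum a_ih_i\mapsto \sum a_i$), $H_n=\{h\in H:h-1\in I(H)^n\}$ the $n$-th modular dimension subgroup, and $a_n(H)=\dim_{\mathbb{F}_p}H_n/H_{n+1}$. Let $r=\dim H^2(G,\mathbb{F}_p)$ and let $1\to R\to F\xrightarrow{\phi} G\to1$ be a minimal presentation ($F$ free pro-$p$ on generators $\sigma_1,\dots,\sigma_d$ lifting a minimal generating set of $G$). For $1\neq\rho\in F$ its level is the largest $n$ with $\rho\in F_n$. Relations are chosen inductively: $S_0=\emptyset$, $S_n=S_{n-1}\cup\{\rho_{n,1},\dots,\rho_{n,r_n}\}$ where the new elements have level $n$ and together with $S_{n-1}$ form a minimal generating system of $RF_{n+1}/F_{n+1}$ as a normal subgroup of $F/F_{n+1}$; $r_k$ is the number of relations of level $k$ ($r_1=0$, $\sum r_k=r$). Enumerate the relations as $\rho_1,\dots,\rho_r$. Identify $\mathbb{F}_p[F]$ with non-commutative power series $\mathbb{F}_p\langle\langle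 x_1,\dots,x_d\rangle\rangle$ via $\sigma_i\mapsto1+x_i$, let $f_i$ be the image of $\rho_i-1$ and $v(f_i)$ the level of $\rho_i$. Fox derivatives are defined by $f=\sum_j\frac{\partial f}{\partial x_j}x_j$ for $f$ without constant term. With $I=I(G)$, $I^n=\mathbb{F}_p[G]$ for $n\le0$, set $c_n=\dim_{\mathbb{F}_p}\mathbb{F}_p[G]/I^n$, and for $n\ge1$ let $e_n=\dim_{\mathbb{F}_p}\ker J_n$ where $J_n:\bigoplus_{i=1}^r\mathbb{F}_p[G]/I^{n-v(f_i)}\to\bigoplus_{j=1}^d\mathbb{F}_p[G]/I^{n-1}$ sends $(g_i)_i$ to $\big(\sum_i g_i\phi(\partial f_i/\partial x_j)\big)_j$, $\phi:\mathbb{F}_p[F]\to\mathbb{F}_p[G]$ being the induced map. *)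

(* Defs.v *)
From HB Require Import structures.
From mathcomp Require Import all_boot all_order fingroup all_algebra generic_quotient.
From mathcomp Require Import all_classical all_reals all_analysis.
Set Implicit Arguments.
Unset Strict Implicit.
Unset Printing Implicit Defensive.
Import Order.TTheory GRing.Theory Num.Theory.
Import numFieldNormedType.Exports.
Local Open Scope classical_set_scope.
Local Open Scope quotient_scope.
Local Open Scope ring_scope.

HB.mixin Record isTopGroup G of monoid.Group G & Topological G := {
  mulg_continuous : continuous (fun z : G * G => (z.1 * z.2)%g);
  invg_continuous : continuous (fun x : G => x^-1%g) }.

#[short(type="topGroupType")]
HB.structure Definition TopGroup :=
  {G of isTopGroup G & monoid.Group G & Topological G}.

#[short(type="contHomType")]
HB.structure Definition ContHom (G H : topGroupType) :=
  {f of @Continuous G H f & @UMagmaMorphism G H f}.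

Section Subgroups.
Variable G : groupType.
Implicit Types X H : set G.

Definition is_subgroup H :=
  H 1%g /\ forall x y, H x -> H y -> H (x * y^-1)%g.

Definition is_normal H :=
  is_subgroup H /\ forall x g, H x -> H (x ^ g)%g.

Definition subgroup_gen X : set G :=
  \bigcap_(H in [set H | is_subgroup H /\ X `<=` H]) H.

Definition normal_gen X : set G :=
  \bigcap_(H in [set H | is_normal H /\ X `<=` H]) H.

End Subgroups.

(* The finite index condition is automatic when G is compact. *)
Record opnsub (G : topGroupType) := OpnSub {
  opnsub_set :> G -> Prop;
  opnsub_open : open (opnsub_set : set G);
  opnsub_normal : is_normal (opnsub_set : set G);
  opnsub_finite : exists s : seq G,
    forall g, exists2 x, x \in s & opnsub_set (x^-1 * g)%g }.

Section Quotient.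
Variables (G : topGroupType) (U : opnsub G).

Lemma opnsub1 : U 1%g.
Proof. by have [[]] := opnsub_normal U. Qed.

Lemma opnsubV x : U x -> U x^-1%g.
Proof.
by move=> Ux; rewrite -[x^-1%g]mul1g; have [[U1 h] _] := opnsub_normal U; apply: h.
Qed.

Lemma opnsubM x y : U x -> U y -> U (x * y)%g.
Proof.
by move=> Ux /opnsubV Uy; rewrite -[y]invgK; have [[_ h] _] := opnsub_normal U; apply: h.
Qed.

Lemma opnsubJ x g : U x -> U (x ^ g)%g.
Proof. by have [_] := opnsub_normal U; apply. Qed.

Definition quo_rel : rel G := fun x y => `[< U (x^-1 * y)%g >].

Lemma quo_rel_refl : reflexive quo_rel.
Proof. by move=> x; apply/asboolP; rewrite mulVg; apply: opnsub1. Qed.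

Lemma quo_rel_sym : symmetric quo_rel.
Proof.
have h x y : quo_rel x y -> quo_rel y x.
  by move=> /asboolP /opnsubV xy; apply/asboolP; rewrite invgM invgK in xy.
by move=> x y; apply/idP/idP; apply: h.
Qed.

Lemma quo_rel_trans : transitive quo_rel.
Proof.
move=> y x z /asboolP xy /asboolP yz; apply/asboolP.
by have := opnsubM xy yz; rewrite mulgA mulgK.
Qed.

Canonical quo_equiv := EquivRel quo_rel quo_rel_refl quo_rel_sym quo_rel_trans.

Definition quo := {eq_quot quo_equiv}.
HB.instance Definition _ := Choice.on quo.
HB.instance Definition _ := EqQuotient.on quo.

Definition quo_pi (g : G) : quo := \pi_quo g.

Lemma quo_piE x y : quo_pi x = quo_pi y <-> U (x^-1 * y)%g.
Proof.
split=> [/eqquotP|h]; first by move=> /asboolP.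
by apply/eqquotP; apply/asboolP.
Qed.

Lemma quo_reprK q : quo_pi (repr q) = q.
Proof. exact: reprK. Qed.

Lemma quo_enum_ex : exists s : seq quo, forall q, q \in s.
Proof.
have [s hs] := opnsub_finite U; exists (map quo_pi s) => q.
have [x xs Ux] := hs (repr q); apply/mapP; exists x => //.
by rewrite -[LHS]quo_reprK; apply/esym/quo_piE.
Qed.

Let e : seq quo := undup (sval (cid quo_enum_ex)).

Let mem_e q : q \in e.
Proof. by rewrite mem_undup; exact: (svalP (cid quo_enum_ex)). Qed.

Let quo_index q : 'I_(size e) := Ordinal (etrans (index_mem q e) (mem_e q)).

Let quo_indexK : cancel quo_index (tnth (in_tuple e)).
Proof. by move=> q; rewrite (tnth_nth q) nth_index. Qed.

HB.instance Definition _ : isCountable quo := CanIsCountable quo_indexK.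
HB.instance Definition _ : fintype.isFinite quo := CanIsFinite quo_indexK.

Let mul (a b : quo) : quo := quo_pi (repr a * repr b)%g.
Let one : quo := quo_pi 1%g.
Let inv (a : quo) : quo := quo_pi (repr a)^-1%g.

Let quo_reprE x : U (x^-1 * repr (quo_pi x))%g.
Proof. by apply/quo_piE; rewrite quo_reprK. Qed.

Lemma quo_piM_subproof x y : quo_pi (x * y)%g = mul (quo_pi x) (quo_pi y).
Proof.
apply/quo_piE; set a := repr (quo_pi x); set b := repr (quo_pi y).
have -> : ((x * y)^-1 * (a * b) = (x^-1 * a) ^ y * (y^-1 * b))%g.
  by rewrite /conjg invgM !mulgA mulgK.
by apply: opnsubM; [apply: opnsubJ|]; apply: quo_reprE.
Qed.

Lemma quo_piV_subproof x : quo_pi x^-1%g = inv (quo_pi x).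
Proof.
apply/quo_piE; rewrite invgK; set a := repr (quo_pi x).
have -> : (x * a^-1 = ((x^-1 * a)^-1) ^ x^-1)%g.
  by rewrite /conjg invgM !invgK !mulgA mulgK.
by apply/opnsubJ/opnsubV/quo_reprE.
Qed.

Let mulA : associative mul.
Proof.
move=> a b c; rewrite -[a]quo_reprK -[b]quo_reprK -[c]quo_reprK.
by rewrite -!quo_piM_subproof mulgA.
Qed.

Let mul1 : left_id one mul.
Proof. by move=> a; rewrite -[a]quo_reprK -quo_piM_subproof mul1g. Qed.

Let mul1' : right_id one mul.
Proof. by move=> a; rewrite -[a]quo_reprK -quo_piM_subproof mulg1. Qed.

Let mulV : left_inverse one inv mul.
Proof.
by move=> a; rewrite -[a]quo_reprK -quo_piV_subproof -quo_piM_subproof mulVg.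
Qed.

Let mulV' : right_inverse one inv mul.
Proof.
by move=> a; rewrite -[a]quo_reprK -quo_piV_subproof -quo_piM_subproof mulgV.
Qed.

HB.instance Definition _ := isGroup.Build quo mulA mul1 mul1' mulV mulV'.

Lemma quo_piM x y : quo_pi (x * y)%g = (quo_pi x * quo_pi y)%g.
Proof. exact: quo_piM_subproof. Qed.

Lemma quo_pi1 : quo_pi 1%g = 1%g.
Proof. by []. Qed.

End Quotient.

(* The projection G / V -> G / U, meaningful when V is contained in U. *)
Definition quo_proj (G : topGroupType) (V U : opnsub G) (q : quo V) : quo U :=
  quo_pi U (repr q).

Section QuoProj.
Variables (G : topGroupType) (V U : opnsub G).
Hypothesis VU : forall x, V x -> U x.

Lemma quo_projE x : quo_proj U (quo_pi V x) = quo_pi U x.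
Proof.
by apply/esym/quo_piE/VU/quo_piE; rewrite quo_reprK.
Qed.

Lemma quo_projM : {morph @quo_proj G V U : a b / (a * b)%g}.
Proof.
move=> a b; rewrite -[a]quo_reprK -[b]quo_reprK -quo_piM !quo_projE.
exact: quo_piM.
Qed.

End QuoProj.

Record invsys := InvSys {
  is_idx : Type;
  is_obj : is_idx -> nzRingType;
  is_le : is_idx -> is_idx -> Prop;
  is_tr : forall i j, is_obj j -> is_obj i;
  is_i0 : is_idx;
  is_trB : forall i j, is_le i j -> {morph @is_tr i j : x y / x - y};
  is_trM : forall i j, is_le i j -> {morph @is_tr i j : x y / x * y};
  is_tr1 : forall i j, is_le i j -> @is_tr i j 1 = 1 }.

Record invlim (S : invsys) := InvLim {
  il_val :> forall i, @is_obj S i;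
  il_coh : forall i j, is_le i j -> is_tr i (il_val j) = il_val i }.

Section InvLimRing.
Variable S : invsys.
Implicit Types x y : invlim S.

HB.instance Definition _ := gen_eqMixin (invlim S).
HB.instance Definition _ := gen_choiceMixin (invlim S).

Lemma invlimP x y : (forall i, x i = y i) -> x = y.
Proof.
case: x y => [x hx] [y hy] /= xy; have {}xy : x = y by apply/functional_extensionality_dep.
by subst y; rewrite (Prop_irrelevance hx hy).
Qed.

Let tr0 i j (h : is_le i j) : @is_tr S i j 0 = 0.
Proof. by rewrite -[X in is_tr _ X](subrr 0) is_trB // subrr. Qed.

Let trN i j (h : is_le i j) u : @is_tr S i j (- u) = - is_tr i u.
Proof. by rewrite -sub0r is_trB // tr0 // sub0r. Qed.

Let trD i j (h : is_le i j) u v : @is_tr S i j (u + v) = is_tr i u + is_tr i v.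
Proof. by rewrite -{1}[v]opprK is_trB // trN // opprK. Qed.

Let zero : invlim S.
Proof. by exists (fun=> 0) => i j h; rewrite tr0. Defined.
Let one : invlim S.
Proof. by exists (fun=> 1) => i j h; rewrite is_tr1. Defined.
Let opp x : invlim S.
Proof. by exists (fun i => - x i) => i j h; rewrite trN // il_coh. Defined.
Let add x y : invlim S.
Proof. by exists (fun i => x i + y i) => i j h; rewrite trD // !il_coh. Defined.
Let mul x y : invlim S.
Proof. by exists (fun i => x i * y i) => i j h; rewrite is_trM // !il_coh. Defined.

Let addA : associative add.
Proof. by move=> x y z; apply: invlimP => i /=; rewrite addrA. Qed.
Let addC : commutative add.
Proof. by move=> x y; apply: invlimP => i /=; rewrite addrC. Qed.
Let add0 : left_id zero add.
Proof. by move=> x; apply: invlimP => i /=; rewrite add0r. Qed.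
Let addN : left_inverse zero opp add.
Proof. by move=> x; apply: invlimP => i /=; rewrite addNr. Qed.
HB.instance Definition _ := GRing.isZmodule.Build (invlim S) addA addC add0 addN.

Let mulA : associative mul.
Proof. by move=> x y z; apply: invlimP => i /=; rewrite mulrA. Qed.
Let mul1 : left_id one mul.
Proof. by move=> x; apply: invlimP => i /=; rewrite mul1r. Qed.
Let mul1' : right_id one mul.
Proof. by move=> x; apply: invlimP => i /=; rewrite mulr1. Qed.
Let mulDl : left_distributive mul +%R.
Proof. by move=> x y z; apply: invlimP => i /=; rewrite mulrDl. Qed.
Let mulDr : right_distributive mul +%R.
Proof. by move=> x y z; apply: invlimP => i /=; rewrite mulrDr. Qed.
Let one_neq0 : one != 0.
Proof.
apply/eqP => /(congr1 (fun x => il_val x (is_i0 S))) /= /eqP.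
by rewrite oner_eq0.
Qed.
HB.instance Definition _ := GRing.Zmodule_isNzRing.Build (invlim S)
  mulA mul1 mul1' mulDl mulDr one_neq0.

Lemma invlimDE x y i : (x + y) i = x i + y i. Proof. by []. Qed.
Lemma invlimNE x i : (- x) i = - x i. Proof. by []. Qed.
Lemma invlimME x y i : (x * y) i = x i * y i. Proof. by []. Qed.
Lemma invlim0E i : (0 : invlim S) i = 0. Proof. by []. Qed.
Lemma invlim1E i : (1 : invlim S) i = 1. Proof. by []. Qed.

End InvLimRing.

Definition galg (K : fieldType) (gT : finGroupType) := {ffun gT -> K}.

Section GroupAlgebra.
Variables (K : fieldType) (gT : finGroupType).
Local Notation A := (galg K gT).
Implicit Types a b c : A.

HB.instance Definition _ := GRing.Lmodule.copy A {ffun gT -> K^o}.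

Let mul a b : A := [ffun g => \sum_(h : gT) a h * b (h^-1 * g)%g].

Definition gdelta (g : gT) : A := [ffun h => (h == g)%:R].

Let mulA : associative mul.
Proof.
move=> a b c; apply/ffunP => g; rewrite !ffunE.
under eq_bigr => h _.
  rewrite ffunE (reindex_inj (mulgI h^-1%g)) /= big_distrr /=.
  under eq_bigr => k _ do rewrite invgM invgK -mulgA mulKVg mulrA.
  over.
rewrite exchange_big /=; apply: eq_bigr => k _.
by rewrite ffunE big_distrl.
Qed.

Let mul1 : left_id (gdelta 1%g) mul.
Proof.
move=> a; apply/ffunP => g; rewrite ffunE (bigD1 1%g) //= big1 => [|h /negPf h1].
  by rewrite ffunE eqxx mul1r invg1 mul1g addr0.
by rewrite ffunE h1 mul0r.
Qed.

Let mul1' : right_id (gdelta 1%g) mul.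
Proof.
move=> a; apply/ffunP => g; rewrite ffunE (bigD1 g) //= big1 => [|h hg].
  by rewrite ffunE mulVg eqxx mulr1 addr0.
by rewrite ffunE -eq_mulVg1 (negPf hg) mulr0.
Qed.

Let mulDl : left_distributive mul +%R.
Proof.
move=> a b c; apply/ffunP => g; rewrite !ffunE -big_split /=.
by apply: eq_bigr => h _; rewrite ffunE mulrDl.
Qed.

Let mulDr : right_distributive mul +%R.
Proof.
move=> a b c; apply/ffunP => g; rewrite !ffunE -big_split /=.
by apply: eq_bigr => h _; rewrite ffunE mulrDr.
Qed.

Let one_neq0 : gdelta 1%g != 0.
Proof. by apply/eqP => /ffunP/(_ 1%g); rewrite !ffunE eqxx => /eqP; rewrite oner_eq0. Qed.

HB.instance Definition _ := GRing.Zmodule_isNzRing.Build A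
  mulA mul1 mul1' mulDl mulDr one_neq0.

Lemma galgME a b g : (a * b) g = \sum_(h : gT) a h * b (h^-1 * g)%g.
Proof. exact: ffunE. Qed.

Lemma galg1E : 1 = gdelta 1%g. Proof. by []. Qed.

Lemma galgZE k a g : (k *: a) g = k * a g.
Proof. by rewrite ffunE. Qed.

Let scaleAl k a b : k *: (a * b) = k *: a * b.
Proof.
apply/ffunP => g; rewrite galgZE !galgME big_distrr /=.
by apply: eq_bigr => h _; rewrite galgZE mulrA.
Qed.
HB.instance Definition _ := GRing.Lmodule_isLalgebra.Build K A scaleAl.

Let scaleAr k a b : k *: (a * b) = a * (k *: b).
Proof.
apply/ffunP => g; rewrite galgZE !galgME big_distrr /=.
by apply: eq_bigr => h _; rewrite galgZE mulrCA.
Qed.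
HB.instance Definition _ := GRing.Lalgebra_isAlgebra.Build K A scaleAr.

End GroupAlgebra.

Definition galg_map (K : fieldType) (gT hT : finGroupType) (f : gT -> hT)
    (a : galg K gT) : galg K hT :=
  [ffun h => \sum_(g | f g == h) a g].

Section GalgMap.
Variables (K : fieldType) (gT hT : finGroupType) (f : gT -> hT).
Local Notation fA := (@galg_map K gT hT f).

Lemma galg_mapB : {morph fA : a b / a - b}.
Proof.
move=> a b; apply/ffunP => h; rewrite !ffunE -sumrB.
by apply: eq_bigr => g _; rewrite !ffunE.
Qed.

Lemma galg_mapZ k : {morph fA : a / k *: a}.
Proof.
move=> a; apply/ffunP => h; rewrite galgZE !ffunE big_distrr /=.
by apply: eq_bigr => g _; rewrite galgZE.
Qed.

Lemma galg_map_delta g : fA (gdelta K g) = gdelta K (f g).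
Proof.
apply/ffunP => h; rewrite !ffunE; have [<-|hf] := eqVneq (f g) h.
  rewrite (bigD1 g) //= ffunE eqxx big1 ?addr0 // => k /andP[_ /negPf kg].
  by rewrite ffunE kg.
rewrite big1 // => k /eqP kh; rewrite ffunE; case: eqP => // kg.
by rewrite -kh kg eqxx in hf.
Qed.

Hypothesis fM : {morph f : x y / (x * y)%g}.

Lemma galg_map1 : fA 1 = 1.
Proof.
by rewrite !galg1E galg_map_delta; congr gdelta;
  apply: (mulgI (f 1%g)); rewrite -fM !mulg1.
Qed.

Lemma galg_mapM : {morph fA : a b / a * b}.
Proof.
move=> a b; apply/ffunP => h; rewrite ffunE galgME.
under eq_bigr do rewrite galgME.
rewrite exchange_big /=.
rewrite (partition_big f predT) //=; apply: eq_bigr => k _.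
rewrite !ffunE big_distrl /=; apply: eq_bigr => g /eqP gk.
rewrite -big_distrr /=; congr (_ * _).
rewrite (reindex_inj (mulgI g)) /=; apply: eq_big => x; last by rewrite mulKg.
by rewrite fM gk -(inj_eq (mulgI k^-1%g)) mulKg.
Qed.

End GalgMap.

Lemma galg_map_comp (K : fieldType) (gT hT kT : finGroupType)
    (f : gT -> hT) (h : hT -> kT) (a : galg K gT) :
  galg_map h (galg_map f a) = galg_map (fun x => h (f x)) a.
Proof.
apply/ffunP => k; rewrite !ffunE; under eq_bigr do rewrite ffunE.
rewrite [RHS](partition_big f (fun y => h y == k)) //=.
apply: eq_bigr => y /eqP hy; apply: eq_bigl => x.
by rewrite andbC; case: eqP => //= ->; rewrite hy eqxx.
Qed.

Section CompletedGroupAlgebra.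
Variables (p : nat) (G : topGroupType).

Definition opnT : opnsub G.
Proof.
exists (fun=> True); first exact: openT.
  by [].
by exists [:: 1%g] => g; exists 1%g; rewrite ?mem_head.
Defined.

Definition cga_sys : invsys := @InvSys (opnsub G)
  (fun U => galg 'F_p (quo U)) (fun U V => forall x, V x -> U x)
  (fun U V => galg_map (@quo_proj G V U)) opnT
  (fun U V _ => @galg_mapB _ _ _ _)
  (fun U V VU => galg_mapM (quo_projM VU))
  (fun U V VU => galg_map1 _ (quo_projM VU)).

(* F_p[[G]], as a projective limit over all U of finite index; for compact G
   these are all the open normal subgroups. *)
Definition cga := invlim cga_sys.
HB.instance Definition _ := GRing.NzRing.on cga.

Let scale (k : 'F_p) (x : cga) : cga.
Proof.
exists (fun U : opnsub G => k *: (x U : galg 'F_p (quo U))) => U V VU.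
by rewrite /is_tr /= galg_mapZ; congr (_ *: _); apply: (il_coh x VU).
Defined.

Let scaleA a b x : scale a (scale b x) = scale (a * b) x.
Proof. by apply: invlimP => U; apply: scalerA. Qed.
Let scale1 : left_id 1 scale.
Proof. by move=> x; apply: invlimP => U; apply: scale1r. Qed.
Let scaleDr : right_distributive scale +%R.
Proof. by move=> a x y; apply: invlimP => U; apply: scalerDr. Qed.
Let scaleDl x : {morph scale^~ x : a b / a + b}.
Proof. by move=> a b; apply: invlimP => U; apply: scalerDl. Qed.
HB.instance Definition _ :=
  GRing.Zmodule_isLmodule.Build 'F_p cga scaleA scale1 scaleDr scaleDl.

Let scaleAl a (x y : cga) : a *: (x * y) = a *: x * y.
Proof. by apply: invlimP => U; apply: scalerAl. Qed.
HB.instance Definition _ := GRing.Lmodule_isLalgebra.Build 'F_p cga scaleAl.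
Let scaleAr a (x y : cga) : a *: (x * y) = x * (a *: y).
Proof. by apply: invlimP => U; apply: scalerAr. Qed.
HB.instance Definition _ := GRing.Lalgebra_isAlgebra.Build 'F_p cga scaleAr.

Definition gel (g : G) : cga.
Proof.
exists (fun U : opnsub G => gdelta 'F_p (quo_pi U g)) => U V VU.
by rewrite /is_tr /= galg_map_delta quo_projE.
Defined.

(* Read off at the level of the trivial quotient G / G. *)
Definition cga_aug (x : cga) : 'F_p :=
  \sum_(q : quo opnT) (x opnT : galg 'F_p (quo opnT)) q.

Definition aug_ideal : set cga := [set x | cga_aug x = 0].

End CompletedGroupAlgebra.

Section PreimageOpnsub.
Variables (F G : topGroupType) (phi : contHomType F G) (U : opnsub G).

Lemma opnsub_preim_open : open [set x | U (phi x)].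
Proof. by apply: (open_comp (f := phi)) (opnsub_open U) => x _; apply: cts_fun. Qed.

Lemma opnsub_preim_normal : is_normal [set x | U (phi x)].
Proof.
split; [split=> [|x y Ux Uy]|move=> x g Ux] => /=.
- by rewrite gmulf1; apply: opnsub1.
- by rewrite gmulfM gmulfV; apply/opnsubM/opnsubV.
- by rewrite /conjg !gmulfM gmulfV; apply: opnsubJ.
Qed.

Lemma opnsub_preim_finite : exists s : seq F,
  forall g, exists2 x, x \in s & U (phi (x^-1 * g)%g).
Proof.
pose c (q : quo U) := xget 1%g [set x | quo_pi U (phi x) = q].
exists [seq c q | q <- enum {: quo U}] => g.
exists (c (quo_pi U (phi g))); first by rewrite map_f // mem_enum.
rewrite gmulfM gmulfV; apply/quo_piE.
exact: (@xgetPex _ 1%g [set x | quo_pi U (phi x) = quo_pi U (phi g)] (ex_intro _ g erefl)).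
Qed.

Definition opnsub_preim : opnsub F :=
  OpnSub opnsub_preim_open opnsub_preim_normal opnsub_preim_finite.

Definition quo_map (q : quo opnsub_preim) : quo U := quo_pi U (phi (repr q)).

Lemma quo_mapE x : quo_map (quo_pi opnsub_preim x) = quo_pi U (phi x).
Proof.
apply/esym/quo_piE; rewrite -gmulfV -gmulfM.
by apply: (quo_piE opnsub_preim x _).1; rewrite quo_reprK.
Qed.

End PreimageOpnsub.

Definition cga_map (p : nat) (F G : topGroupType) (phi : contHomType F G)
  (x : cga p F) : cga p G.
Proof.
exists (fun U => galg_map (@quo_map F G phi U) (x (opnsub_preim phi U))) => U V VU.
rewrite /is_tr /= galg_map_comp.
have VU' y : opnsub_preim phi V y -> opnsub_preim phi U y by apply: VU.
rewrite -(il_coh x VU') /is_tr /= galg_map_comp; congr galg_map.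
apply/funext => q; rewrite -[q]quo_reprK quo_projE // !quo_mapE.
by rewrite quo_projE.
Defined.

Lemma cga_map_gel (p : nat) (F G : topGroupType) (phi : contHomType F G) g :
  cga_map phi (gel p g) = gel p (phi g).
Proof. by apply: invlimP => U; rewrite /= galg_map_delta quo_mapE. Qed.

Section Ideals.
Variable A : nzRingType.

Fixpoint ideal_pow (I : set A) (n : nat) : set A :=
  if n is m.+1 then
    [set x | exists k (a b : 'I_k -> A),
       [/\ forall i, I (a i), forall i, ideal_pow I m (b i) &
           x = \sum_i a i * b i]]
  else setT.

End Ideals.

(* W / W' has a basis of n elements; W' is meant to be a subspace of W. *)
Definition has_dim_quo (K : fieldType) (V : lmodType K) (W W' : set V) (n : nat) :=
  exists2 b : 'I_n -> V, forall i, W (b i) &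
    forall v, W v -> exists! c : {ffun 'I_n -> K}, W' (v - \sum_i c i *: b i).

(* 0 when W / W' is infinite dimensional. *)
Definition dim_quo (K : fieldType) (V : lmodType K) (W W' : set V) : nat :=
  xget 0%N [set n | has_dim_quo W W' n].

(* The same for an elementary abelian p-group H / H', written
   multiplicatively. *)
Definition has_gdim_quo (p : nat) (G : groupType) (H H' : set G) (n : nat) :=
  exists2 b : 'I_n -> G, forall i, H (b i) &
    forall h, H h -> exists! c : {ffun 'I_n -> 'I_p},
      H' ((\prod_i b i ^+ c i)^-1 * h)%g.

Definition gdim_quo (p : nat) (G : groupType) (H H' : set G) : nat :=
  xget 0%N [set n | has_gdim_quo p H H' n].

(* F_p<<x_0, ..., x_(d-1)>> : a word w in the letters 'I_d stands for the
   monomial obtained by multiplying its letters from left to right. *)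
Definition ncps (p d : nat) := seq 'I_d -> 'F_p.

Section NCPowerSeries.
Variables p d : nat.
Implicit Types (f g h : ncps p d) (w : seq 'I_d).

HB.instance Definition _ := GRing.Zmodule.copy (ncps p d) (seq 'I_d -> 'F_p).

Let mul f g : ncps p d :=
  fun w => \sum_(k < (size w).+1) f (take k w) * g (drop k w).
Let one : ncps p d := fun w => (w == [::])%:R.

Let mulA : associative mul.
Proof.
move=> f g h; apply/funext => w; rewrite /mul.
transitivity (\sum_(0 <= k < (size w).+1) \sum_(k <= m < (size w).+1)
   f (take k w) * (g (drop k (take m w)) * h (drop m w))).
  rewrite big_mkord; apply: eq_bigr => k _; rewrite big_distrr /=.
  have kw : (k <= size w)%N by rewrite -ltnS.
  have sh (F : nat -> 'F_p) : \sum_(k <= m < (size w).+1) F m =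
      \sum_(l < (size w - k).+1) F (l + k)%N.
    by rewrite -{1}[val k]add0n big_addn subSn // big_mkord.
  rewrite sh size_drop.
  by apply: eq_bigr => l _; rewrite take_drop drop_drop addnC.
rewrite big_mkord; under eq_bigr do rewrite big_geq_mkord /=.
rewrite (exchange_big_dep predT) //=; apply: eq_bigr => m _.
rewrite big_distrl /= (size_takel (ltnSE (ltn_ord m))).
rewrite (big_ord_widen (size w).+1 (fun k =>
  f (take k (take m w)) * g (drop k (take m w)) * h (drop m w))) //.
apply: eq_big => [k|k /= km]; first by rewrite ltnS.
by rewrite take_takel // mulrA.
Qed.

Let mul1 : left_id one mul.
Proof.
move=> f; apply/funext => w; rewrite /mul big_ord_recl /= take0 drop0.
rewrite /one eqxx mul1r big1 ?addr0 // => i _.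
by rewrite /bump /= add1n -size_eq0 (size_takel (ltn_ord i)) mul0r.
Qed.

Let mul1' : right_id one mul.
Proof.
move=> f; apply/funext => w; rewrite /mul big_ord_recr /= take_size drop_size.
rewrite /one eqxx mulr1 big1 ?add0r // => i _.
by rewrite -size_eq0 size_drop subn_eq0 leqNgt ltn_ord mulr0.
Qed.

Let mulDl : left_distributive mul +%R.
Proof.
move=> f g h; apply/funext => w; rewrite /mul -[RHS]big_split /=.
by apply: eq_bigr => k _; rewrite -mulrDl.
Qed.

Let mulDr : right_distributive mul +%R.
Proof.
move=> f g h; apply/funext => w; rewrite /mul -[RHS]big_split /=.
by apply: eq_bigr => k _; rewrite -mulrDr.
Qed.

Let one_neq0 : one != 0.
Proof.
by apply/eqP => /(congr1 (fun f : ncps p d => f [::])) /eqP; rewrite oner_eq0.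
Qed.

HB.instance Definition _ := GRing.Zmodule_isNzRing.Build (ncps p d)
  mulA mul1 mul1' mulDl mulDr one_neq0.

Lemma ncpsME f g w :
  (f * g) w = \sum_(k < (size w).+1) f (take k w) * g (drop k w).
Proof. by []. Qed.

Definition ncX (j : 'I_d) : ncps p d := fun w => (w == [:: j])%:R.

Definition fox (j : 'I_d) f : ncps p d := fun w => f (rcons w j).

(* The Fox derivatives are characterised by f = \sum_j (df/dx_j) x_j for f
   without constant term. *)
Lemma foxE f : f [::] = 0 -> f = \sum_j fox j f * ncX j.
Proof.
move=> f0; apply/funext => w.
have -> : (\sum_j fox j f * ncX j) w = \sum_j (fox j f * ncX j) w.
  by elim/big_rec2: _ => // j x y _ <-.
case/lastP: w => [|w j].
  rewrite f0 big1 // => j _; rewrite ncpsME big_ord_recl big_ord0 /=.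
  by rewrite /ncX /= mulr0 addr0.
have E i : (fox i f * ncX i) (rcons w j) = (i == j)%:R * f (rcons w i).
  rewrite ncpsME size_rcons.
  rewrite (bigD1 (Ordinal (ltnW (ltnSn (size w).+1)))) //= big1 ?addr0.
    rewrite -cats1 take_size_cat // drop_size_cat // /fox /ncX eqseq_cons andbT.
    by rewrite mulrC eq_sym.
  move=> k /eqP kw; rewrite /ncX; case: eqP; rewrite ?mulr0 // => /(congr1 size).
  rewrite size_drop size_rcons /= => h; case: kw; apply: val_inj => /=.
  by have kw := ltn_ord k; rewrite -(subKn (ltnSE kw)) h subn1.
rewrite (bigD1 j) //= E eqxx mul1r big1 ?addr0 // => i ij.
by rewrite E (negPf ij) mul0r.
Qed.
End NCPowerSeries.

Section PadicIntegers.
Variable p : nat.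

Let md i := (Zp_trunc (p ^ i.+1)).+2.

Let md_dvd i j : (i <= j)%N -> (md i %| md j)%N.
Proof.
move=> ij; rewrite /md; case: p => [|[|q]]; rewrite ?exp0n // ?exp1n //.
have gt1 k : (1 < q.+2 ^ k.+1)%N by rewrite -{1}(exp1n k.+1) ltn_exp2r.
by rewrite !Zp_cast ?dvdn_exp2l.
Qed.

Let tr i j (x : 'Z_(p ^ j.+1)) : 'Z_(p ^ i.+1) := (x : nat)%:R.

Let tr_nat i j n : (i <= j)%N -> tr i (n%:R : 'Z_(p ^ j.+1)) = n%:R.
Proof.
move=> ij; rewrite /tr !Zp_nat; apply: val_inj => /=.
by rewrite modn_dvdm // md_dvd.
Qed.

Let trD i j : (i <= j)%N -> {morph @tr i j : x y / x + y}.
Proof.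
move=> ij x y; rewrite -[x]natr_Zp -[y]natr_Zp -natrD !tr_nat //.
by rewrite natrD.
Qed.

Let trM i j : (i <= j)%N -> {morph @tr i j : x y / x * y}.
Proof.
move=> ij x y; rewrite -[x]natr_Zp -[y]natr_Zp -natrM !tr_nat //.
by rewrite natrM.
Qed.

Let trB i j : (i <= j)%N -> {morph @tr i j : x y / x - y}.
Proof.
by move=> ij x y; apply/(addIr (tr i y)); rewrite -trD // !subrK.
Qed.

Let tr1 i j : (i <= j)%N -> @tr i j 1 = 1.
Proof. by move=> ij; rewrite -[1]/(1%:R) tr_nat. Qed.

Definition padic_sys : invsys := @InvSys nat (fun i => 'Z_(p ^ i.+1))
  (fun i j => (i <= j)%N) tr 0%N trB trM tr1.

(* Z_p when p is prime; the indices start at Z/p because 'Z_1 is not trivial. *)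
Definition padic := invlim padic_sys.
HB.instance Definition _ := GRing.NzRing.on padic.

Let mulC : commutative (@GRing.mul padic).
Proof.
by move=> x y; apply: invlimP => i; apply: (@mulrC 'Z_(p ^ i.+1)).
Qed.
HB.instance Definition _ := GRing.PzRing_hasCommutativeMul.Build padic mulC.

Definition padic_dvd (N : nat) (x : padic) := exists y, x = (p ^ N)%:R * y.

End PadicIntegers.

Section Analytic.
Variable p : nat.
Local Notation Zp := (padic p).

(* Near y, f is given by a power series over Q_p converging on p^h Z_p^m:
   coordinate j of f (y + p^h x) is p^(-k) \sum_alpha a_alpha x^alpha
   for all x in Z_p^m, where the a_alpha in Z_p tend to 0 (a family over Q_p
   tending to 0 is bounded, hence of this form). The values of f away from a
   neighbourhood of y are irrelevant. *)
Definition analytic_at m n (f : 'rV[Zp]_m -> 'rV[Zp]_n) (y : 'rV[Zp]_m) :=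
  exists h : nat, forall j : 'I_n,
  exists (k : nat) (a : ('I_m -> nat) -> Zp),
    (forall N, exists D, forall alpha,
       (exists i, (D <= alpha i)%N) -> padic_dvd N (a alpha)) /\
    (forall (x : 'rV[Zp]_m) N, exists D0, forall D, (D0 <= D)%N ->
       padic_dvd N ((p ^ k)%:R * f (y + (p ^ h)%:R *: x) 0 j -
         \sum_(alpha : {ffun 'I_m -> 'I_D})
            a (fun i => alpha i) * \prod_i x 0 i ^+ alpha i)).

Variable G : topGroupType.

(* A chart g |-> chart_map g from chart_dom to an open subset of Z_p^m, with
   inverse chart_inv; both maps are total, with junk values outside. *)
Record chart (m : nat) := Chart {
  chart_dom : set G;
  chart_map : G -> 'rV[Zp]_m;
  chart_inv : 'rV[Zp]_m -> G }.

(* chart_dom is open, its image is open, and chart_map is a homeomorphism onto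
   its image with inverse chart_inv; the y + p^h Z_p^m form a basis of
   neighbourhoods of y in Z_p^m. *)
Definition is_chart m (c : chart m) :=
  [/\ open (chart_dom c),
      forall g, chart_dom c g -> chart_inv c (chart_map c g) = g,
      forall g h, chart_dom c g ->
        \forall g' \near g, exists x, chart_map c g' = chart_map c g + (p ^ h)%:R *: x &
      forall g (W : set G), chart_dom c g -> nbhs g W ->
        exists h, forall x, exists g',
          [/\ chart_dom c g', W g' & chart_map c g' = chart_map c g + (p ^ h)%:R *: x]].

Definition padic_analytic :=
  exists (m : nat) (atlas : set (chart m)),
  [/\ forall c, atlas c -> is_chart c,
      forall g, exists2 c, atlas c & chart_dom c g,
      forall c c' g, atlas c -> atlas c' -> chart_dom c g -> chart_dom c' g ->
        analytic_at (fun z => chart_map c' (chart_inv c z)) (chart_map c g),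
      forall c1 c2 c3 g h, atlas c1 -> atlas c2 -> atlas c3 ->
        chart_dom c1 g -> chart_dom c2 h -> chart_dom c3 (g * h)%g ->
        analytic_at (fun z : 'rV[Zp]_(m + m) => chart_map c3
            (chart_inv c1 (lsubmx z) * chart_inv c2 (rsubmx z))%g)
          (row_mx (chart_map c1 g) (chart_map c2 h)) &
      forall c1 c2 g, atlas c1 -> atlas c2 ->
        chart_dom c1 g -> chart_dom c2 g^-1%g ->
        analytic_at (fun z => chart_map c2 (chart_inv c1 z)^-1%g)
          (chart_map c1 g)].

End Analytic.

Section ProP.
Variable p : nat.

Definition pro_p (G : topGroupType) :=
  [/\ compact [set: G], hausdorff_space G,
      forall V : set G, nbhs 1%g V ->
        exists2 H : set G, is_subgroup H & open H /\ H `<=` V &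
      forall U : opnsub G, p.-nat #|{: quo U}|].

Definition free_pro_p (F : topGroupType) (d : nat) (sigma : 'I_d -> F) :=
  pro_p F /\
  forall (P : topGroupType) (u : 'I_d -> P), pro_p P ->
    exists f : contHomType F P, (forall j, f (sigma j) = u j) /\
      forall f' : contHomType F P, (forall j, f' (sigma j) = u j) -> f' =1 f.

Definition min_top_gen (G : topGroupType) (d : nat) (s : 'I_d -> G) :=
  closure (subgroup_gen (range s)) = setT /\
  forall j, closure (subgroup_gen (s @` [set i | i != j])) <> setT.

Definition minimal_presentation (F G : topGroupType) (d : nat)
    (sigma : 'I_d -> F) (phi : contHomType F G) :=
  [/\ free_pro_p sigma, set_surj setT setT phi &
      min_top_gen (fun j => phi (sigma j))].

Definition dimsub (H : topGroupType) (n : nat) : set H :=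
  [set h | ideal_pow (@aug_ideal p H) n (gel p h - 1)].

Definition is_level (H : topGroupType) (h : H) (n : nat) :=
  dimsub n h /\ forall m, dimsub m h -> (m <= n)%N.

(* The images of the rho i, i in S, form a minimal generating system of
   R F_(n+1) / F_(n+1) as a normal subgroup of F / F_(n+1); this is expressed
   in F through the correspondence theorem. *)
Definition min_normal_gen (F : topGroupType) (R : set F) (n r : nat)
    (rho : 'I_r -> F) (S : set 'I_r) :=
  let RF := [set z | exists x y, [/\ R x, dimsub n.+1 y & z = (x * y)%g]] in
  normal_gen (rho @` S `|` @dimsub F n.+1) = RF /\
  forall i, S i -> normal_gen (rho @` (S `\ i) `|` @dimsub F n.+1) <> RF.

(* S_n = [set rho i | v i <= n], where v i is the level of rho i. *)
Definition relation_system (F G : topGroupType) (phi : contHomType F G)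
    (r : nat) (rho : 'I_r -> F) (v : 'I_r -> nat) :=
  let R := [set x | phi x = 1%g] in
  [/\ forall i, R (rho i),
      forall i, rho i != 1%g /\ is_level (rho i) (v i) &
      forall n, (1 <= n)%N -> min_normal_gen R n rho [set i | (v i <= n)%N]].

(* The identification of F_p<<x_0, ..., x_(d-1)>> with F_p[[F]]; it is
   determined by its values on the 1 + x_j. *)
Definition magnus_iso (F : topGroupType) (d : nat) (sigma : 'I_d -> F)
    (theta : {rmorphism ncps p d -> cga p F}) :=
  bijective theta /\ forall j, theta (1 + ncX p j) = gel p (sigma j).

End ProP.

(* Continuous cochains with values in the trivial module F_p. *)
Section Cohomology.
Variables (p : nat) (G : topGroupType).

Definition locally_constant (T : topologicalType) (S : Type) (f : T -> S) :=
  forall x, \forall y \near x, f y = f x.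

Definition Z2 : set (G * G -> ('F_p)^o) :=
  [set f | locally_constant f /\ forall x y z,
    f (y, z) - f (x * y, z)%g + f (x, y * z)%g - f (x, y) = 0].

Definition B2 : set (G * G -> ('F_p)^o) :=
  [set f | exists2 u : G -> 'F_p, locally_constant u &
    forall x y, f (x, y) = u y - u (x * y)%g + u x].

Definition dimH2 : nat := dim_quo Z2 B2.

End Cohomology.

Section Invariants.
Variables (p : nat) (G : topGroupType).
Local Notation I := (@aug_ideal p G).

Definition dim_a (n : nat) : nat := gdim_quo p (@dimsub p G n) (@dimsub p G n.+1).

Definition dim_c (n : nat) : nat := dim_quo [set: cga p G] (ideal_pow I n).

(* ker J_n is a subspace of \bigoplus_i F_p[[G]] / I^(n - v i): it is the
   quotient of its preimage in F_p[[G]]^r by \bigoplus_i I^(n - v i). The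
   truncated subtraction accounts for I^m = F_p[[G]] when m <= 0. *)
Definition dim_e (r d : nat) (v : 'I_r -> nat) (J : 'I_r -> 'I_d -> cga p G)
    (n : nat) : nat :=
  dim_quo
    [set g : {ffun 'I_r -> cga p G} |
      forall j, ideal_pow I n.-1 (\sum_i g i * J i j)]
    [set g : {ffun 'I_r -> cga p G} | forall i, ideal_pow I (n - v i) (g i)].

End Invariants.

Definition Pfac (R : realType) (p n : nat) (t : R) : R :=
  (1 - t ^+ n) / (1 - t ^+ (n * p)).

(* Main.v *)
(* With I the augmentation ideal and h_n = dim I^n/I^(n+1), the theorem is the
   sum of three facts. First (Jennings), the series of the h_n is the product of
   the P_n^(-a_n): in the finite quotient by a dimension subgroup, adding one
   generator x of weight w to a normal subgroup of index p multiplies the Hilbert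
   polynomial by 1 + X^w + ... + X^((p-1)w). Second (Fox, Lyndon), the complex
   F_p[[G]]^r -> F_p[[G]]^d -> I -> 0 is exact, compatibly with the filtrations, so
   e_n + d c_(n-1) + 1 = sum_i c_(n - v_i) + c_n. Third (Lazard), c_n grows
   polynomially for analytic G: p-th powers in a chart around 1 show that
   p^(i + k) Z_p^m lies in the p^k-th dimension subgroup for a fixed i, so that its
   index is at most C p^(mk). Compactness arguments over the open normal subgroups
   are done with an ultrafilter. *)
From HB Require Import structures.
Require Import Defs.
From mathcomp Require Import finmap.
From mathcomp Require Import all_boot all_order all_fingroup all_algebra all_solvable generic_quotient.
From mathcomp Require Import all_classical all_reals all_analysis.
From mathcomp Require Import ring lra zify.
Set Implicit Arguments.
Unset Strict Implicit.
Unset Printing Implicit Defensive.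
Import Order.TTheory GRing.Theory Num.Theory.
Import numFieldNormedType.Exports.
Local Open Scope classical_set_scope.
Local Open Scope ring_scope.

(** * Dimensions of quotients *)

Section DimQuo.
Variable K : fieldType.

(** Let C, H, E be the generating series of c_n, h_n, e_n. Then (1 - t) C = t H, and summing the
    dimension relation over n >= 1 gives E = (sum r_k t^k - d t + 1) C - t / (1 - t). Division by C
    turns the last term into 1 / H, which is the infinite product. The growth bound makes C converge
    for every t < 1, and the other series inherit convergence from C. The main obstacle is that
    [ideal_pow] is purely algebraic: it consists of finite sums of products, without any closure,
    while F_p[[G]] is known through its finite quotients. Finite generation bridges the gap:
    elements of I^(n+1) are combinations of d fixed elements with coefficients in I^n, so
    compactness shows that I^n is closed, and finite codimension over a finite field then makes it
    open. After that, statements modulo I^n can be checked on finite sums of group elements.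
    Quotients of infinite-dimensional spaces are never formed: dimensions belong to pairs W' inside
    W, and exactness becomes a comparison of such pairs. *)

Definition is_subspace (V : lmodType K) (W : set V) :=
  W 0 /\ forall k x y, W x -> W y -> W (k *: x + y).

Section Subspace.
Variables (V : lmodType K) (W : set V).
Hypothesis sW : is_subspace W.

Lemma subspaceD x y : W x -> W y -> W (x + y).
Proof. by move=> Wx Wy; rewrite -[x]scale1r; apply: sW.2. Qed.

Lemma subspaceZ k x : W x -> W (k *: x).
Proof. by move=> Wx; rewrite -[_ *: _]addr0; apply: sW.2 => //; apply: sW.1. Qed.

Lemma subspaceN x : W x -> W (- x).
Proof. by rewrite -scaleN1r; apply: subspaceZ. Qed.

Lemma subspaceB x y : W x -> W y -> W (x - y).
Proof. by move=> Wx Wy; apply: subspaceD => //; apply: subspaceN. Qed.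

Lemma subspace_sum (I : Type) (r : seq I) (P : pred I) (F : I -> V) :
  (forall i, P i -> W (F i)) -> W (\sum_(i <- r | P i) F i).
Proof. by move=> h; elim/big_ind: _ => //; [apply: sW.1 | apply: subspaceD]. Qed.

Lemma subspace_subr x y : W (x - y) -> W x <-> W y.
Proof.
move=> Wxy; split=> [Wx|Wy]; last by rewrite -(subrK y x); apply: subspaceD.
by rewrite -[y](subKr x); apply: subspaceB.
Qed.

End Subspace.

Lemma subspace_preim (V V' : lmodType K) (T : {linear V -> V'}) (W : set V') :
  is_subspace W -> is_subspace (T @^-1` W).
Proof.
move=> sW; split=> [|k x y Wx Wy] /=; rewrite ?linear0; first exact: sW.1.
by rewrite linearP; apply: sW.2.
Qed.

Lemma subspace_setT (V : lmodType K) : is_subspace [set: V].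
Proof. by []. Qed.

Lemma subspace_set0 (V : lmodType K) : is_subspace [set x : V | x = 0].
Proof. by split=> //= k x y -> ->; rewrite scaler0 addr0. Qed.

Section Coordinates.
Variables (V : lmodType K) (W W' : set V).
Hypotheses (sW : is_subspace W) (sW' : is_subspace W').

(** An isomorphism of W / W' with K^n, given as a function on all of V with arbitrary values outside
    W; neither W nor the quotient has to become a type. *)
Definition coordinates n (L : V -> 'rV[K]_n) :=
  [/\ forall k x y, W x -> W y -> L (k *: x + y) = k *: L x + L y,
      forall x, W x -> L x = 0 <-> W' x &
      forall c, exists2 x, W x & L x = c].

Lemma coordinates0 n (L : V -> 'rV[K]_n) : coordinates L -> L 0 = 0.
Proof. by move=> [_ h _]; apply/h; [apply: sW.1 | apply: sW'.1]. Qed.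

Lemma coordinates_sum n (L : V -> 'rV[K]_n) (T : Type) (r : seq T) (c : T -> K) b :
  coordinates L -> (forall t, W (b t)) ->
  L (\sum_(t <- r) c t *: b t) = \sum_(t <- r) c t *: L (b t).
Proof.
move=> cL Wb; elim: r => [|t r IH]; first by rewrite !big_nil (coordinates0 cL).
have [lin _ _] := cL; rewrite !big_cons lin ?IH //.
by apply: subspace_sum => // i _; apply: subspaceZ.
Qed.

Lemma coordinatesB n (L : V -> 'rV[K]_n) x y :
  coordinates L -> W x -> W y -> L (x - y) = L x - L y.
Proof. by move=> [lin _ _] Wx Wy; rewrite addrC -scaleN1r lin // scaleN1r addrC. Qed.

Lemma has_dim_fin (T : finType) (b : T -> V) : (forall t, W (b t)) ->
  (forall v, W v -> exists! c : {ffun T -> K}, W' (v - \sum_t c t *: b t)) ->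
  has_dim_quo W W' #|T|.
Proof.
move=> Wb h; exists (fun i => b (enum_val i)) => // v /h [c [hc uc]].
have sumE (c' : {ffun 'I_#|T| -> K}) : \sum_i c' i *: b (enum_val i) =
    \sum_t [ffun t => c' (enum_rank t)] t *: b t.
  rewrite (reindex (@enum_val T (mem T))) /=.
    by apply: eq_bigr => i _; rewrite ffunE enum_valK.
  by apply: onW_bij; apply: enum_val_bij.
exists [ffun i => c (enum_val i)]; split=> [|c']; rewrite sumE.
  set e := [ffun t => _]; suff -> : e = c by [].
  by apply/ffunP => t; rewrite !ffunE enum_rankK.
by move=> /uc ->; apply/ffunP => i; rewrite !ffunE enum_valK.
Qed.

(** Coefficients in a basis are unique, so choosing them is linear in the vector; conversely,
    preimages of the standard basis vectors form a basis. This makes matrices available for W /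
    W'. *)
Lemma has_dim_coordinates n :
  has_dim_quo W W' n <-> exists L : V -> 'rV[K]_n, coordinates L.
Proof.
split=> [[b Wb h]|[L cL]].
  have h' v : exists c : {ffun 'I_n -> K}, W v -> W' (v - \sum_i c i *: b i).
    have [/h [c [hc _]]|nWv] := pselect (W v); first by exists c.
    by exists [ffun=> 0].
  have {h'} [c hc] := choice h'.
  have cE v (e : {ffun 'I_n -> K}) : W v -> W' (v - \sum_i e i *: b i) -> c v = e.
    move=> Wv W'e; have [e' [_ u]] := h v Wv.
    by rewrite -(u _ W'e) -(u _ (hc _ Wv)).
  exists (fun v => \row_i c v i); split=> [k x y Wx Wy|x Wx|e].
  - rewrite (cE _ [ffun i => k * c x i + c y i]).
    + by apply/rowP => i; rewrite !mxE ffunE.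
    + exact: sW.2.
    + under eq_bigr do rewrite ffunE scalerDl -scalerA.
      rewrite big_split -scaler_sumr /= opprD addrACA -scalerBr.
      by apply: sW'.2; apply: hc.
  - split=> [x0|W'x].
      have := hc _ Wx; rewrite big1 ?subr0 // => i _.
      by have /rowP/(_ i) := x0; rewrite !mxE => ->; rewrite scale0r.
    rewrite (cE _ [ffun=> 0]) //; first by apply/rowP => i; rewrite !mxE ffunE.
    by rewrite big1 ?subr0 // => i _; rewrite ffunE scale0r.
  - exists (\sum_i e 0 i *: b i).
      by apply: subspace_sum => // i _; apply: subspaceZ.
    rewrite (cE _ [ffun i => e 0 i]).
    + by apply/rowP => i; rewrite !mxE ffunE.
    + by apply: subspace_sum => // i _; apply: subspaceZ.
    + under [X in _ - X]eq_bigr do rewrite ffunE.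
      by rewrite subrr; apply: sW'.1.
have [lin ker sur] := cL.
have [b Wb bE] : exists2 b : 'I_n -> V, forall i, W (b i) &
    forall i, L (b i) = delta_mx 0 i.
  have [b hb] := choice (fun i => (exists2P _ _).1 (sur (delta_mx 0 i))).
  by exists b => i; have [] := hb i.
have LE (c : 'I_n -> K) : L (\sum_i c i *: b i) = \row_i c i.
  rewrite (coordinates_sum _ _ cL) // [RHS]row_sum_delta.
  by apply: eq_bigr => i _; rewrite bE mxE.
have WS (c : 'I_n -> K) : W (\sum_i c i *: b i).
  by apply: subspace_sum => // i _; apply: subspaceZ.
exists b => // v Wv; exists [ffun i => L v 0 i]; split=> [|c].
  apply/ker; first exact: subspaceB.
  rewrite coordinatesB // LE; apply/eqP; rewrite subr_eq0; apply/eqP/rowP => i.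
  by rewrite mxE ffunE.
move=> /ker; rewrite coordinatesB // LE => /(_ (subspaceB sW Wv (WS _))) /eqP.
rewrite subr_eq0 => /eqP LvE; apply/ffunP => i.
by rewrite ffunE LvE mxE.
Qed.

Lemma has_dim_le n m : has_dim_quo W W' n -> has_dim_quo W W' m -> (n <= m)%N.
Proof.
move=> [b Wb hb] /has_dim_coordinates [L cL]; have [lin ker sur] := cL.
pose M := \matrix_(i < n) L (b i).
suff : row_free M by move=> /eqP <-; apply: rank_leq_col.
apply/row_freeP; rewrite -/(row_free _); apply/row_freeP; rewrite -kermx_eq0.
apply/rowV0P => u /sub_kermxP uM.
have uE : u *m M = L (\sum_i u 0 i *: b i).
  rewrite (coordinates_sum _ _ cL) // mulmx_sum_row.
  by apply: eq_bigr => i _; rewrite rowK.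
have WS : W (\sum_i u 0 i *: b i).
  by apply: subspace_sum => // i _; apply: subspaceZ.
have W'S : W' (\sum_i u 0 i *: b i) by apply/ker => //; rewrite -uE.
(* A relation among the rows L (b i) gives a second expansion of 0 modulo W'; uniqueness kills its
   coefficients. *)
have [c [_ uc]] := hb 0 sW.1.
have e1 : c = [ffun=> 0].
  apply: uc; rewrite big1 ?subr0; first exact: sW'.1.
  by move=> i _; rewrite ffunE scale0r.
have e2 : c = [ffun i => - u 0 i].
  apply: uc; under eq_bigr do rewrite ffunE scaleNr.
  by rewrite sumrN opprK add0r.
apply/rowP => i; move: e2; rewrite e1 => /ffunP /(_ i).
by rewrite !ffunE mxE => /eqP; rewrite eq_sym oppr_eq0 => /eqP.
Qed.

End Coordinates.

Lemma has_dim_uniq (V : lmodType K) (W W' : set V) n m :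
  is_subspace W -> is_subspace W' ->
  has_dim_quo W W' n -> has_dim_quo W W' m -> n = m.
Proof.
by move=> sW sW' hn hm; apply/eqP; rewrite eqn_leq; apply/andP; split;
  apply: (has_dim_le sW sW').
Qed.

Lemma dim_quoE (V : lmodType K) (W W' : set V) n :
  is_subspace W -> is_subspace W' -> has_dim_quo W W' n -> dim_quo W W' = n.
Proof.
move=> sW sW' hn; apply: (has_dim_uniq sW sW') => //.
exact: (@xgetPex _ 0%N [set n | has_dim_quo W W' n] (ex_intro _ n hn)).
Qed.

(** Ranks are bounded by n, so some matrix with row space inside S has maximal rank; a vector of S
    outside its row space could be adjoined and would raise the rank. *)
Lemma subspace_row_space n (S : set 'rV[K]_n) : is_subspace S ->
  exists A : 'M[K]_n, forall u, S u <-> (u <= A)%MS.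
Proof.
move=> sS.
pose P k := `[< exists2 A : 'M[K]_n, \rank A = k & forall u, (u <= A)%MS -> S u >].
have exP : exists k, P k.
  exists 0%N; apply/asboolP; exists 0; first exact: mxrank0.
  by move=> u; rewrite submx0 => /eqP ->; apply: sS.1.
have ubP k : P k -> (k <= n)%N by move=> /asboolP [A <- _]; apply: rank_leq_col.
have [k /asboolP [A rA SA] kmax] := ex_maxnP exP ubP.
exists A => u; split=> [Su|]; last exact: SA.
have : P (\rank (A + u)%MS).
  apply/asboolP; exists (A + u)%MS => // w /sub_addsmxP [[w1 w2] ->] /=.
  apply: subspaceD => //; first by apply: SA; apply: submxMl.
  have /sub_rVP [a ->] : (w2 *m u <= u)%MS by apply: submxMl.
  exact: subspaceZ.
move=> /kmax; rewrite -rA => le.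
have := mxrank_leqif_sup (addsmxSl A u); move=> [_ ].
by rewrite eqn_leq le (mxrankS (addsmxSl A u)) => /esym; rewrite addsmx_sub => /andP[].
Qed.

(** The image of W1 in the coordinate space of W / W' is the row space of some A. Coordinates on W1
    / W' come from a row basis of A, those on W / W1 from a column basis of its cokernel matrix, and
    the two ranks add up to n. *)
Lemma has_dim_tower (V : lmodType K) (W W1 W' : set V) n :
  is_subspace W -> is_subspace W1 -> is_subspace W' -> W' `<=` W1 -> W1 `<=` W ->
  has_dim_quo W W' n -> exists a b,
    [/\ has_dim_quo W1 W' a, has_dim_quo W W1 b & n = (a + b)%N].
Proof.
move=> sW sW1 sW' W'1 W1W.
move=> /(has_dim_coordinates sW sW') [L cL].
have [lin ker sur] := cL.
have sS : is_subspace (L @` W1).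
  split; first by exists 0; [apply: sW1.1 | apply: (coordinates0 sW sW' cL)].
  move=> k _ _ [x Wx <-] [y Wy <-]; exists (k *: x + y); first exact: sW1.2.
  by rewrite lin //; apply: W1W.
have [A hA] := subspace_row_space sS.
exists (\rank A), (\rank (cokermx A)); split.
- apply/(has_dim_coordinates sW1 sW').
  exists (fun x => L x *m pinvmx (row_base A)).
  have LA x : W1 x -> L x *m pinvmx (row_base A) *m row_base A = L x.
    by move=> Wx; apply: mulmxKpV; rewrite eq_row_base; apply/hA; exists x.
  split=> [k x y Wx Wy|x Wx|c].
  + by rewrite lin ?mulmxDl ?scalemxAl //; apply: W1W.
  + split=> [L0|/ker ->]; [|by rewrite mul0mx|exact: W1W].
    by apply/ker; [apply: W1W | rewrite -(LA _ Wx) L0 mul0mx].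
  + have /hA [x Wx xE] : (c *m row_base A <= A)%MS.
      by rewrite -(eq_row_base A) submxMl.
    exists x => //; apply: (row_free_inj (row_base_free A)).
    by rewrite LA.
- apply/(has_dim_coordinates sW sW1).
  exists (fun x => L x *m col_base (cokermx A)).
  split=> [k x y Wx Wy|x Wx|c].
  + by rewrite lin ?mulmxDl ?scalemxAl.
  + rewrite (_ : L x *m col_base (cokermx A) = 0 <-> (L x <= A)%MS); last first.
      have E : L x *m cokermx A = L x *m col_base (cokermx A) *m row_base (cokermx A).
        by rewrite -mulmxA mulmx_base.
      rewrite submxE E; split=> [->|/eqP h]; first by rewrite mul0mx.
      by apply: (row_free_inj (row_base_free (cokermx A))); rewrite /= h mul0mx.
    rewrite -hA; split=> [[y Wy yx]|Wx1]; last by exists x.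
    have Wy' := W1W _ Wy.
    apply/(subspace_subr sW1 (y := y)) => //; apply: W'1; apply/ker.
      exact: subspaceB.
    by rewrite (coordinatesB cL) // yx subrr.
  + have /row_fullP [B BE] : row_full (col_base (cokermx A)) by apply: col_base_full.
    have [x Wx xE] := sur (c *m B); exists x => //.
    by rewrite xE -mulmxA BE mulmx1.
- by rewrite mxrank_coker subnKC // rank_leq_row.
Qed.

(** The hypotheses say that T induces a well-defined, injective and surjective map from W1 / W1' to
    W2 / W2', so a basis is carried to a basis. *)
Lemma has_dim_transport (V1 V2 : lmodType K) (T : {linear V1 -> V2})
    (W1 W1' : set V1) (W2 W2' : set V2) n :
  is_subspace W2 -> is_subspace W2' -> W2' `<=` W2 ->
  (forall x, W1 x -> W2 (T x)) ->
  (forall x, W1 x -> W2' (T x) <-> W1' x) ->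
  (forall y, W2 y -> exists2 x, W1 x & W2' (y - T x)) ->
  is_subspace W1 ->
  has_dim_quo W1 W1' n -> has_dim_quo W2 W2' n.
Proof.
move=> sW2 sW2' W22 TW TW' Tsur sW1 [b Wb hb].
exists (T \o b) => [i|y Wy]; first exact: TW.
have [x Wx xy] := Tsur y Wy; have [c [hc uc]] := hb x Wx.
have E (e : {ffun 'I_n -> K}) :
    W2' (y - \sum_i e i *: (T \o b) i) <-> W1' (x - \sum_i e i *: b i).
  rewrite -TW'.
    have -> : T (x - \sum_i e i *: b i) = T x - \sum_i e i *: (T \o b) i.
      rewrite linearB linear_sum; congr (_ - _).
      by apply: eq_bigr => i _; rewrite linearZ.
    by apply: (subspace_subr sW2'); rewrite opprB addrA subrK.
  by apply: (subspaceB sW1) => //; apply: (subspace_sum sW1) => i _; apply: subspaceZ.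
by exists c; split=> [|e]; rewrite E => // /uc.
Qed.

(** The free space on T maps onto W modulo W', so W / W' is the quotient of K^T by the preimage of
    W', to which [has_dim_tower] applies. *)
Lemma has_dim_span (V : lmodType K) (W W' : set V) (T : finType) (b : T -> V) :
  is_subspace W -> is_subspace W' -> W' `<=` W -> (forall t, W (b t)) ->
  (forall v, W v -> exists c : T -> K, W' (v - \sum_t c t *: b t)) ->
  exists2 n, (n <= #|T|)%N & has_dim_quo W W' n.
Proof.
move=> sW sW' W'W Wb h.
pose f (c : {ffun T -> K^o}) := \sum_t c t *: b t.
have f_lin : linear f.
  move=> k x y; rewrite /f scaler_sumr -big_split /=; apply: eq_bigr => t _.
  by rewrite !ffunE scalerDl scalerA.
pose fL : {linear {ffun T -> K^o} -> V} :=
  HB.pack f (GRing.isLinear.Build _ _ _ _ f f_lin).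
have d0 : has_dim_quo [set: {ffun T -> K^o}] [set x | x = 0] #|T|.
  apply: (@has_dim_fin _ _ _ _ (fun t => [ffun s => (s == t)%:R])) => // v _.
  have E (c : {ffun T -> K}) : \sum_t c t *: [ffun s => (s == t)%:R : K^o] = c.
    apply/ffunP => s; rewrite sum_ffunE (bigD1 s) //= big1 ?addr0.
      by rewrite !ffunE eqxx /GRing.scale /= mulr1.
    by move=> t ts; rewrite !ffunE eq_sym (negPf ts) scaler0.
  exists v; split=> [/=|c /=]; rewrite E ?subrr // => /eqP.
  by rewrite subr_eq0 => /eqP.
have sf : is_subspace (fL @^-1` W') by apply: subspace_preim.
have [a [n [_ hn E]]] := has_dim_tower (@subspace_setT _) sf (@subspace_set0 _)
  (W' := [set x | x = 0])
  (fun x (x0 : x = 0) => eq_ind_r (fL @^-1` W') sf.1 x0) (fun x _ => Logic.I) d0.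
exists n; first by rewrite E leq_addl.
apply: (has_dim_transport (T := fL) sW sW' W'W _ _ _ (@subspace_setT _) hn) => [x _|x _|y Wy].
- by apply: subspace_sum => // t _; apply: subspaceZ.
- by [].
- have [c hc] := h y Wy; exists (finfun c) => //=; rewrite /f.
  by under eq_bigr do rewrite ffunE.
Qed.

(** The union of the two bases is only shown to span; this gives some finite dimension, whose value
    is then forced by [has_dim_tower] and uniqueness. *)
Lemma has_dim_add (V : lmodType K) (W W1 W' : set V) a b :
  is_subspace W -> is_subspace W1 -> is_subspace W' -> W' `<=` W1 -> W1 `<=` W ->
  has_dim_quo W1 W' a -> has_dim_quo W W1 b -> has_dim_quo W W' (a + b)%N.
Proof.
move=> sW sW1 sW' W'1 W1W ha hb.
have [||n _ hn] := @has_dim_span V W W' ('I_a + 'I_b)%type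
  (fun t => match t with inl i => s2val (cid2 ha) i | inr i => s2val (cid2 hb) i end)
  sW sW' (subset_trans W'1 W1W).
- case=> i; last by case: (cid2 hb).
  by apply: W1W; case: (cid2 ha).
- case: (cid2 ha) => /= ba Wa ca; case: (cid2 hb) => /= bb Wb cb v Wv.
  have [c [hc _]] := cb _ Wv; have [c' [hc' _]] := ca _ hc.
  exists (fun t => match t with inl i => c' i | inr i => c i end).
  by rewrite big_sumType /= addrC opprD addrA.
have [a' [b' [ha' hb' E]]] := has_dim_tower sW sW1 sW' W'1 W1W hn.
rewrite (has_dim_uniq sW1 sW' ha ha') (has_dim_uniq sW sW1 hb hb').
by rewrite -E.
Qed.

Lemma subspace_prod (V : lmodType K) (T : finType) (W : T -> set V) :
  (forall t, is_subspace (W t)) ->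
  is_subspace [set g : {ffun T -> V} | forall t, W t (g t)].
Proof.
move=> sW; split=> [t|k x y Wx Wy t] /=; rewrite !ffunE; first exact: (sW t).1.
exact: (sW t).2.
Qed.

Lemma has_dim_prod (V : lmodType K) r (W W' : 'I_r -> set V) (n : 'I_r -> nat) :
  (forall i, is_subspace (W i)) -> (forall i, is_subspace (W' i)) ->
  (forall i, has_dim_quo (W i) (W' i) (n i)) ->
  has_dim_quo [set g : {ffun 'I_r -> V} | forall i, W i (g i)]
    [set g : {ffun 'I_r -> V} | forall i, W' i (g i)] (\sum_i n i)%N.
Proof.
move=> sW sW' h.
pose b i := s2val (cid2 (h i)).
have b1 i := s2valP (cid2 (h i)); have b2 i := s2valP' (cid2 (h i)).
have -> : (\sum_i n i)%N = #|{: {i : 'I_r & 'I_(n i)}}|.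
  by rewrite card_tagged sumnE big_map big_enum /=; apply: eq_bigr => i _; rewrite card_ord.
pose B (t : {i : 'I_r & 'I_(n i)}) : {ffun 'I_r -> V} :=
  [ffun j => if tag t == j then b (tag t) (tagged t) else 0].
apply: (@has_dim_fin _ _ _ _ B) => [[i k] j|v Wv] /=.
  rewrite /B ffunE; case: eqP => [<-|_]; [exact: b1 | exact: (sW j).1].
have BE (c : {ffun {i : 'I_r & 'I_(n i)} -> K}) j :
    (\sum_t c t *: B t) j = \sum_(k < n j) c (Tagged _ k) *: b j k.
  rewrite sum_ffunE.
  rewrite (eq_bigr (fun t : {i : 'I_r & 'I_(n i)} => c (Tagged _ (tagged t)) *: B (Tagged _ (tagged t)) j)); last first.
    by move=> [i k] _; rewrite ffunE.
  rewrite -(sig_big_dep (fun=> true) (fun _ _ => true) (fun i (k : 'I_(n i)) => c (Tagged _ k) *: B (Tagged _ k) j)) /=.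
  rewrite (bigD1 j) //= [X in _ + X]big1 ?addr0.
    by apply: eq_bigr => k _; rewrite ffunE eqxx.
  by move=> i /negPf ij; rewrite big1 // => k _; rewrite ffunE /= ij scaler0.
pose c i := sval (cid (b2 i _ (Wv i))); have hc i := svalP (cid (b2 i _ (Wv i))).
exists [ffun t => c (tag t) (tagged t)]; split=> [i|c' hc'].
  rewrite !ffunE BE; under eq_bigr do rewrite ffunE /=.
  exact: (hc i).1.
apply/ffunP => -[i k]; rewrite ffunE /=.
have -> : c i = [ffun k : 'I_(n i) => c' (existT _ i k)]; last by rewrite ffunE.
apply: (hc i).2; under eq_bigr do rewrite ffunE.
by have := hc' i; rewrite !ffunE BE.
Qed.

End DimQuo.

(** * Powers of an ideal *)

Section IdealPow.
Variables (A : nzRingType) (I : set A).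

Definition two_sided (J : set A) :=
  [/\ J 0, forall x y, J x -> J y -> J (x - y),
      forall a x, J x -> J (a * x) & forall a x, J x -> J (x * a)].

Section TwoSided.
Variable J : set A.
Hypothesis tJ : two_sided J.

Lemma two_sided0 : J 0. Proof. by case: tJ. Qed.
Lemma two_sidedB x y : J x -> J y -> J (x - y). Proof. by case: tJ => _ h _ _; apply: h. Qed.
Lemma two_sidedN x : J x -> J (- x).
Proof. by rewrite -sub0r => Jx; apply: two_sidedB => //; apply: two_sided0. Qed.
Lemma two_sidedD x y : J x -> J y -> J (x + y).
Proof. by move=> Jx Jy; rewrite -[y]opprK; apply: two_sidedB => //; apply: two_sidedN. Qed.
Lemma two_sidedMl a x : J x -> J (a * x). Proof. by case: tJ => _ _ h _; apply: h. Qed.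
Lemma two_sidedMr a x : J x -> J (x * a). Proof. by case: tJ => _ _ _; apply. Qed.
Lemma two_sided_sum (T : Type) (r : seq T) (P : pred T) (F : T -> A) :
  (forall t, P t -> J (F t)) -> J (\sum_(t <- r | P t) F t).
Proof. by move=> h; elim/big_ind: _ => //; [apply: two_sided0 | apply: two_sidedD]. Qed.
Lemma two_sided_subr x y : J (x - y) -> J x <-> J y.
Proof.
move=> Jxy; split=> [Jx|Jy]; last by rewrite -(subrK y x); apply: two_sidedD.
by rewrite -[y](subKr x); apply: two_sidedB.
Qed.
Lemma two_sided_trans y x z : J (x - y) -> J (y - z) -> J (x - z).
Proof. by move=> Jxy Jyz; rewrite -(subrK y x) -addrA; apply: two_sidedD. Qed.
Lemma two_sided_sym x y : J (x - y) -> J (y - x).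
Proof. by move=> Jxy; rewrite -opprB; apply: two_sidedN. Qed.
Lemma two_sided_congD x y x' y' : J (x - y) -> J (x' - y') -> J (x + x' - (y + y')).
Proof. by move=> Jxy Jxy'; rewrite opprD addrACA; apply: two_sidedD. Qed.
End TwoSided.

Hypothesis tI : two_sided I.

Lemma ideal_powSM n a b : I a -> ideal_pow I n b -> ideal_pow I n.+1 (a * b).
Proof.
by move=> Ia Jb; exists 1%N, (fun=> a), (fun=> b); split=> //; rewrite big_ord1.
Qed.

Lemma ideal_pow_two_sided n : two_sided (ideal_pow I n).
Proof.
elim: n => [//|n IH] /=; split.
- by exists 0%N, (fun=> 0), (fun=> 0); split=> [[]|[]|] //; rewrite big_ord0.
- move=> _ _ [k [a [b [Ia Jb ->]]]] [l [c [d [Ic Jd ->]]]].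
  exists (k + l)%N, (fun i => match fintype.split i with inl j => a j | inr j => - c j end),
    (fun i => match fintype.split i with inl j => b j | inr j => d j end); split.
  + by move=> i; case: (fintype.split i) => j //; apply: two_sidedN.
  + by move=> i; case: (fintype.split i).
  + rewrite big_split_ord /=; congr (_ + _).
      by apply: eq_bigr => i _; rewrite (unsplitK (inl i)).
    by rewrite -sumrN; apply: eq_bigr => i _; rewrite (unsplitK (inr i)) mulNr.
- move=> e _ [k [a [b [Ia Jb ->]]]]; exists k, (fun i => e * a i), b; split=> //.
    by move=> i; apply: two_sidedMl.
  by rewrite big_distrr /=; apply: eq_bigr => i _; rewrite mulrA.
- move=> e _ [k [a [b [Ia Jb ->]]]]; exists k, a, (fun i => b i * e); split=> //.
    by move=> i; apply: two_sidedMr.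
  by rewrite big_distrl /=; apply: eq_bigr => i _; rewrite mulrA.
Qed.

Lemma ideal_powM m n x y :
  ideal_pow I m x -> ideal_pow I n y -> ideal_pow I (m + n)%N (x * y).
Proof.
elim: m x => [|m IH] x.
  by move=> _; apply: (two_sidedMl (ideal_pow_two_sided n)).
move=> [k [a [b [Ia Jb ->]]]] Jy; rewrite big_distrl addSn.
apply: (two_sided_sum (ideal_pow_two_sided (m + n)%N.+1)) => i _.
by rewrite /= -mulrA; apply: ideal_powSM => //; apply: (IH _ (Jb i) Jy).
Qed.

Lemma ideal_pow1 : ideal_pow I 1 = I.
Proof.
apply/seteqP; split=> x; last first.
  by move=> Ix; rewrite -[x]mulr1; apply: ideal_powSM.
move=> [k [a [b [Ia _ ->]]]]; apply: (two_sided_sum tI) => i _.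
exact: two_sidedMr.
Qed.

Lemma ideal_pow_le m n x : (m <= n)%N -> ideal_pow I n x -> ideal_pow I m x.
Proof.
elim: n m x => [|n IH] [|m] x // mn [k [a [b [Ia Jb ->]]]].
apply: (two_sided_sum (ideal_pow_two_sided m.+1)) => i _.
by apply: ideal_powSM => //; apply: IH (Jb i).
Qed.

Lemma ideal_powX m n x : ideal_pow I m x -> ideal_pow I (n * m)%N (x ^+ n).
Proof.
by move=> Jx; elim: n => // n IH; rewrite exprS mulSn; apply: ideal_powM.
Qed.

(** Powers grow by factors on the left while the generators stand on the right: expanding w in a
    product u w leaves coefficients u b in the next power. *)
Lemma ideal_pow_gen (d : nat) (x : 'I_d -> A) : (forall j, I (x j)) ->
  (forall a, I a -> exists b, a = \sum_j b j * x j) ->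
  forall n a, ideal_pow I n.+1 a ->
    exists2 b, (forall j, ideal_pow I n (b j)) & a = \sum_j b j * x j.
Proof.
move=> Ix gen; elim=> [|n IH] a.
  by rewrite ideal_pow1 => /gen[b ->]; exists b.
move=> [k [u [w [Iu Jw ->]]]].
have [b hb] := choice (fun i => (exists2P _ _).1 (IH _ (Jw i))).
exists (fun j => \sum_i u i * b i j) => [j|].
  apply: (two_sided_sum (ideal_pow_two_sided n.+1)) => i _.
  by apply: ideal_powSM => //; apply: (hb i).1.
under [RHS]eq_bigr do rewrite big_distrl /=.
rewrite exchange_big /=; apply: eq_bigr => i _; rewrite {1}(hb i).2 big_distrr /=.
by apply: eq_bigr => j _; rewrite mulrA.
Qed.

End IdealPow.

Lemma ideal_pow_morph (A B : nzRingType) (f : {rmorphism A -> B}) (I : set A) (J : set B) :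
  (forall x, I x -> J (f x)) -> forall n x, ideal_pow I n x -> ideal_pow J n (f x).
Proof.
move=> fI; elim=> // n IH _ [k [a [b [Ia Ib ->]]]].
exists k, (f \o a), (f \o b); split=> [i|i|]; [exact: fI (Ia i)|exact: IH (Ib i)|].
by rewrite rmorph_sum /=; apply: eq_bigr => i _; rewrite rmorphM.
Qed.

Lemma two_sided_subspace (K : fieldType) (A : algType K) (J : set A) :
  two_sided J -> is_subspace J.
Proof.
move=> tJ; split=> [|k x y Jx Jy]; first exact: (two_sided0 tJ).
by rewrite -[x]mul1r scalerAl; apply: (two_sidedD tJ) => //; apply: (two_sidedMl tJ).
Qed.

(** * Jennings' theorem for finite p-groups *)

Section GalgDelta.
Local Open Scope group_scope.
Variables (K : fieldType) (gT : finGroupType).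
Local Notation A := (galg K gT).
Local Notation "''d_' g" := (gdelta K g : A) (at level 8, g at level 2).

Lemma gdelta_mulE g (a : A) h : ('d_g * a)%R h = a (g^-1 * h)%g.
Proof.
rewrite galgME (bigD1 g) //= big1 => [|k /negPf kg]; first by rewrite ffunE eqxx mul1r addr0.
by rewrite ffunE kg mul0r.
Qed.

Lemma gdeltaM g h : 'd_(g * h)%g = ('d_g * 'd_h)%R.
Proof.
apply/ffunP => k; rewrite gdelta_mulE !ffunE.
by rewrite -(inj_eq (mulgI g^-1%g)) mulKg.
Qed.

Lemma gdelta1 : 'd_1%g = 1%R. Proof. by []. Qed.

Lemma gdeltaX g n : 'd_(g ^+ n)%g = ('d_g ^+ n)%R.
Proof. by elim: n => [|n IH]; rewrite ?expg0 // expgS exprS gdeltaM IH. Qed.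

Lemma gdelta_sum (a : A) : a = (\sum_g a g *: 'd_g)%R.
Proof.
apply/ffunP => h; rewrite sum_ffunE (bigD1 h) //= galgZE ffunE eqxx mulr1 big1 ?addr0 //.
by move=> g gh; rewrite galgZE ffunE eq_sym (negPf gh) mulr0.
Qed.

End GalgDelta.

Lemma galg_pchar (p : nat) (K : fieldType) (gT : finGroupType) :
  p \in [pchar K]%R -> p \in [pchar (galg K gT)]%R.
Proof.
move=> chK; rewrite inE (pcharf_prime chK) /=; apply/eqP/ffunP => g.
by rewrite -scaler_nat galgZE (pcharf0 chK) mul0r !ffunE.
Qed.

Section GroupFiltration.
Local Open Scope group_scope.
Variables (K : fieldType) (gT : finGroupType) (Q : nat -> {group gT}).
Local Notation A := (galg K gT).
Local Notation "''d_' g" := (gdelta K g : A) (at level 8, g at level 2).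
Implicit Types (H M : {group gT}).

(** The span of the products of factors h - 1, with h in H and in some Q m, of total weight at least
    n. Being inductive, it lets proofs follow the way an element is built. *)
Inductive wprod (H : {set gT}) : nat -> A -> Prop :=
| wprod0 n : wprod H n 0%R
| wprod1 : wprod H 0 1%R
| wprod_lin n k a b : wprod H n a -> wprod H n b -> wprod H n (k *: a + b)%R
| wprod_le m n a : (m <= n)%N -> wprod H n a -> wprod H m a
| wprod_mul h m n a : h \in H -> h \in Q m -> wprod H n a ->
    wprod H (m + n)%N (('d_h - 1) * a)%R.

Section Basics.
Variable H : {set gT}.

Lemma wprod_subspace n : is_subspace (wprod H n).
Proof. by split; [apply: wprod0 | move=> k x y; apply: wprod_lin]. Qed.

Lemma wprodD n a b : wprod H n a -> wprod H n b -> wprod H n (a + b)%R.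
Proof. exact: (subspaceD (wprod_subspace n)). Qed.

Lemma wprodB n a b : wprod H n a -> wprod H n b -> wprod H n (a - b)%R.
Proof. exact: (subspaceB (wprod_subspace n)). Qed.

Lemma wprodM m n a b : wprod H m a -> wprod H n b -> wprod H (m + n)%N (a * b)%R.
Proof.
move=> Ea Eb; elim: Ea => {m a} [m||m k a a' _ IH _ IH'|m m' a mm _ IH|h m m' a hH hQ _ IH].
- by rewrite mul0r; apply: wprod0.
- by rewrite mul1r.
- by rewrite mulrDl -scalerAl; apply: wprod_lin.
- by apply: wprod_le IH; rewrite leq_add2r.
- by rewrite -mulrA -addnA; apply: wprod_mul.
Qed.

Lemma wprod_gen h m : h \in H -> h \in Q m -> wprod H m ('d_h - 1)%R.
Proof.
move=> hH hQ; rewrite -[m]addn0 -['d_h - 1]mulr1.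
by apply: wprod_mul => //; apply: wprod1.
Qed.

End Basics.

Lemma wprodS (H H' : {set gT}) n a : H' \subset H -> wprod H' n a -> wprod H n a.
Proof.
move=> HH; elim=> {n a} [n||n k a b _ IH _ IH'|m n a mn _ IH|h m n a hH hQ _ IH].
- exact: wprod0.
- exact: wprod1.
- exact: wprod_lin.
- exact: wprod_le IH.
- by apply: wprod_mul => //; apply: (fintype.subsetP HH).
Qed.

Lemma wprod_supp H n a g : wprod H n a -> g \notin H -> a g = 0%R.
Proof.
move=> Ea gH; elim: Ea g gH => {n a} [n||n k a b _ IH _ IH'|m n a mn _ IH|h m n a hH hQ _ IH] g gH.
- by rewrite ffunE.
- by rewrite galg1E ffunE; case: eqP => // g1; rewrite g1 group1 in gH.
- by rewrite ffunE galgZE IH // IH' // mulr0 addr0.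
- exact: IH.
- rewrite mulrBl mul1r [LHS]ffunE gdelta_mulE IH ?groupMl ?groupV // ffunE IH //.
  by rewrite oppr0 addr0.
Qed.

Hypothesis Qdecr : forall m n, (m <= n)%N -> Q n \subset Q m.
Hypothesis Q1 : forall g, g \in Q 1%N.
Hypothesis Qcomm : forall m n x y, x \in Q m -> y \in Q n -> [~ x, y]%g \in Q (m + n)%N.

Lemma mem_Q0 g : g \in Q 0%N.
Proof. by apply: (fintype.subsetP (Qdecr (leq0n 1))); apply: Q1. Qed.

Lemma wprod_delta (H : {set gT}) h : h \in H -> wprod H 0 'd_h.
Proof.
move=> hH; rewrite -['d_h](subrK 1%R).
by apply: wprodD (wprod1 H); apply: wprod_gen => //; apply: mem_Q0.
Qed.

Variables (p : nat) (chK : p \in [pchar K]%R).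
Hypothesis Qpow : forall m x, x \in Q m -> (x ^+ p)%g \in Q (p * m)%N.

Section Step.
Variables (H M : {group gT}) (x : gT) (w : nat).
Hypotheses (MH : M \subset H) (xH : x \in H) (xQ : x \in Q w) (xN : x \in 'N(M)).
Hypothesis xp : (x ^+ p)%g \in M.
Hypothesis xM : forall c, (0 < c < p)%N -> (x ^+ c)%g \notin M.
Hypothesis HMx : forall h m, h \in H -> h \in Q m -> exists c h',
  [/\ (c < p)%N, h' \in M, h' \in Q m, h = (x ^+ c * h')%g & (c = 0 \/ m <= w)%N].

Let u : A := ('d_x - 1)%R.
Let conj (y : A) : A := ('d_(x^-1) * y * 'd_x)%R.

Let p_gt0 : (0 < p)%N := prime_gt0 (pcharf_prime chK).

Let conjM a b : conj (a * b)%R = (conj a * conj b)%R.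
Proof.
rewrite /conj -!mulrA; congr (_ * (_ * _))%R.
by rewrite [in RHS]mulrA -gdeltaM mulgV mul1r.
Qed.

Let conj1 : conj 1%R = 1%R.
Proof. by rewrite /conj mulr1 -gdeltaM mulVg. Qed.

Let conj_lin k a b : conj (k *: a + b)%R = (k *: conj a + conj b)%R.
Proof. by rewrite /conj mulrDr mulrDl -scalerAr -scalerAl. Qed.

Let conjd h : conj 'd_h = 'd_(h ^ x)%g.
Proof. by rewrite /conj -!gdeltaM conjgE !mulgA. Qed.

Let conj_comm h m : h \in M -> h \in Q m ->
  wprod M (m + w)%N (conj ('d_h - 1) - ('d_h - 1))%R.
Proof.
move=> hM hQ.
have -> : (conj ('d_h - 1) - ('d_h - 1) = 'd_h * ('d_[~ h, x]%g - 1))%R.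
  rewrite -['d_h - 1]addrC -scaleN1r conj_lin conj1 conjd scaleN1r opprD opprK.
  rewrite addrACA addNr add0r mulrBr mulr1 -gdeltaM; congr ('d_ _ - _)%R.
  by rewrite commgEl mulKVg.
rewrite -[(m + w)%N]add0n; apply: wprodM; first exact: wprod_delta.
apply: wprod_gen; last exact: Qcomm.
by rewrite commgEl groupM ?groupV // memJ_norm.
Qed.

(** Conjugation by x changes a factor h - 1 by h ([h, x] - 1), whose weight exceeds that of h by w;
    the gain passes to products. *)
Let conj_sub_wprod m y : wprod M m y ->
  wprod M m (conj y) /\ wprod M (m + w)%N (conj y - y)%R.
Proof.
elim=> {m y} [n||n k a b _ [IH1 IH2] _ [IH1' IH2']|m n a mn _ [IH1 IH2]|h m n a hH hQ Ea [IH1 IH2]].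
- by rewrite /conj mulr0 mul0r subrr; split; apply: wprod0.
- by rewrite conj1 subrr; split; [apply: wprod1 | apply: wprod0].
- rewrite conj_lin; split; first exact: wprod_lin.
  by rewrite opprD addrACA -scalerBr; apply: wprod_lin.
- by split; [apply: wprod_le IH1 | apply: wprod_le IH2; rewrite leq_add2r].
- rewrite conjM; have hc := conj_comm hH hQ; split.
    rewrite -[conj ('d_h - 1)%R](subrK ('d_h - 1)%R) mulrDl.
    apply: wprodD; last exact: wprod_mul.
    by apply: wprod_le (wprodM hc IH1); rewrite leq_add2r leq_addr.
  have E (c c' e e' : A) : (c * e - c' * e' = (c - c') * e + c' * (e - e'))%R.
    by rewrite mulrBl mulrBr addrA subrK.
  rewrite E.
  apply: wprodD; last by rewrite -addnA; apply: wprod_mul.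
  by rewrite addnAC; apply: wprodM.
Qed.

(** A normal form, shown below to describe exactly [wprod H n]: the powers of u = x - 1 below p
    serve as a basis over K[M], and u^k counts for weight k w. Once k w >= n, truncated subtraction
    leaves only membership of y k in K[M]. *)
Let B n (b : A) := exists2 y : {ffun 'I_p -> A},
  (forall k : 'I_p, wprod M (n - k * w)%N (y k)) & b = (\sum_(k < p) u ^+ k * y k)%R.

Let B_le m n b : (m <= n)%N -> B n b -> B m b.
Proof.
move=> mn [y Ey ->]; exists y => // k.
by apply: wprod_le (Ey k); rewrite leq_sub2r.
Qed.

Let B_subspace n : is_subspace (B n).
Proof.
split=> [|k _ _ [y Ey ->] [z Ez ->]].
  exists [ffun=> 0%R] => [k|]; first by rewrite ffunE; apply: wprod0.
  by rewrite big1 // => k _; rewrite ffunE mulr0.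
exists (k *: y + z)%R => [i|]; first by rewrite !ffunE; apply: wprod_lin.
rewrite scaler_sumr -big_split /=; apply: eq_bigr => i _.
by rewrite !ffunE mulrDr scalerAr.
Qed.

Let B_term n (k : 'I_p) y : wprod M n y -> B (n + k * w)%N (u ^+ k * y)%R.
Proof.
move=> Ey; exists [ffun i => if i == k then y else 0%R] => [i|].
  by rewrite ffunE; case: eqP => [->|_]; [rewrite addnK | apply: wprod0].
rewrite (bigD1 k) //= ffunE eqxx big1 ?addr0 // => i /negPf ik.
by rewrite ffunE ik mulr0.
Qed.

Let uX : (u ^+ p = 'd_(x ^+ p)%g - 1)%R.
Proof.
rewrite /u; have cp := galg_pchar gT chK.
have := pFrobenius_autB_comm cp (commr1 'd_x).
by rewrite !pFrobenius_autE expr1n gdeltaX.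
Qed.

(** The only overflow is u^p, which characteristic p turns into x^p - 1, an element of K[M] of
    weight p w by [Qpow]. *)
Let B_u n b : B n b -> B (n + w)%N (u * b)%R.
Proof.
move=> [y Ey ->]; rewrite big_distrr /=; apply: (subspace_sum (B_subspace _)) => k _.
rewrite mulrA -exprS.
have [kp|] := ltnP k.+1 p.
  apply: B_le (B_term (Ordinal kp) (Ey k)); rewrite /=.
  by rewrite mulSn [(w + _)%N]addnC addnA leq_add2r addnC -leq_subLR.
move=> pk; have kE : k.+1 = p by apply/eqP; rewrite eqn_leq pk andbT.
rewrite kE uX.
have := wprodM (wprod_gen (H := M) xp (Qpow xQ)) (Ey k).
move=> /(B_term (Ordinal p_gt0)); rewrite expr0 mul1r; apply: B_le => /=.
rewrite mul0n addn0 -{1}kE mulSn [(w + _)%N]addnC addnAC leq_add2r.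
by rewrite -leq_subLR.
Qed.

(** A factor y from K[M] moves past u by y u = u y^x + (y^x - y); the second term has lost u, but
    the difference gains the same weight w. *)
Let B_wprodX m n y z (k : nat) : (k < p)%N -> wprod M m y -> wprod M n z ->
  B (m + n + k * w)%N (y * (u ^+ k * z))%R.
Proof.
elim: k m y => [|k IH] m y kp Ey Ez.
  have := B_term (Ordinal p_gt0) (wprodM Ey Ez).
  by rewrite /= expr0 !mul1r.
have xc : ('d_x * conj y = y * 'd_x)%R by rewrite /conj !mulrA -gdeltaM mulgV mul1r.
have yu : (y * u = u * conj y + (conj y - y))%R.
  by rewrite /u mulrBr mulr1 mulrBl mul1r xc addrA subrK.
have -> : (y * (u ^+ k.+1 * z) =
    u * (conj y * (u ^+ k * z)) + (conj y - y) * (u ^+ k * z))%R.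
  by rewrite exprS -[(u * _ * z)%R]mulrA [LHS]mulrA yu mulrDl -[(u * conj y * _)%R]mulrA.
have [E1 E2] := conj_sub_wprod Ey.
apply: (subspaceD (B_subspace _)).
  by rewrite mulSn [(w + _)%N]addnC addnA; apply/B_u/IH => //; apply: ltnW.
rewrite mulSn addnA (addnAC _ n w) ; apply: IH => //; exact: ltnW.
Qed.

Let B_wprod m n y b : wprod M m y -> B n b -> B (m + n)%N (y * b)%R.
Proof.
move=> Ey [z Ez ->]; rewrite big_distrr /=; apply: (subspace_sum (B_subspace _)) => k _.
apply: B_le (B_wprodX (ltn_ord k) Ey (Ez k)).
by rewrite -addnA leq_add2l addnC -leq_subLR.
Qed.

Let wprod_B n a : wprod H n a -> B n a.
Proof.
elim=> {n a} [n||n k a b _ IH _ IH'|m n a mn _ IH|h m n a hH hQ _ IH].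
- exact: (B_subspace n).1.
- by have := B_term (Ordinal p_gt0) (wprod1 M); rewrite expr0 mulr1.
- exact: (B_subspace n).2.
- exact: B_le IH.
- have [c [h' [cp hM h'Q -> cw]]] := HMx hH hQ.
  have Bh : B n ('d_h' * a)%R.
    by rewrite -[n]add0n; apply: B_wprod => //; apply: wprod_delta.
  have Bx i : B n ('d_x ^+ i * ('d_h' * a))%R.
    elim: i => [|i IHi]; first by rewrite expr0 mul1r.
    rewrite exprS -mulrA; set b := (_ ^+ i * _)%R in IHi *.
    rewrite -['d_x](subrK 1%R) mulrDl mul1r; apply: (subspaceD (B_subspace _)) => //.
    by apply: B_le (B_u IHi); rewrite leq_addr.
  (* Here x^c h' - 1 = (x^c - 1) h' + (h' - 1), and x - 1 is split off from x^c - 1. *)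
  have -> : (('d_(x ^+ c * h')%g - 1) * a =
      u * ((\sum_(i < c) 'd_x ^+ i) * ('d_h' * a)) + ('d_h' - 1) * a)%R.
    rewrite mulrA -subrX1 !mulrBl !mul1r gdeltaM gdeltaX addrA.
    by rewrite !mulrA subrK.
  apply: (subspaceD (B_subspace _)).
    (* Unless c = 0, the single factor u already carries weight at least m. *)
    case: cw => [->|mw]; first by rewrite big_ord0 mul0r mulr0; apply: (B_subspace _).1.
    apply: (@B_le _ (n + w)%N); first by rewrite addnC leq_add2l.
    apply: B_u; rewrite big_distrl /=.
    by apply: (subspace_sum (B_subspace _)).
  by apply: B_wprod => //; apply: wprod_gen.
Qed.

Let B_wprodH n b : B n b -> wprod H n b.
Proof.
move=> [y Ey ->]; apply: (subspace_sum (wprod_subspace _ _)) => k _.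
have Eu : wprod H (k * w)%N (u ^+ k)%R.
  elim: (val k) => [|i IH]; first exact: wprod1.
  by rewrite exprS mulSn; apply: wprodM => //; apply: wprod_gen.
apply: wprod_le (wprodM Eu (wprodS MH (Ey k))).
by rewrite -leq_subLR.
Qed.

(** Triangularity: on the coset x^k M the product u^j y vanishes for j < k and is a translate of y
    for j = k. *)
Let u_eval (j k : nat) y g : (j <= k < p)%N -> wprod M 0 y -> g \in M ->
  (u ^+ j * y)%R (x ^+ k * g)%g = if (j == k)%N then y g else 0%R.
Proof.
move=> jk Ey gM; elim: j k jk => [|j IH] k jk.
  rewrite expr0 mul1r; case: eqP => [<-|/eqP k0]; first by rewrite expg0 mul1g.
  have k0' : (0 < k < p)%N by move: jk => /andP[_ ->]; rewrite lt0n eq_sym k0.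
  by apply: (wprod_supp Ey); rewrite groupMr // xM.
case: k jk => // k /andP[jk kp].
rewrite exprS -mulrA mulrBl mul1r [LHS]ffunE [X in (_ + X)%R]ffunE gdelta_mulE.
rewrite expgS mulgA mulKg IH ?(ltnW kp) ?andbT //.
rewrite -expgS IH; last by rewrite kp andbT ltnW.
by rewrite eqSS (ltn_eqF (jk : (j < k.+1)%N)) subr0.
Qed.

(** Descending induction on k: on the coset x^k M the terms with smaller exponent vanish by
    [u_eval], those with larger exponent by induction. *)
Let u_inj (y : {ffun 'I_p -> A}) : (forall k, wprod M 0 (y k)) ->
  (\sum_(k < p) u ^+ k * y k = 0)%R -> y = 0%R.
Proof.
move=> Ey s0.
suff h m (k : 'I_p) : (p <= k + m)%N -> y k = 0%R.
  by apply/ffunP => k; rewrite (h p k) ?leq_addl // ffunE.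
elim: m k => [|m IH] k; first by rewrite addn0 leqNgt ltn_ord.
move=> pkm; apply/ffunP => g; rewrite [RHS]ffunE.
have [gM|gM] := boolP (g \in M); last exact: (wprod_supp (Ey k)).
have := congr1 (fun a : A => a (x ^+ k * g)%g) s0.
rewrite /= [RHS]ffunE sum_ffunE (bigD1 k) //= u_eval ?leqnn ?ltn_ord ?eqxx // => <-.
rewrite big1 ?addr0 // => i ik.
have [lt|gt|eq] := ltngtP i k; last by rewrite (val_inj eq) eqxx in ik.
  by rewrite u_eval ?(ltnW lt) ?ltn_ord //= ltn_eqF.
by rewrite IH ?mulr0 ?ffunE // (leq_trans pkm) // -addSnnS leq_add2r.
Qed.

(** K[H] is the direct sum of the u^k K[M] for k < p, and its filtration splits into that of K[M]
    shifted by k w; hence p shifted copies of h. *)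
Lemma has_dim_wprod_step (h : nat -> nat) :
  (forall n, has_dim_quo (wprod M n) (wprod M n.+1) (h n)) ->
  forall n, has_dim_quo (wprod H n) (wprod H n.+1)
    (\sum_(k < p) if (k * w <= n)%N then h (n - k * w)%N else 0%N).
Proof.
move=> hM n.
pose f (y : {ffun 'I_p -> A}) : A := (\sum_(k < p) u ^+ k * y k)%R.
have f_lin : linear f.
  move=> k y z; rewrite /f scaler_sumr -big_split; apply: eq_bigr => i _ /=.
  by rewrite !ffunE mulrDr scalerAr.
pose T : {linear {ffun 'I_p -> A} -> A} :=
  HB.pack f (GRing.isLinear.Build _ _ _ _ f f_lin).
have := @has_dim_prod K A p (fun k : 'I_p => wprod M (n - k * w)%N)
  (fun k : 'I_p => wprod M (n.+1 - k * w)%N)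
  (fun k : 'I_p => if (k * w <= n)%N then h (n - k * w)%N else 0%N)
  (fun _ => wprod_subspace _ _) (fun _ => wprod_subspace _ _).
have hk (k : 'I_p) : has_dim_quo (wprod M (n - k * w)%N) (wprod M (n.+1 - k * w)%N)
    (if (k * w <= n)%N then h (n - k * w)%N else 0%N).
  case: leqP => [le|lt]; first by rewrite subSn.
  (* For k w > n both truncated weights are 0, so this summand of the quotient vanishes. *)
  rewrite (_ : n - k * w = n.+1 - k * w)%N; last first.
    by apply/eqP; rewrite (eqP (lt : (n.+1 - _)%N == 0%N)) subn_eq0 ltnW.
  exists (fun=> 0%R) => [i|v Wv]; first exact: wprod0.
  exists [ffun=> 0%R]; split=> [|c _]; first by rewrite big_ord0 subr0.
  by apply/ffunP => -[].
move=> /(_ hk); apply: (has_dim_transport (T := T)).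
- exact: wprod_subspace.
- exact: wprod_subspace.
- by move=> a; apply: wprod_le.
- by move=> y Ey; apply: B_wprodH; exists y.
- move=> y Ey; split=> [/wprod_B[z Ez yz] k|E]; last by apply: B_wprodH; exists y.
  suff -> : y = z by apply: Ez.
  apply/eqP; rewrite -subr_eq0; apply/eqP/u_inj => [i|].
    by rewrite !ffunE; apply: wprodB; [apply: wprod_le (Ey i)|apply: wprod_le (Ez i)].
  transitivity (f (y - z)%R); first by [].
  rewrite -[f]/(T : _ -> _) linearB; apply/eqP; rewrite subr_eq0; exact/eqP.
- by move=> a /wprod_B[y Ey ->]; exists y => //; rewrite subrr; apply: wprod0.
- apply: (@subspace_prod K A _ (fun k : 'I_p => wprod M (n - k * w)%N)) => k.
  exact: wprod_subspace.
Qed.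

End Step.

Hypothesis pQ : p.-group (Q 1%N).
Variables (N : nat) (QN : Q N = 1%G).

Definition layer_log H k := logn p #|(H :&: Q k)%g : (H :&: Q k.+1)%g|.

Definition layer_poly k : {poly nat} := (\sum_(i < p) 'X^(i * k)%N)%R.

Definition jennings_poly H : {poly nat} :=
  (\prod_(1 <= k < N) layer_poly k ^+ layer_log H k)%R.

Lemma coef_layer_polyM k (P : {poly nat}) n :
  ((layer_poly k * P)`_n = \sum_(i < p) if (i * k <= n)%N then P`_(n - i * k)%N else 0%N)%R.
Proof.
rewrite /layer_poly big_distrl /= coef_sum; apply: eq_bigr => i _.
by rewrite coefXnM ltnNge; case: leqP.
Qed.

Lemma sub_Q0 H w : (w <= 1)%N -> H \subset Q w.
Proof.
move=> w1; apply/fintype.subsetP => h _.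
by apply: (fintype.subsetP (Qdecr w1)); apply: Q1.
Qed.

Lemma pgroup_sub H : p.-group H.
Proof. exact: pgroupS (sub_Q0 H (leqnn 1)) pQ. Qed.

Lemma has_dim_wprod_trivial n :
  has_dim_quo (wprod 1%G n) (wprod 1%G n.+1) ((n == 0%N) : nat).
Proof.
have E m a : wprod 1%G m a -> exists k, a = ((if m == 0%N then k else 0) *: 1)%R.
  elim=> {m a} [m||m k a b _ [x ->] _ [y ->]|m m' a mm _ [k ->]|h m m' a /set1P-> _ _ _].
  - by exists 0%R; case: ifP => _; rewrite scale0r.
  - by exists 1%R; rewrite scale1r.
  - exists (k * x + y)%R; rewrite scalerA -scalerDl.
    by case: (m == 0%N) => //; rewrite mulr0 addr0.
  - exists (if m' == 0%N then k else 0)%R; case: m mm => //=.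
    by case: m' => //= n' _; rewrite scale0r.
  - by exists 0%R; rewrite gdelta1 subrr mul0r; case: ifP => _; rewrite scale0r.
have E0 m a : (0 < m)%N -> wprod 1%G m a -> a = 0%R.
  by case: m => // m _ /E[k ->]; rewrite scale0r.
case: n => [|n] /=.
  exists (fun=> 1%R) => [_|v /E[k ->]]; first exact: wprod1.
  exists [ffun=> k]; split=> [|c]; rewrite big_ord1 -scalerBl ?ffunE ?subrr ?scale0r.
    exact: wprod0.
  move=> /(E0 _ _ (ltn0Sn _)) /(congr1 (fun a : A => a 1%g)) /eqP.
  rewrite galgZE galg1E !ffunE eqxx mulr1 subr_eq0 => /eqP ->.
  by apply/ffunP => i; rewrite ffunE; congr (c _); apply: val_inj; case: i => -[].
exists (fun=> 0%R) => [_|v /E0 ->]; [exact: wprod0| |by []].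
exists [ffun=> 0%R]; split=> [|c _]; first by rewrite big_ord0 subr0; apply: wprod0.
by apply/ffunP => -[].
Qed.

(** Induction on the order of H. Let w be the largest index with H inside Q w, and M a maximal
    subgroup of H containing the intersection of H with Q (w + 1). Then M has the same layers as H
    except at w, where the logarithm drops by one, and [has_dim_wprod_step] supplies the missing
    factor. *)
Theorem has_dim_wprod H n :
  has_dim_quo (wprod H n) (wprod H n.+1) ((jennings_poly H)`_n)%R.
Proof.
have [m] := ubnP #|H|; elim: m => // m IH in H n *; rewrite ltnS => Hm.
have [H1|H1] := eqVneq H 1%G.
  rewrite H1 /jennings_poly big1_seq; last first.
    move=> k _; rewrite /layer_log (trivgP (subsetIl _ _)) (trivgP (subsetIl _ _)).
    by rewrite indexgg logn1 expr0.
  by rewrite coef1 natn; apply: has_dim_wprod_trivial.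
have exw : exists w, H \subset Q w by exists 1%N; apply: sub_Q0.
have ubw w : H \subset Q w -> (w <= N)%N.
  rewrite leqNgt => Hw; apply: contra H1 => Nw.
  have := fintype.subset_trans Hw (Qdecr (ltnW Nw)).
  by rewrite QN => /trivgP/eqP; rewrite -val_eqE.
have [w Hw wmax] := ex_maxnP exw ubw.
have w1 : (0 < w)%N by apply: wmax; apply: sub_Q0.
have nHw : ~~ (H \subset Q w.+1) by apply/negP => /wmax; rewrite ltnn.
have wN : (w < N)%N.
  by rewrite ltnNge; apply: contra nHw => Nw; rewrite (fintype.subset_trans Hw) //
    (fintype.subset_trans (Qdecr Nw)) // QN sub1G.
have pH : p.-group H := pgroup_sub H.
have [LH|[M maxM LM]] := maximal_exists (subsetIl H (Q w.+1)).
  by case/negP: nHw; rewrite -LH subsetIr.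
have MH := proper_sub (maxgroupp maxM).
have nMH : H \subset 'N(M) := normal_norm (p_maximal_normal pH maxM).
have iM : #|H : M| = p := p_maximal_index pH maxM.
have pp := pcharf_prime chK.
have [x xH xM] : exists2 x, x \in H & x \notin M.
  by have /properP[_ [x xH xM]] := maxgroupp maxM; exists x.
have oX : #[coset M x] = p.
  apply/prime_nt_dvdP => //.
    by rewrite order_eq1; apply: contra xM => /eqP/coset_idr; apply; apply: (fintype.subsetP nMH).
  by rewrite -iM -card_quotient // order_dvdG // mem_quotient.
have xn := fintype.subsetP nMH _ xH.
have cX c : (coset M x ^+ c == 1)%g = (x ^+ c \in M)%g.
  rewrite -morphX //; apply/eqP/idP => [h|h]; last exact: coset_id.
  by apply: coset_idr => //; rewrite groupX.
have HM h : h \in H -> exists c h', [/\ (c < p)%N, h' \in M & h = (x ^+ c * h')%g].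
  move=> hH; have : coset M h \in <[coset M x]>.
    suff -> : <[coset M x]>%g = (H / M)%g by rewrite mem_quotient.
    apply/eqP; rewrite eqEcard cycle_subG mem_quotient //=.
    by rewrite card_quotient // iM -oX.
  move=> /cyclePmin[c cp cE]; exists c, (x ^- c * h)%g; split; last by rewrite mulKVg.
    by rewrite -oX.
  have hN := fintype.subsetP nMH _ hH.
  apply: coset_idr; first by rewrite groupM // groupV groupX.
  rewrite coset_morphM ?groupV ?groupX // morphV ?groupX //= morphX //=.
  by rewrite -[X in (_ * X)%g = _]/(coset M h) cE mulVg.
have step := @has_dim_wprod_step H M x w MH xH (fintype.subsetP Hw _ xH) xn _ _ _
  (fun n => (jennings_poly M)`_n)%R _ n.
have QM k : (w < k)%N -> (H :&: Q k)%g = (M :&: Q k)%g.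
  move=> wk; apply/eqP; rewrite finset.eqEsubset (finset.setSI _ MH) andbT finset.subsetI subsetIr andbT.
  by apply: fintype.subset_trans LM; rewrite finset.setIS // Qdecr.
have Qle k : (k <= w)%N -> forall M' : {group gT}, M' \subset H -> (M' :&: Q k)%g = M'.
  move=> kw M' M'H; apply/finset.setIidPl; apply: fintype.subset_trans M'H _.
  exact: fintype.subset_trans Hw (Qdecr kw).
have -> : jennings_poly H = (layer_poly w * jennings_poly M)%R.
  rewrite /jennings_poly !(bigD1_seq w) ?iota_uniq //=; last 2 first.
  - by rewrite mem_index_iota w1 wN.
  - by rewrite mem_index_iota w1 wN.
  rewrite mulrA -exprS; congr (_ * _)%R.
    congr (_ ^+ _)%R; rewrite /layer_log !(Qle w) // QM //.
    rewrite -(Lagrange_index MH (subsetIl M (Q w.+1))) iM mulnC lognM ?indexg_gt0 ?prime_gt0 //.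
    by rewrite [logn p p]logn_prime // eqxx addn1.
  rewrite big_seq_cond [RHS]big_seq_cond; apply: eq_bigr => k /andP[_ kw].
  congr (_ ^+ _)%R; rewrite /layer_log.
  have [lt|gt] := ltnP w k; first by rewrite !QM // ltnW.
  have lt : (k < w)%N by rewrite ltn_neqAle kw.
  by rewrite !Qle // !indexgg.
rewrite coef_layer_polyM; apply: step.
- by rewrite -cX -oX expg_order.
- move=> c /andP[c0 cp]; rewrite -cX -order_dvdn oX; apply/negP => /(dvdn_leq c0).
  by rewrite leqNgt cp.
- move=> h k hH hQ; have [kw|wk] := leqP k w.
    have [c [h' [cp hM ->]]] := HM _ hH; exists c, h'; split=> //; last by right.
    by apply: (fintype.subsetP _ _ (fintype.subsetP MH _ hM)); apply: fintype.subset_trans Hw (Qdecr kw).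
  (* Beyond w, the groups H and M have the same intersection with Q k, so no power of x occurs. *)
  exists 0%N, h; split; rewrite ?prime_gt0 ?expg0 ?mul1g //; last by left.
  have : h \in (H :&: Q k)%g by rewrite finset.inE hH.
  by rewrite QM // finset.inE => /andP[].
- move=> k; apply: IH; apply: leq_trans Hm.
  by apply: proper_card; apply: maxgroupp maxM.
Qed.

End GroupFiltration.

(** * Inverse limits over open normal subgroups *)

Section OpnsubMeet.
Variable G : topGroupType.

Lemma opnsub_meet (U V : opnsub G) :
  exists W : opnsub G, forall x, W x <-> U x /\ V x.
Proof.
have oW : open [set x | U x /\ V x] by apply: openI; apply: opnsub_open.
have nW : is_normal [set x | U x /\ V x].
  split; [split=> [|x y [Ux Vx] [Uy Vy]]|move=> x g [Ux Vx]] => /=.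
  - by split; apply: opnsub1.
  - by split; apply/opnsubM => //; apply: opnsubV.
  - by split; apply: opnsubJ.
have fW : exists s : seq G, forall g, exists2 x, x \in s & U (x^-1 * g)%g /\ V (x^-1 * g)%g.
  pose c (q : quo U * quo V) := xget 1%g [set x | quo_pi U x = q.1 /\ quo_pi V x = q.2].
  exists [seq c q | q <- enum {: quo U * quo V}] => g.
  exists (c (quo_pi U g, quo_pi V g)); first by rewrite map_f // mem_enum.
  have [] := @xgetPex _ 1%g [set x | quo_pi U x = quo_pi U g /\ quo_pi V x = quo_pi V g].
    by exists g.
  by move=> /quo_piE ? /quo_piE.
by exists (OpnSub oW nW fW).
Qed.

Lemma opnsub_meet_fin (T : finType) (U : T -> opnsub G) :
  exists W : opnsub G, forall t x, W x -> U t x.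
Proof.
suff [W hW] : exists W : opnsub G, forall t x, t \in enum T -> W x -> U t x.
  by exists W => t x; apply: hW; rewrite mem_enum.
elim: (enum T) => [|t s [W IH]]; first by exists (opnT G).
have [W' hW'] := opnsub_meet (U t) W.
exists W' => t' x; rewrite inE => /predU1P[->|ts] /hW'[] //.
by move=> _; apply: IH.
Qed.

End OpnsubMeet.

Section InvLimChoice.
Variables (p : nat) (G : topGroupType) (T : finType).

(* The values of the approximate solutions, pushed forward to level U, take
   finitely many values, hence are constant along an ultrafilter refining the
   filter of small open subgroups. *)
Lemma cga_compact (P : forall U : opnsub G, (T -> galg 'F_p (quo U)) -> Prop) :
  (forall U, exists x, P U x) ->
  (forall U V : opnsub G, (forall g, V g -> U g) -> forall x, P V x ->
     P U (fun t => galg_map (@quo_proj G V U) (x t))) ->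
  exists x : T -> cga p G, forall U, P U (fun t => x t U).
Proof.
move=> ex tr.
have exs U := cid (ex U).
pose s U := sval (exs U).
have sP U : P U (s U) := svalP (exs U).
pose F : set_system (opnsub G) := [set S | exists U : opnsub G,
  forall V : opnsub G, (forall g, V g -> U g) -> S V].
have FF : ProperFilter F.
  split; first by move=> [U /(_ U (fun _ => id))].
  split=> [|A B [U hU] [V hV]|A B AB [U hU]].
  - by exists (opnT G).
  - have [W hW] := opnsub_meet U V; exists W => W' W'W.
    by split; [apply: hU | apply: hV] => g /W'W /hW [].
  - by exists U => V /hU /AB.
have [UF [uUF FUF]] := ultraFilterLemma FF.
pose X U (V : opnsub G) : {ffun T -> {ffun quo U -> 'F_p}} :=
  [ffun t => galg_map (@quo_proj G V U) (s V t)].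
have constX U : exists x, UF [set V | X U V = x].
  apply: contrapT => /forallNP nex.
  have : UF (\bigcap_(x in [set: {ffun T -> {ffun quo U -> 'F_p}}]) [set V | X U V <> x]).
    have : \forall V \near UF, forall x, X U V <> x.
      apply: filter_forall => x.
      by have [/nex|] := in_ultra_setVsetC [set V | X U V = x] uUF.
    by apply: filterS => V hV x _; apply: hV.
  by move=> /filter_ex [V /(_ (X U V) Logic.I)].
pose x U := sval (cid (constX U)).
have xP U : UF [set V | X U V = x U] := svalP (cid (constX U)).
have tailU (U : opnsub G) : UF [set V : opnsub G | forall g, V g -> U g].
  by apply: FUF; exists U.
have UI A B : UF A -> UF B -> UF (A `&` B) by apply: filterI.
have coh (t : T) (U V : is_idx (cga_sys p G)) : is_le U V ->
    @is_tr (cga_sys p G) U V (x V t) = x U t.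
  move=> VU.
  (* A single W inside U and V at which both limit values are attained; coherence is inherited from
     there. *)
  have /filter_ex [W [[[XU XV] WU] WV]] :=
    UI _ _ (UI _ _ (UI _ _ (xP U) (xP V)) (tailU U)) (tailU V).
  rewrite -XU -XV !ffunE /is_tr /= galg_map_comp; congr galg_map.
  by apply/funext => q; rewrite -[q]quo_reprK !quo_projE.
exists (fun t => @InvLim (cga_sys p G) (fun U => x U t) (coh t)) => U /=.
have /filter_ex [W [XU WU]] := UI _ _ (xP U) (tailU U).
rewrite -XU; have := tr U W WU _ (sP W).
by under [X in P _ X -> _]funext do rewrite -[galg_map _ _](ffunE (fun t => galg_map (@quo_proj G W U) (s W t))).
Qed.

End InvLimChoice.

(** * Completed group algebras *)

Section GalgAug.
Variables (K : fieldType) (gT : finGroupType).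
Local Notation A := (galg K gT).

Definition galg_aug (a : A) : K := \sum_g a g.

Lemma galg_aug_linear : scalable_for *%R galg_aug.
Proof.
by move=> k a; rewrite /galg_aug big_distrr; apply: eq_bigr => g _; rewrite galgZE.
Qed.

Lemma galg_augB : zmod_morphism galg_aug.
Proof.
by move=> a b; rewrite /galg_aug -sumrB; apply: eq_bigr => g _; rewrite !ffunE.
Qed.

Lemma galg_augM : monoid_morphism galg_aug.
Proof.
split=> [|a b]; rewrite /galg_aug.
  rewrite (bigD1 1%g) //= galg1E ffunE eqxx big1 ?addr0 // => g /negPf g1.
  by rewrite ffunE g1.
under eq_bigr do rewrite galgME; rewrite exchange_big big_distrl /=.
apply: eq_bigr => g _; rewrite -big_distrr /=; congr (_ * _).
by rewrite (reindex_inj (mulgI g)) /=; apply: eq_bigr => h _; rewrite mulKg.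
Qed.

HB.instance Definition _ := GRing.isZmodMorphism.Build _ _ galg_aug galg_augB.
HB.instance Definition _ := GRing.isMonoidMorphism.Build _ _ galg_aug galg_augM.
HB.instance Definition _ := GRing.isScalable.Build _ _ _ *%R galg_aug galg_aug_linear.

Lemma galg_aug_delta g : galg_aug (gdelta K g) = 1.
Proof.
rewrite /galg_aug (bigD1 g) //= ffunE eqxx big1 ?addr0 // => h /negPf hg.
by rewrite ffunE hg.
Qed.

Definition galg_aug_ideal : set A := [set a | galg_aug a = 0].

Lemma galg_aug_two_sided : two_sided galg_aug_ideal.
Proof.
rewrite /galg_aug_ideal; split=> [|x y /= x0 y0|a x /= x0|a x /= x0] /=.
- exact: rmorph0.
- by rewrite rmorphB /= x0 y0 subrr.
- by rewrite rmorphM /= x0 mulr0.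
- by rewrite rmorphM /= x0 mul0r.
Qed.

End GalgAug.

Section GalgMapMorphism.
Variables (K : fieldType) (gT hT : finGroupType) (f : gT -> hT).
Hypothesis fM : {morph f : x y / (x * y)%g}.

Lemma galg_aug_map a : galg_aug (galg_map f a) = galg_aug a :> K.
Proof.
rewrite /galg_aug [RHS](partition_big f predT) //=.
by apply: eq_bigr => h _; rewrite ffunE.
Qed.

Lemma galg_map_ideal_pow n (a : galg K gT) :
  ideal_pow (@galg_aug_ideal K gT) n a ->
  ideal_pow (@galg_aug_ideal K hT) n (galg_map f a).
Proof.
pose F : {rmorphism galg K gT -> galg K hT} := HB.pack (@galg_map K gT hT f)
  (GRing.isZmodMorphism.Build _ _ (@galg_map K gT hT f) (@galg_mapB K gT hT f))
  (GRing.isMonoidMorphism.Build _ _ (@galg_map K gT hT f)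
    (galg_map1 K fM, galg_mapM fM)).
apply: (ideal_pow_morph (f := F)) => x /= x0.
by rewrite /galg_aug_ideal /= galg_aug_map.
Qed.

End GalgMapMorphism.

Section CgaAt.
Variables (p : nat) (G : topGroupType) (U : opnsub G).

Definition cga_at (x : cga p G) : galg 'F_p (quo U) := x U.

Lemma cga_atB : zmod_morphism cga_at. Proof. by []. Qed.
Lemma cga_atM : monoid_morphism cga_at. Proof. by []. Qed.
Lemma cga_atZ : scalable cga_at. Proof. by []. Qed.
HB.instance Definition _ := GRing.isZmodMorphism.Build _ _ cga_at cga_atB.
HB.instance Definition _ := GRing.isMonoidMorphism.Build _ _ cga_at cga_atM.
HB.instance Definition _ := GRing.isScalable.Build _ _ _ _ cga_at cga_atZ.

Lemma cga_at_gel g : cga_at (gel p g) = gdelta 'F_p (quo_pi U g).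
Proof. by []. Qed.

Lemma cga_aug_at x : cga_aug x = galg_aug (cga_at x).
Proof.
have h : @is_le (cga_sys p G) (opnT G) U by [].
have := il_coh x h; rewrite /is_tr /= => xE.
rewrite /cga_aug /cga_at -[RHS](@galg_aug_map _ _ _ (@quo_proj G U (opnT G))).
by rewrite xE.
Qed.

End CgaAt.

Section CgaAug.
Variables (p : nat) (G : topGroupType).
Local Notation A := (cga p G).
Local Notation I := (@aug_ideal p G).

Lemma cga_augE x : cga_aug x = galg_aug (@cga_at p G (opnT G) x).
Proof. exact: cga_aug_at. Qed.

Lemma cga_augB : zmod_morphism (@cga_aug p G).
Proof. by move=> x y; rewrite !cga_augE !rmorphB. Qed.
Lemma cga_augM : monoid_morphism (@cga_aug p G).
Proof. by split=> [|x y]; rewrite !cga_augE ?rmorph1 ?rmorphM. Qed.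
Lemma cga_augZ : scalable_for *%R (@cga_aug p G).
Proof. by move=> k x; rewrite !cga_augE cga_atZ galg_aug_linear. Qed.
HB.instance Definition _ := GRing.isZmodMorphism.Build _ _ (@cga_aug p G) cga_augB.
HB.instance Definition _ := GRing.isMonoidMorphism.Build _ _ (@cga_aug p G) cga_augM.
HB.instance Definition _ := GRing.isScalable.Build _ _ _ *%R (@cga_aug p G) cga_augZ.

Lemma cga_aug_gel (g : G) : cga_aug (gel p g) = 1.
Proof. by rewrite cga_augE cga_at_gel galg_aug_delta. Qed.

Lemma aug_ideal_two_sided : two_sided I.
Proof.
rewrite /aug_ideal; split=> [|x y /= x0 y0|a x /= x0|a x /= x0] /=.
- exact: rmorph0.
- by rewrite rmorphB /= x0 y0 subrr.
- by rewrite rmorphM /= x0 mulr0.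
- by rewrite rmorphM /= x0 mul0r.
Qed.

Lemma aug_ideal_gel (g : G) : I (gel p g - 1).
Proof. by rewrite /aug_ideal /= rmorphB /= cga_aug_gel rmorph1 subrr. Qed.

Lemma ipow_two_sided n : two_sided (ideal_pow I n).
Proof. exact/ideal_pow_two_sided/aug_ideal_two_sided. Qed.

Lemma ipow_subspace n : is_subspace (ideal_pow I n).
Proof. exact/two_sided_subspace/ipow_two_sided. Qed.

Lemma gelM (g h : G) : gel p (g * h)%g = gel p g * gel p h.
Proof. by apply: invlimP => U; rewrite /= quo_piM gdeltaM. Qed.

Lemma gel1 : gel p (1%g : G) = 1.
Proof. exact: invlimP. Qed.

Lemma gelMV (g : G) : gel p g * gel p g^-1%g = 1.
Proof. by rewrite -gelM mulgV gel1. Qed.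

Lemma gelVM (g : G) : gel p g^-1%g * gel p g = 1.
Proof. by rewrite -gelM mulVg gel1. Qed.

Lemma cga_at_ideal_pow U n x : ideal_pow I n x ->
  ideal_pow (@galg_aug_ideal 'F_p (quo U)) n (cga_at U x).
Proof.
apply: ideal_pow_morph => y; rewrite /aug_ideal /galg_aug_ideal /=.
by rewrite (cga_aug_at U).
Qed.

Lemma is_normal_ideal (J : set A) : two_sided J ->
  is_normal [set g : G | J (gel p g - 1)].
Proof.
move=> tJ; split; [split=> [|x y Jx Jy]|move=> x g Jx] => /=.
- by rewrite gel1 subrr; apply: (two_sided0 tJ).
- have -> : gel p (x * y^-1)%g - 1 = ((gel p x - 1) - (gel p y - 1)) * gel p y^-1%g.
    by rewrite opprB addrA subrK mulrBl gelMV gelM.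
  by apply: (two_sidedMr tJ); apply: (two_sidedB tJ).
- have -> : gel p (x ^ g)%g - 1 = gel p g^-1%g * (gel p x - 1) * gel p g.
    by rewrite mulrBr mulr1 mulrBl gelVM conjgE !gelM !mulrA.
  by apply: (two_sidedMr tJ); apply: (two_sidedMl tJ).
Qed.

Lemma gel_ideal_sub (J : set A) (g h : G) : two_sided J ->
  J (gel p (g^-1 * h)%g - 1) <-> J (gel p h - gel p g).
Proof.
move=> tJ; have E : gel p h - gel p g = gel p g * (gel p (g^-1 * h)%g - 1).
  by rewrite mulrBr mulr1 -gelM mulKVg.
split=> [|]; rewrite E; first exact: (two_sidedMl tJ).
by move=> /(two_sidedMl tJ (gel p g^-1%g)); rewrite mulrA gelVM mul1r.
Qed.

End CgaAug.

(** * Powers of the augmentation ideal of a finitely generated group *)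

Section GeneratedCga.
Variables (p : nat) (G : topGroupType) (d : nat) (s : 'I_d -> G).
Local Notation A := (cga p G).
Local Notation I := (@aug_ideal p G).
Local Notation IU U := (@galg_aug_ideal 'F_p (quo U)).

Hypothesis gen : forall (U : opnsub G) (a : galg 'F_p (quo U)), galg_aug a = 0 ->
  exists b : 'I_d -> galg 'F_p (quo U), a = \sum_j b j * cga_at U (gel p (s j) - 1).

Let x j : A := gel p (s j) - 1.

Let xI j : I (x j). Proof. exact: aug_ideal_gel. Qed.

Lemma galg_ideal_pow_gen (U : opnsub G) n a : ideal_pow (IU U) n.+1 a ->
  exists2 b, (forall j, ideal_pow (IU U) n (b j)) & a = \sum_j b j * cga_at U (x j).
Proof.
apply: ideal_pow_gen; first exact: galg_aug_two_sided.
  by move=> j; apply: etrans (esym (cga_aug_at U (x j))) (xI j).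
by move=> b; apply: gen.
Qed.

(** Each finite level has such an expansion, and transition maps send expansions to expansions, so
    [cga_compact] provides a coherent choice. *)
Lemma closed_ideal_pow_gen n (y : A) : (forall U, ideal_pow (IU U) n.+1 (cga_at U y)) ->
  exists2 b : 'I_d -> A, forall j U, ideal_pow (IU U) n (cga_at U (b j)) &
    y = \sum_j b j * x j.
Proof.
move=> Jy; pose P (U : opnsub G) (b : 'I_d -> galg 'F_p (quo U)) :=
  (forall j, ideal_pow (IU U) n (b j)) /\ cga_at U y = \sum_j b j * cga_at U (x j).
have [||b hb] := @cga_compact p G 'I_d P.
- by move=> U; have [b hb bE] := galg_ideal_pow_gen (Jy U); exists b.
- move=> U V VU b [hb bE]; split=> [j|].
    exact: (galg_map_ideal_pow (quo_projM VU)).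
  have trE z : galg_map (@quo_proj G V U) (cga_at V z) = cga_at U z.
    exact: (il_coh z (VU : @is_le (cga_sys p G) U V)).
  pose F : {additive galg 'F_p (quo V) -> galg 'F_p (quo U)} :=
    HB.pack (galg_map (@quo_proj G V U)) (GRing.isZmodMorphism.Build _ _
      (galg_map (@quo_proj G V U)) (@galg_mapB _ _ _ _)).
  rewrite -trE bE; transitivity (\sum_j F (b j * cga_at V (x j))).
    exact: (raddf_sum F).
  apply: eq_bigr => j _; apply: etrans (galg_mapM (quo_projM VU) _ _) _.
  by congr (_ * _); apply: trE.
exists b => [j U|]; first exact: (hb U).1.
apply: invlimP => U; rewrite -[LHS]/(cga_at U y) (hb U).2.
apply/esym; apply: etrans (raddf_sum (@cga_at p G U) _ _ _) _.
exact: eq_bigr.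
Qed.

(** The number d of terms does not depend on the finite level, which lets the expansions pass to the
    limit; the algebraic power therefore contains its closure. *)
Lemma ideal_pow_closed n (y : A) :
  (forall U, ideal_pow (IU U) n (cga_at U y)) -> ideal_pow I n y.
Proof.
elim: n y => [//|n IH] y /closed_ideal_pow_gen [b hb ->].
apply: (two_sided_sum (ipow_two_sided p G n.+1)) => j _.
have -> : n.+1 = (n + 1)%N by rewrite addn1.
apply: ideal_powM; [exact: aug_ideal_two_sided| exact: IH (hb j)|].
rewrite ideal_pow1; [exact: xI | exact: aug_ideal_two_sided].
Qed.

Lemma aug_ideal_gen y : I y -> exists b, y = \sum_j b j * x j.
Proof.
move=> Iy; have [|b _ yE] := @closed_ideal_pow_gen 0 y; last by exists b.
move=> U; apply: cga_at_ideal_pow; rewrite ideal_pow1 //.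
exact: aug_ideal_two_sided.
Qed.

Lemma ipow_gen n y : ideal_pow I n.+1 y ->
  exists2 b, (forall j, ideal_pow I n (b j)) & y = \sum_j b j * x j.
Proof.
by apply: ideal_pow_gen; [apply: aug_ideal_two_sided | apply: xI | apply: aug_ideal_gen].
Qed.

Lemma ipow_mulx n y j : ideal_pow I n y -> ideal_pow I n.+1 (y * x j).
Proof.
move=> Jy; rewrite -addn1; apply: ideal_powM => //; first exact: aug_ideal_two_sided.
rewrite ideal_pow1; [exact: xI | exact: aug_ideal_two_sided].
Qed.

(** Products of n elements s j - 1 span. Only finiteness is obtained here; the value comes later
    from finite quotients. *)
Lemma has_dim_gr n : exists h, has_dim_quo (ideal_pow I n) (ideal_pow I n.+1) h.
Proof.
suff [T [b [bI bE]]] : exists (T : finType) (b : T -> A), (forall t, ideal_pow I n (b t)) /\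
    forall y, ideal_pow I n y -> exists c : T -> 'F_p,
      ideal_pow I n.+1 (y - \sum_t c t *: b t).
  have [|h _ hh] := has_dim_span (ipow_subspace p G n) (ipow_subspace p G n.+1) _ bI bE.
    by move=> y; apply: ideal_pow_le => //; apply: aug_ideal_two_sided.
  by exists h.
elim: n => [|n [T [b [bI bE]]]].
  exists unit, (fun=> 1); split=> // y _; exists (fun=> cga_aug y).
  rewrite ideal_pow1; last exact: aug_ideal_two_sided.
  rewrite /aug_ideal /= big_const card_unit /= addr0 rmorphB /= linearZ /= rmorph1.
  by rewrite mulr1 subrr.
exists (T * 'I_d)%type, (fun t => b t.1 * x t.2); split=> [t|y /ipow_gen [e eI ->]].
  exact: ipow_mulx.
have [c hc] := choice (fun j => bE _ (eI j)).
exists (fun t => c t.2 t.1).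
rewrite -(pair_bigA _ (fun t j => c j t *: (b t * x j))) /= exchange_big /= -sumrB.
apply: (two_sided_sum (ipow_two_sided p G n.+2)) => j _.
have -> : e j * x j - \sum_t c j t *: (b t * x j) = (e j - \sum_t c j t *: b t) * x j.
  by rewrite mulrBl big_distrl /=; congr (_ - _); apply: eq_bigr => t _; rewrite scalerAl.
exact: ipow_mulx.
Qed.

Lemma ipow_mono m n : (m <= n)%N -> ideal_pow I n `<=` ideal_pow I m.
Proof. by move=> mn y; apply: ideal_pow_le => //; apply: aug_ideal_two_sided. Qed.

Lemma has_dim_ipow (h : nat -> nat) :
  (forall n, has_dim_quo (ideal_pow I n) (ideal_pow I n.+1) (h n)) ->
  forall n, has_dim_quo [set: A] (ideal_pow I n) (\sum_(i < n) h i)%N.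
Proof.
move=> hh; elim=> [|n IH].
  rewrite big_ord0; exists (fun=> 0) => // v _; exists [ffun=> 0]; split=> // c _.
  by apply/ffunP => -[].
rewrite big_ord_recr /= addnC.
by apply: (has_dim_add _ (ipow_subspace p G n) (ipow_subspace p G n.+1)) => //; apply: ipow_mono.
Qed.

(** Write y as its augmentation plus a combination of the s j - 1; knowing the coefficients modulo
    I^n determines y modulo I^(n+1). Scalars of F_p are absorbed by repeating group elements. *)
Lemma gel_span n (y : A) : exists l : seq G, ideal_pow I n (y - \sum_(g <- l) gel p g).
Proof.
pose S n := [set y : A | exists l : seq G, ideal_pow I n (y - \sum_(g <- l) gel p g)].
have SD m u v : S m u -> S m v -> S m (u + v).
  move=> [l hl] [l' hl']; exists (l ++ l'); rewrite big_cat opprD addrACA.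
  by apply: (two_sidedD (ipow_two_sided p G m)).
have S0 m : S m 0.
  by exists [::]; rewrite big_nil subr0; apply: (two_sided0 (ipow_two_sided p G m)).
have Snat m k u : S m u -> S m (u *+ k).
  by move=> Su; elim: k => [|k IH]; rewrite ?mulr0n // mulrS; apply: SD.
have SZ m (k : 'F_p) u : S m u -> S m (k *: u).
  by move=> Su; rewrite -[k]natr_Zp scaler_nat; apply: Snat.
have Sgel m g : S m (gel p g).
  by exists [:: g]; rewrite big_seq1 subrr; apply: (two_sided0 (ipow_two_sided p G m)).
have Ssum m (T : Type) (r : seq T) (F : T -> A) :
    (forall t, S m (F t)) -> S m (\sum_(t <- r) F t).
  move=> SF; elim: r => [|t r IH]; first by rewrite big_nil; apply: S0.
  by rewrite big_cons; apply: (SD).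
rewrite -[exists l, _]/(S n y).
elim: n y => [|n IH] y; first by exists [::].
have [b yE] : exists b, y - cga_aug y *: 1 = \sum_j b j * x j.
  apply: aug_ideal_gen.
  by rewrite /aug_ideal /= rmorphB /= linearZ /= rmorph1 mulr1 subrr.
rewrite -(subrK (cga_aug y *: 1) y) yE; apply: (SD); last first.
  by apply: (SZ); rewrite -(gel1 p G).
apply: (Ssum) => j; have [l hl] := IH (b j).
rewrite -(subrK (\sum_(g <- l) gel p g) (b j)) mulrDl; apply: (SD).
  by exists [::]; rewrite big_nil subr0; apply: ipow_mulx.
rewrite big_distrl; apply: (Ssum) => g; rewrite /= /x mulrBr mulr1 -gelM -scaleN1r; apply: (SD) => //; exact: SZ.
Qed.

(** As F_p is finite, there are finitely many residues modulo I^n. By [ideal_pow_closed] each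
    nonzero residue is detected at some finite level, and a common refinement of these levels
    detects them all. *)
Lemma ipow_open n : exists U : opnsub G,
  forall y : A, ideal_pow (IU U) n (cga_at U y) -> ideal_pow I n y.
Proof.
have hh i := cid (has_dim_gr i).
have [b _ hb] := has_dim_ipow (fun i => svalP (hh i)) n.
set N := (\sum_(i < n) _)%N in b hb.
pose e (c : {ffun 'I_N -> 'F_p}) : A := \sum_i c i *: b i.
have sep c : exists U : opnsub G,
    ideal_pow (IU U) n (cga_at U (e c)) -> ideal_pow I n (e c).
  have [|nI] := pselect (ideal_pow I n (e c)); first by exists (opnT G).
  apply: contrapT => /forallNP h; apply: nI; apply: ideal_pow_closed => U.
  by apply: contrapT => nU; apply: (h U).
have [U hU] := choice sep.
have [W hW] := opnsub_meet_fin U.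
exists W => y Wy; have [c [hc _]] := hb y Logic.I.
apply/(two_sided_subr (ipow_two_sided p G n) hc); apply: hU.
have Ue : ideal_pow (IU W) n (cga_at W (e c)).
  apply/(two_sided_subr (ideal_pow_two_sided (@galg_aug_two_sided _ _) n) (x := cga_at W y)) => //.
  by rewrite -rmorphB; apply: cga_at_ideal_pow.
have trE : galg_map (@quo_proj G W (U c)) (cga_at W (e c)) = cga_at (U c) (e c).
  exact: (il_coh (e c) (hW c : @is_le (cga_sys p G) (U c) W)).
by rewrite -trE; exact: (galg_map_ideal_pow (quo_projM (hW c)) Ue).
Qed.

End GeneratedCga.

(** * Dimension subgroups *)

Section OpenSubgroups.
Variable G : topGroupType.

Lemma lmulg_continuous (g : G) : continuous (fun x : G => (g * x)%g).
Proof.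
move=> x; apply: (cvg_comp (fun y : G => (g, y)) (fun z : G * G => (z.1 * z.2)%g) _
  (@mulg_continuous G (g, x))).
by apply: cvg_pair; [apply: cvg_cst | apply: cvg_id].
Qed.

Lemma open_lmulg (g : G) (H : set G) : open H -> open [set x | H (g * x)%g].
Proof.
move=> oH; apply: (open_comp (f := fun x : G => (g * x)%g) (D := H)) oH.
by move=> x _; apply: lmulg_continuous.
Qed.

Lemma subgroup_open (H : set G) : is_subgroup H -> nbhs 1%g H -> open H.
Proof.
move=> [H1 HV]; rewrite nbhsE => -[W [oW W1] WH].
rewrite openE => x Hx; rewrite /interior nbhsE /=.
exists [set y | W (x^-1 * y)%g]; first by split; [apply: open_lmulg | rewrite /= mulVg].
move=> y /WH Hxy.
have HM a b : H a -> H b -> H (a * b)%g.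
  move=> Ha Hb; rewrite -[b]invgK; apply: (HV) => //.
  by rewrite -[(b^-1)%g]mul1g; apply: (HV).
by rewrite -[y](mulKVg x); apply: HM.
Qed.

Lemma opnsub_sup (H : set G) (W : opnsub G) : is_normal H -> (forall x, W x -> H x) ->
  exists U : opnsub G, forall x, U x <-> H x.
Proof.
move=> nH WH.
have oH : open H.
  apply: subgroup_open; first exact: nH.1.
  rewrite nbhsE; exists (W : set G) => //; split; [exact: opnsub_open | exact: opnsub1].
have fH : exists s : seq G, forall g, exists2 x, x \in s & H (x^-1 * g)%g.
  have [s hs] := opnsub_finite W; exists s => g; have [x xs Wx] := hs g.
  by exists x => //; apply: WH.
by exists (OpnSub oH nH fH).
Qed.

Lemma compact_finite_index (H : set G) : compact [set: G] -> H 1%g -> open H ->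
  exists s : seq G, forall g, exists2 x, x \in s & H (x^-1 * g)%g.
Proof.
move=> G_compact H1 oH; pose Gp : ptopologicalType := HB.pack G (isPointed.Build G 1%g).
have cG : @cover_compact Gp [set: G] by rewrite -(@compact_cover Gp).
have [||E _ hE] := cG G [set: G] (fun g => [set x | H (g^-1 * x)%g]).
- by move=> g _; apply: open_lmulg.
- by move=> g _; exists g => //=; rewrite mulVg.
by exists (enum_fset E) => g; have [e /= eE He] := hE g Logic.I; exists e.
Qed.

End OpenSubgroups.

Section IdealPowLift.
Variables (p : nat) (F : topGroupType) (gT : finGroupType) (f : F -> gT).
Local Notation A := (cga p F).
Local Notation I := (@aug_ideal p F).
Local Notation IQ := (@galg_aug_ideal 'F_p gT).
Hypothesis fM : {morph f : x y / (x * y)%g}.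
Hypothesis fS : forall q, exists z, f z = q.
Variables (T : set A) (n : nat).
Hypotheses (tT : two_sided T) (IT : ideal_pow I n `<=` T).
Hypothesis fT : forall z, f z = 1%g -> T (gel p z - 1).

(* A section of F -> gT extends linearly to F_p[gT] -> F_p[[F]] and is
   multiplicative modulo T. *)
Lemma ideal_pow_lift (l : seq F) :
  ideal_pow IQ n (\sum_(z <- l) gdelta 'F_p (f z)) -> T (\sum_(z <- l) gel p z).
Proof.
pose c q := sval (cid (fS q)); have cK q : f (c q) = q := svalP (cid (fS q)).
have f1 : f 1%g = 1%g by apply: (mulgI (f 1%g)); rewrite -fM !mulg1.
have fV z : f z^-1%g = (f z)^-1%g.
  by apply: (mulgI (f z)); rewrite -fM !mulgV f1.
pose psi (a : galg 'F_p gT) : A := \sum_q a q *: gel p (c q).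
have psi_lin : linear psi.
  move=> k a b; rewrite /psi scaler_sumr -big_split; apply: eq_bigr => q _ /=.
  by rewrite !ffunE scalerDl scalerA.
pose psiL : {linear galg 'F_p gT -> A} := HB.pack psi (GRing.isLinear.Build _ _ _ _ psi psi_lin).
have psi_sum (J : Type) (r : seq J) (E : J -> galg 'F_p gT) :
    psi (\sum_(j <- r) E j) = \sum_(j <- r) psi (E j) by exact: (linear_sum psiL).
have psiZ k a : psi (k *: a) = k *: psi a by exact: (linearZZ psiL).
have psi_delta q : psi (gdelta 'F_p q) = gel p (c q).
  rewrite /psi (bigD1 q) //= ffunE eqxx scale1r big1 ?addr0 // => h /negPf hq.
  by rewrite ffunE hq scale0r.
have psi_f z : T (psi (gdelta 'F_p (f z)) - gel p z).
  rewrite psi_delta; apply/(gel_ideal_sub _ _ tT)/fT.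
  by rewrite fM fV cK mulVg.
have psiM a b : T (psi (a * b) - psi a * psi b).
  have -> : psi (a * b) - psi a * psi b =
      \sum_q \sum_r (a q * b r) *: (psi (gdelta 'F_p (q * r)%g) - gel p (c q * c r)%g).
    rewrite {1}[a]gdelta_sum {1}[b]gdelta_sum big_distrl psi_sum.
    rewrite [psi a]/psi [psi b]/psi big_distrl -sumrB; apply: eq_bigr => q _ /=.
    rewrite !big_distrr psi_sum -sumrB; apply: eq_bigr => r _ /=.
    rewrite -scalerAl -scalerAr -gdeltaM scalerA psiZ -scalerAl -scalerAr -gelM scalerA.
    by rewrite scalerBr.
  apply: (two_sided_sum tT) => q _; apply: (two_sided_sum tT) => r _.
  apply: (subspaceZ (two_sided_subspace tT)).
  by have := psi_f (c q * c r)%g; rewrite fM !cK.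
have psiI a : IQ a -> I (psi a).
  move=> a0; rewrite /aug_ideal /= /psi raddf_sum /=.
  rewrite -[RHS](a0 : galg_aug a = 0); apply: eq_bigr => q _.
  by rewrite cga_augZ cga_aug_gel mulr1.
(* By multiplicativity an m-fold product lifts to an m-fold product modulo T; for m = n the latter
   lies in T by [IT]. *)
have psi_pow m a : ideal_pow IQ m a -> exists2 i, ideal_pow I m i & T (psi a - i).
  elim: m a => [|m IH] a; first by exists (psi a) => //; rewrite subrr; apply: (two_sided0 tT).
  move=> [k [u [w [Iu Jw ->]]]].
  have [i hi] := choice (fun j => (exists2P _ _).1 (IH _ (Jw j))).
  exists (\sum_j psi (u j) * i j).
    apply: (two_sided_sum (ipow_two_sided p F m.+1)) => j _.
    by apply: ideal_powSM; [apply: psiI | apply: (hi j).1].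
  rewrite psi_sum -sumrB; apply: (two_sided_sum tT) => j _ /=.
  rewrite -(subrK (psi (u j) * psi (w j)) (psi (u j * w j))) -addrA -mulrBr.
  by apply: (two_sidedD tT) => //; apply: (two_sidedMl tT); apply: (hi j).2.
move=> /psi_pow [i Ji Ti].
have h : T (psi (\sum_(z <- l) gdelta 'F_p (f z)) - \sum_(z <- l) gel p z).
  rewrite psi_sum -sumrB.
  by apply: (two_sided_sum tT) => z _; apply: psi_f.
apply: (two_sided_subr tT h).1; apply: (two_sided_subr tT Ti).2; exact: IT.
Qed.

End IdealPowLift.

Section Dimsub.
Variables (p : nat) (p_prime : prime p) (G : topGroupType).
Local Notation A := (cga p G).
Local Notation I := (@aug_ideal p G).
Local Notation tI := (ipow_two_sided p G).

Lemma dimsub_normal n : is_normal (@dimsub p G n).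
Proof. exact: (is_normal_ideal (tI n)). Qed.

Lemma dimsub_le m n : (m <= n)%N -> @dimsub p G n `<=` @dimsub p G m.
Proof. by move=> mn g; apply: ideal_pow_le => //; apply: aug_ideal_two_sided. Qed.

Lemma dimsub01 n (g : G) : (n <= 1)%N -> dimsub p n g.
Proof.
move=> n1; apply: (dimsub_le n1).
have h : ideal_pow I 1 (gel p g - 1); last exact: h.
rewrite ideal_pow1; [exact: aug_ideal_gel | exact: aug_ideal_two_sided].
Qed.

Lemma dimsub1g n : dimsub p n (1%g : G).
Proof. exact: (dimsub_normal n).1.1. Qed.

Lemma dimsubV n (g : G) : dimsub p n g -> dimsub p n g^-1%g.
Proof.
by move=> hg; rewrite -[(g^-1)%g]mul1g; apply: (dimsub_normal n).1.2 => //; apply: dimsub1g.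
Qed.

Lemma dimsubM n (g h : G) : dimsub p n g -> dimsub p n h -> dimsub p n (g * h)%g.
Proof.
move=> hg hh; rewrite -[h]invgK; apply: (dimsub_normal n).1.2 => //.
exact: dimsubV.
Qed.

(** In the group algebra, g h - h g is the ring commutator of g - 1 and h - 1. *)
Lemma dimsub_comm m n (g h : G) : dimsub p m g -> dimsub p n h ->
  dimsub p (m + n)%N [~ g, h]%g.
Proof.
rewrite /dimsub /= => hg hh.
have -> : gel p [~ g, h]%g - 1 = gel p (g^-1 * h^-1)%g *
    ((gel p g - 1) * (gel p h - 1) - (gel p h - 1) * (gel p g - 1)).
  have -> : (gel p g - 1) * (gel p h - 1) - (gel p h - 1) * (gel p g - 1) =
      gel p (g * h)%g - gel p (h * g)%g.
    rewrite !mulrBl !mulrBr !mul1r !mulr1 -!gelM.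
    have E (a b c e k : A) : a - c - (b - k) - (e - b - (c - k)) = a - e.
      by rewrite !opprB addrACA !addrA !subrK.
    exact: E.
  rewrite mulrBr -!gelM; congr (gel p _ - _).
    by rewrite /commg /conjg !mulgA.
  by rewrite !mulgA mulgKV mulVg gel1.
apply: (two_sidedMl (tI _)); apply: (two_sidedB (tI _)).
  by apply: ideal_powM => //; apply: aug_ideal_two_sided.
by rewrite addnC; apply: ideal_powM => //; apply: aug_ideal_two_sided.
Qed.

Lemma cga_pchar : p \in [pchar A].
Proof.
rewrite inE p_prime /=; apply/eqP; rewrite -scaler_nat.
by rewrite (pcharf0 (pchar_Fp p_prime)) scale0r.
Qed.

Lemma gelX (g : G) n : gel p (g ^+ n)%g = gel p g ^+ n.
Proof. by elim: n => [|n IH]; rewrite ?expg0 ?gel1 // expgS exprS gelM IH. Qed.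

Lemma gelXp (g : G) : gel p (g ^+ p)%g - 1 = (gel p g - 1) ^+ p.
Proof.
have := pFrobenius_autB_comm cga_pchar (commr1 (gel p g)).
by rewrite !pFrobenius_autE expr1n gelX.
Qed.

Lemma dimsubXp n (g : G) : dimsub p n g -> dimsub p (p * n)%N (g ^+ p)%g.
Proof.
move=> hg; rewrite /dimsub /= gelXp.
by apply: ideal_powX => //; apply: aug_ideal_two_sided.
Qed.

End Dimsub.

(** * Jennings' theorem for finitely generated pro-p-groups *)

Section JenningsProP.
Variables (p : nat) (p_prime : prime p) (G : topGroupType) (d : nat) (s : 'I_d -> G).
Local Notation A := (cga p G).
Local Notation I := (@aug_ideal p G).
Local Notation tI := (ipow_two_sided p G).
Local Notation IU U := (@galg_aug_ideal 'F_p (quo U)).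

Hypothesis gen : forall (U : opnsub G) (a : galg 'F_p (quo U)), galg_aug a = 0 ->
  exists b : 'I_d -> galg 'F_p (quo U), a = \sum_j b j * cga_at U (gel p (s j) - 1).

(** The map from g to g - 1 is a homomorphism of G_n to I^n / I^(n+1): the defect of a product is (g
    - 1)(h - 1) in I^(2n), and 2n >= n + 1 as n > 0. *)
Lemma gel_prod_sub n k (g : 'I_k -> G) (c : 'I_k -> nat) : (0 < n)%N ->
  (forall i, dimsub p n (g i)) ->
  dimsub p n (\prod_i g i ^+ c i)%g /\
  ideal_pow I n.+1 (gel p (\prod_i g i ^+ c i)%g - 1 - \sum_i (gel p (g i) - 1) *+ c i).
Proof.
move=> n0 hg.
have mul (x y : G) u v : dimsub p n x -> dimsub p n y ->
    ideal_pow I n.+1 (gel p x - 1 - u) -> ideal_pow I n.+1 (gel p y - 1 - v) ->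
    ideal_pow I n.+1 (gel p (x * y)%g - 1 - (u + v)).
  move=> hx hy hu hv.
  apply: (two_sided_trans (tI _) (y := (gel p x - 1) + (gel p y - 1))); last first.
    exact: (two_sided_congD (tI n.+1)).
  set a := gel p x - 1 in hx *; set b := gel p y - 1 in hy *.
  have -> : gel p (x * y)%g - 1 - (a + b) = a * b.
    rewrite gelM -(subrK 1 (gel p x)) -(subrK 1 (gel p y)) -/a -/b.
    by rewrite mulrDl !mulrDr !mulr1 !mul1r addrA addrK -[_ + a + b]addrA addrK.
  apply: (@ipow_mono p G n.+1 (n + n)%N); first by rewrite -addn1 leq_add2l.
  by apply: ideal_powM => //; apply: aug_ideal_two_sided.
have one : dimsub p n (1%g : G) by apply: dimsub1g.
have pow (x : G) k' : dimsub p n x -> dimsub p n (x ^+ k')%g /\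
    ideal_pow I n.+1 (gel p (x ^+ k')%g - 1 - (gel p x - 1) *+ k').
  move=> hx; elim: k' => [|m [IH1 IH2]].
    by rewrite expg0 gel1 subrr mulr0n subr0; split=> //; apply: (two_sided0 (tI _)).
  rewrite expgS mulrS; split; first exact: dimsubM.
  by apply: mul => //; rewrite subrr; apply: (two_sided0 (tI _)).
elim: k g c hg => [|k IH] g c hg.
  by rewrite !big_ord0 gel1 subrr subr0; split=> //; apply: (two_sided0 (tI _)).
rewrite !big_ord_recl; have [h1 h2] := pow _ (c ord0) (hg ord0).
have [h3 h4] := IH (fun i => g (lift ord0 i)) (fun i => c (lift ord0 i)) (fun i => hg _).
by split; [apply: dimsubM | apply: mul].
Qed.

(** Shows that [dim_a] is a true dimension rather than the default of [xget]. The quotient G_n /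
    G_(n+1) embeds as an F_p-subspace in the finite-dimensional I^n / I^(n+1), and elements lifting
    a basis of the image have unique exponents below p. *)
Lemma has_gdim_dimsub n : (0 < n)%N ->
  has_gdim_quo p (@dimsub p G n) (@dimsub p G n.+1) (dim_a p G n).
Proof.
move=> n0; suff [a ha] : exists a, has_gdim_quo p (@dimsub p G n) (@dimsub p G n.+1) a.
  exact: (@xgetPex _ 0%N [set m | has_gdim_quo p _ _ m] (ex_intro _ a ha)).
pose W := [set y : A | exists2 g, dimsub p n g & ideal_pow I n.+1 (y - (gel p g - 1))].
have nn : (n <= n.+1)%N by [].
have W1 : ideal_pow I n.+1 `<=` W.
  move=> y Jy; exists 1%g; first exact: dimsub1g.
  by rewrite gel1 subrr subr0.
have W2 : W `<=` ideal_pow I n.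
  move=> y [g hg hy]; rewrite -(subrK (gel p g - 1) y).
  apply: (two_sidedD (tI n)) => //; exact: (ipow_mono nn).
have sW : is_subspace W.
  split=> [|k x y [g hg hx] [h hh hy]]; first by apply: W1; apply: (two_sided0 (tI _)).
  have := @gel_prod_sub n 1 (fun=> g) (fun=> k) n0 (fun=> hg).
  rewrite !big_ord1; set gk := (g ^+ _)%g => -[hgk hgk'].
  have hxk : ideal_pow I n.+1 (k *: x - (gel p g - 1) *+ (k : nat)).
    rewrite -scaler_nat natr_Zp -scalerBr.
    exact: (subspaceZ (ipow_subspace p G n.+1)).
  exists (gk * h)%g; first exact: dimsubM.
  have := @gel_prod_sub n 2 (fun i => if i == ord0 then gk else h) (fun=> 1%N) n0.
  rewrite !big_ord_recl !big_ord0 /= !expg1 mulg1 !mulr1n addr0 => -[|_ hM].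
    by move=> i; case: ifP.
  apply: (two_sided_trans (tI n.+1) _ (two_sided_sym (tI n.+1) hM)).
  apply: (two_sided_congD (tI n.+1)) => //.
  exact: (two_sided_trans (tI n.+1) hxk (two_sided_sym (tI n.+1) hgk')).
have [h0 hh0] := has_dim_gr gen n.
have [a [_ [[b Wb hb] _ _]]] :=
  has_dim_tower (ipow_subspace p G n) sW (ipow_subspace p G n.+1) W1 W2 hh0.
have [g hg] := choice (fun i => (exists2P _ _).1 (Wb i)).
exists a, g => [i|h hh]; first exact: (hg i).1.
pose toF (c : {ffun 'I_a -> 'I_p}) : {ffun 'I_a -> 'F_p} := [ffun i => (c i : nat)%:R].
have val_toF c i : toF c i = c i :> nat.
  by rewrite ffunE val_Fp_nat // modn_small.
have toF_inj c c' : toF c = toF c' -> c = c'.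
  by move=> E; apply/ffunP => i; apply: val_inj; rewrite /= -!val_toF E.
have [e [he ue]] := hb _ (ex_intro2 _ _ h hh (eq_ind_r (ideal_pow I n.+1) (two_sided0 (tI n.+1)) (subrr _))).
have iff (c : {ffun 'I_a -> 'I_p}) : @dimsub p G n.+1 ((\prod_i g i ^+ c i)^-1 * h)%g <->
    ideal_pow I n.+1 (gel p h - 1 - \sum_i toF c i *: b i).
  rewrite [X in X <-> _](gel_ideal_sub _ _ (tI n.+1)).
  have [_ hc] := @gel_prod_sub n a g (fun i => c i) n0 (fun i => (hg i).1).
  have hc' : ideal_pow I n.+1 (gel p (\prod_i g i ^+ c i)%g - 1 - \sum_i toF c i *: b i).
    apply: (two_sided_trans (tI n.+1) hc); rewrite -sumrB.
    apply: (two_sided_sum (tI n.+1)) => i _.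
    rewrite ffunE -scaler_nat -scalerBr; apply: (subspaceZ (ipow_subspace p G n.+1)).
    exact: (two_sided_sym (tI n.+1) (hg i).2).
  have E : gel p h - gel p (\prod_i g i ^+ c i)%g =
    gel p h - 1 - (gel p (\prod_i g i ^+ c i)%g - 1) by rewrite opprB addrA subrK.
  rewrite E; split=> hx; first exact: (two_sided_trans (tI n.+1) hx hc').
  exact: (two_sided_trans (tI n.+1) hx (two_sided_sym (tI n.+1) hc')).
have lt_p (x : 'F_p) : (x < p)%N by rewrite -[X in (_ < X)%N](card_Fp p_prime) card_ord ltn_ord.
exists [ffun i => Ordinal (lt_p (e i))]; split=> [|c /iff /ue ec].
  apply/iff; suff -> : toF [ffun i => Ordinal (lt_p (e i))] = e by [].
  by apply/ffunP => i; rewrite !ffunE /= natr_Zp.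
apply: toF_inj; rewrite -ec.
by apply/ffunP => i; rewrite !ffunE /= natr_Zp.
Qed.

Section AtDimsub.
Variables (N : nat) (U : opnsub G).
Hypothesis UN : forall g, U g <-> dimsub p N g.

(** Nothing of I^n is lost in G / G_N: for g in G_N, g - 1 lies in I^N and hence in I^n, so
    [ideal_pow_lift] applies with T = I^n. *)
Lemma ipow_at n y : (n <= N)%N ->
  ideal_pow (IU U) n (cga_at U y) <-> ideal_pow I n y.
Proof.
move=> nN; split; last exact: cga_at_ideal_pow.
have [l hl] := gel_span gen N y.
have ln := ipow_mono nN hl.
move=> hy; apply: (two_sided_subr (tI n) ln).2.
apply: (@ideal_pow_lift p G _ (@quo_pi G U) (@quo_piM G U) _ _ n (tI n)) => //.
- by move=> q; exists (repr q); apply: quo_reprK.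
- move=> z; rewrite -quo_pi1 => /esym/quo_piE; rewrite invg1 mul1g => /UN.
  exact: dimsub_le.
- have -> : \sum_(z <- l) gdelta 'F_p (quo_pi U z) = cga_at U (\sum_(z <- l) gel p z).
    by rewrite raddf_sum.
  apply: (two_sided_subr (ideal_pow_two_sided (@galg_aug_two_sided _ _) n) _).1 hy.
  by rewrite -rmorphB; apply: cga_at_ideal_pow.
Qed.

(** The image of G_n in G / G_N. The cutoff at N makes the group trivial from N on, and membership
    independent of the representative. *)
Let Qs n := [set q : quo U | `[< dimsub p (minn n N) (repr q) >]]%SET.

Let memQ n g : (quo_pi U g \in Qs n) = `[< dimsub p (minn n N) g >].
Proof.
rewrite finset.inE; apply/asbool_equiv_eq.
have hU : dimsub p (minn n N) (g^-1 * repr (quo_pi U g))%g.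
  by apply: (dimsub_le (geq_minr n N)); apply/UN/quo_piE; rewrite quo_reprK.
split=> h; last by rewrite -(mulKVg g (repr _)); apply: dimsubM.
have -> : g = (repr (quo_pi U g) * (g^-1 * repr (quo_pi U g))^-1)%g.
  by rewrite invgM invgK mulKVg.
by apply: dimsubM => //; apply: dimsubV.
Qed.

Let Qgroup n : group_set (Qs n).
Proof.
apply/group_setP; split=> [|x y].
  by rewrite -quo_pi1 memQ; apply/asboolP; apply: dimsub1g.
rewrite -[x]quo_reprK -[y]quo_reprK -quo_piM !memQ => /asboolP hx /asboolP hy.
by apply/asboolP/dimsubM.
Qed.

Let Q n := Group (Qgroup n).

Let memQP n g : reflect (dimsub p (minn n N) g) (quo_pi U g \in Q n).
Proof. by rewrite -[_ \in _]/(quo_pi U g \in Qs n) memQ; apply: asboolP. Qed.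

Let quo_piV g : quo_pi U g^-1%g = ((quo_pi U g)^-1)%g.
Proof. by apply: (mulgI (quo_pi U g)); rewrite -quo_piM !mulgV quo_pi1. Qed.

Let quo_piX g n : quo_pi U (g ^+ n)%g = (quo_pi U g ^+ n)%g.
Proof. by elim: n => [|n IH]; rewrite ?expg0 ?quo_pi1 // !expgS quo_piM IH. Qed.

Let Qdecr m n : (m <= n)%N -> Q n \subset Q m.
Proof.
move=> mn; apply/fintype.subsetP => q; rewrite -[q]quo_reprK => /memQP h.
by apply/memQP; apply: dimsub_le h; rewrite leq_min geq_minr (leq_trans (geq_minl _ _)).
Qed.

Let Q1 q : q \in Q 1%N.
Proof. by rewrite -[q]quo_reprK; apply/memQP/dimsub01; rewrite geq_minl. Qed.

Let Qcomm m n x y : x \in Q m -> y \in Q n -> [~ x, y]%g \in Q (m + n)%N.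
Proof.
rewrite -[x]quo_reprK -[y]quo_reprK => /memQP hx /memQP hy.
have -> : [~ quo_pi U (repr x), quo_pi U (repr y)]%g = quo_pi U [~ repr x, repr y]%g.
  by rewrite /commg /conjg !quo_piM !quo_piV.
apply/memQP.
apply: dimsub_le (dimsub_comm hx hy).
have [mN|Nm] := leqP m N; have [nN|Nn] := leqP n N.
- exact: geq_minl.
- by apply: leq_trans (geq_minr _ _) _; apply: leq_addl.
- by apply: leq_trans (geq_minr _ _) _; apply: leq_addr.
- by apply: leq_trans (geq_minr _ _) _; apply: leq_addr.
Qed.

Let Qpow m x : x \in Q m -> (x ^+ p)%g \in Q (p * m)%N.
Proof.
rewrite -[x]quo_reprK => /memQP hx; rewrite -quo_piX; apply/memQP.
apply: dimsub_le (dimsubXp p_prime hx).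
have [mN|Nm] := leqP m N; first exact: geq_minl.
by apply: leq_trans (geq_minr _ _) _; apply: leq_pmull; apply: prime_gt0.
Qed.

Let QN : Q N = 1%G.
Proof.
apply/group_inj/finset.setP => q; rewrite -[q]quo_reprK; apply/memQP/set1gP => /=.
  by rewrite minnn => /UN h; rewrite -quo_pi1; apply/esym/quo_piE; rewrite invg1 mul1g.
by rewrite -quo_pi1 => /esym/quo_piE; rewrite invg1 mul1g minnn => /UN.
Qed.

(** Products of the b i with exponents below p, followed by an element of Q (k + 1), parametrise Q k
    bijectively; comparing orders gives the index. *)
Let layer_logE k : (0 < k < N)%N -> layer_log Q p (Q 1) k = dim_a p G k.
Proof.
move=> /andP[k0 kN].
have QI m : (Q 1 :&: Q m)%g = Q m.
  by apply/finset.setIidPr/fintype.subsetP => q _; apply: Q1.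
rewrite /layer_log !QI.
have [b hb ub] := has_gdim_dimsub k0.
have mk : minn k N = k by apply/minn_idPl/ltnW.
have mk1 : minn k.+1 N = k.+1 by apply/minn_idPl.
pose f (t : {ffun 'I_(dim_a p G k) -> 'I_p} * quo U) : quo U :=
  (quo_pi U (\prod_i b i ^+ t.1 i)%g * t.2)%g.
pose D := [set t : {ffun 'I_(dim_a p G k) -> 'I_p} * quo U | t.2 \in Q k.+1]%SET.
have memD t : (t \in D) = (t.2 \in Q k.+1) by apply: finset.in_set.
have prodQ (c : {ffun 'I_(dim_a p G k) -> 'I_p}) : dimsub p k (\prod_i b i ^+ c i)%g.
  exact: (@gel_prod_sub k _ b (fun i => c i) k0 hb).1.
have fD : f @: D = Q k :> {set quo U}.
  apply/finset.setP => q; apply/imsetP/idP => [[[c r]]|].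
    rewrite memD => hr ->; apply: groupM; first by apply/memQP; rewrite mk.
    exact: (fintype.subsetP (Qdecr (leqnSn k))).
  rewrite -[q]quo_reprK => /memQP; rewrite mk => hq.
  have [c [hc _]] := ub _ hq.
  exists (c, quo_pi U ((\prod_i b i ^+ c i)^-1 * repr q)%g).
    by rewrite memD; apply/memQP; rewrite mk1.
  by rewrite /f /= -quo_piM mulKVg.
have f_inj : {in D &, injective f}.
  move=> [c r] [c' r']; rewrite !memD /= -[r]quo_reprK -[r']quo_reprK.
  move=> /memQP; rewrite mk1 => hr /memQP; rewrite mk1 => hr'.
  rewrite /f /= -!quo_piM => E.
  have hg : dimsub p k (\prod_i b i ^+ c i * repr r)%g.
    by apply: dimsubM => //; apply: dimsub_le hr.
  have [c0 [_ uc]] := ub _ hg.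
  have cc : c = c'.
    rewrite -(uc c) ?mulKg //; apply: uc.
    move/quo_piE: (esym E) => /UN/(dimsub_le kN) E'.
    have := dimsubM hr' E'.
    by rewrite invgM -!mulgA mulKVg.
  subst c'; congr (_, _); move: E; rewrite !quo_piM; exact: mulgI.
have cD : #|Q k| = (p ^ dim_a p G k * #|Q k.+1|)%N.
  rewrite -fD card_in_imset //.
  have -> : D = finset.setX [set: {ffun 'I_(dim_a p G k) -> 'I_p}]%SET (Q k.+1).
    by apply/finset.setP => -[c r]; rewrite memD finset.in_setX finset.in_setT.
  by rewrite cardsX cardsT card_ffun !card_ord.
rewrite -divgS ?Qdecr // cD mulnK ?cardG_gt0 //.
by rewrite pfactorK.
Qed.

Hypothesis G_pgroup : p.-nat #|{: quo U}|.

(** The finite theorem for G / G_N, whose graded pieces below N agree with those of F_p[[G]] by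
    [ipow_at]. *)
Lemma has_dim_gr_at n : (n < N)%N -> has_dim_quo (ideal_pow I n) (ideal_pow I n.+1)
  ((\prod_(1 <= k < N) layer_poly p k ^+ dim_a p G k)`_n)%R.
Proof.
move=> nN.
have chF := pchar_Fp p_prime.
have pQ : (p.-group (Q 1%N))%g by rewrite /pgroup (eq_card (B := {: quo U})) // => q; rewrite Q1.
(* The weight filtration is the augmentation filtration: q - 1 lies in the m-th power for q in Q m,
   and conversely every q has weight at least 1. *)
have wI m (a : galg 'F_p (quo U)) : wprod Q (Q 1%N) m a <-> ideal_pow (IU U) m a.
  have tU := galg_aug_two_sided 'F_p (quo U).
  have tUm m' := ideal_pow_two_sided tU m'.
  split=> [|].
    elim=> {m a} [m||m k a b _ IHa _ IHb|m m' a mm _ IH|q m m' a _ qQ _ IH].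
    - exact: (two_sided0 (tUm m)).
    - by [].
    - exact: (two_sided_subspace (tUm m)).2.
    - exact: ideal_pow_le IH.
    - apply: ideal_powM => //; move: qQ; rewrite -[q]quo_reprK => /memQP.
      have [mN h|Nm /UN h] := leqP m N; first exact: (cga_at_ideal_pow U h).
      rewrite (_ : quo_pi U (repr q) = 1%g) ?gdelta1 ?subrr; first exact: (two_sided0 (tUm m)).
      by rewrite -quo_pi1; apply/esym/quo_piE; rewrite invg1 mul1g.
  elim: m a => [|m IH] a.
    move=> _; rewrite [a]gdelta_sum.
    apply: (subspace_sum (wprod_subspace 'F_p Q (Q 1%N) 0)) => q _.
    by apply: (subspaceZ (wprod_subspace 'F_p Q (Q 1%N) 0)); apply: (wprod_delta 'F_p Qdecr Q1); apply: Q1.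
  move=> [k [u [w [Iu Jw ->]]]].
  apply: (subspace_sum (wprod_subspace 'F_p Q (Q 1%N) m.+1)) => j _.
  have uE : u j = \sum_q u j q *: (gdelta 'F_p q - 1).
    under eq_bigr do rewrite scalerBr.
    rewrite sumrB -gdelta_sum -scaler_suml -[\sum_q _]/(galg_aug (u j)).
    by rewrite (Iu j : galg_aug (u j) = 0) scale0r subr0.
  rewrite uE big_distrl /=; apply: (subspace_sum (wprod_subspace 'F_p Q (Q 1%N) m.+1)) => q _.
  rewrite -scalerAl; apply: (subspaceZ (wprod_subspace 'F_p Q (Q 1%N) m.+1)).
  by rewrite -[m.+1]add1n; apply: wprod_mul; rewrite ?Q1 //; apply: IH (Jw j).
have := has_dim_wprod Qdecr Q1 Qcomm chF Qpow pQ QN (Q 1%N) n.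
have -> : wprod Q (Q 1%N) n = ideal_pow (IU U) n.
  by apply/seteqP; split=> a; move/wI.
have -> : wprod Q (Q 1%N) n.+1 = ideal_pow (IU U) n.+1.
  by apply/seteqP; split=> a; move/wI.
have -> : jennings_poly Q p N (Q 1%N) =
    \prod_(1 <= k < N) layer_poly p k ^+ dim_a p G k.
  by apply: eq_big_nat => k kN; rewrite layer_logE.
set h := (_`_n); move=> hU.
have [h' hh'] := has_dim_gr gen n.
have tU m := ideal_pow_two_sided (@galg_aug_two_sided 'F_p (quo U)) m.
suff hU' : has_dim_quo (ideal_pow (IU U) n) (ideal_pow (IU U) n.+1) h'.
  have sU m := two_sided_subspace (tU m).
  by rewrite (has_dim_uniq (sU n) (sU n.+1) hU hU').
have atE (l : seq G) : cga_at U (\sum_(g <- l) gel p g) = \sum_(g <- l) gdelta 'F_p (quo_pi U g).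
  by rewrite raddf_sum.
apply: (has_dim_transport (T := @cga_at p G U)) hh'.
- exact: two_sided_subspace.
- exact: two_sided_subspace.
- by move=> a; apply: ideal_pow_le => //; apply: galg_aug_two_sided.
- by move=> y; apply: cga_at_ideal_pow.
- by move=> y _; apply: ipow_at.
- move=> a Ja.
  pose y : cga p G := \sum_q a q *: gel p (repr q).
  have yE : cga_at U y = a.
    rewrite [RHS]gdelta_sum /y raddf_sum; apply: eq_bigr => q _.
    by apply: etrans (cga_atZ U (a q) (gel p (repr q))) _; rewrite cga_at_gel quo_reprK.
  exists y; first by apply/(ipow_at _ (ltnW nN)); rewrite yE.
  have E : a - cga_at U y = 0 by rewrite yE subrr.
  exact: (eq_ind_r (ideal_pow (IU U) n.+1) (two_sided0 (tU n.+1)) E).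
- exact: ipow_subspace.
Qed.

End AtDimsub.

End JenningsProP.

(** * Growth of analytic groups *)

Section Padic.
Variables (p : nat) (p_prime : prime p).
Local Notation Zp := (padic p).
Implicit Types x y z : Zp.

Let p_gt1 : (1 < p)%N := prime_gt1 p_prime.

Let pX_gt1 i : (1 < p ^ i.+1)%N.
Proof. by rewrite -{1}(exp1n i.+1) ltn_exp2r. Qed.

Let pX_gt0 i : (0 < p ^ i)%N.
Proof. by rewrite expn_gt0 (ltnW p_gt1). Qed.

(** The residue modulo p^(i+1); the shift comes from [padic_sys], which starts at Z/p. *)
Definition padic_digits x i : nat := (x i : 'Z_(p ^ i.+1)).

Lemma padic_digits_lt x i : (padic_digits x i < p ^ i.+1)%N.
Proof. by rewrite -[X in (_ < X)%N](Zp_cast (pX_gt1 i)); apply: ltn_ord. Qed.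

Lemma padic_digits_mod x i j : (i <= j)%N ->
  (padic_digits x j %% p ^ i.+1)%N = padic_digits x i.
Proof.
move=> ij; rewrite /padic_digits -[X in _ = nat_of_ord X](il_coh x (ij : @is_le (padic_sys p) i j)).
by rewrite /is_tr /= val_Zp_nat.
Qed.

Lemma padic_digits_inj x y : padic_digits x =1 padic_digits y -> x = y.
Proof. by move=> xy; apply: invlimP => i; apply: val_inj; apply: xy. Qed.

Lemma padic_digitsM x y i :
  padic_digits (x * y) i = (padic_digits x i * padic_digits y i %% p ^ i.+1)%N.
Proof.
transitivity ((padic_digits x i * padic_digits y i) %% (Zp_trunc (p ^ i.+1)).+2)%N => //.
by rewrite Zp_cast.
Qed.

Lemma padic_natE n i : (n%:R : Zp) i = n%:R :> 'Z_(p ^ i.+1).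
Proof. by elim: n => // n IH; rewrite -[n.+1]addn1 !natrD invlimDE IH. Qed.

Lemma padic_digits_nat n i : padic_digits n%:R i = (n %% p ^ i.+1)%N.
Proof. by rewrite /padic_digits padic_natE val_Zp_nat. Qed.

Lemma padic_digits0 i : padic_digits 0 i = 0%N.
Proof. by []. Qed.

Lemma padic_pX_eq0 k z : (p ^ k)%:R * z = 0 -> z = 0.
Proof.
move=> z0; apply: padic_digits_inj => i; rewrite padic_digits0.
have := congr1 (fun x => padic_digits x (i + k)%N) z0.
rewrite padic_digitsM padic_digits0 padic_digits_nat.
rewrite [(p ^ k %% _)%N]modn_small ?ltn_exp2l ?ltnS ?leq_addl //.
have -> : ((i + k).+1 = k + i.+1)%N by rewrite addnS addnC.
rewrite expnD -muln_modr => /eqP; rewrite muln_eq0 -leqn0 leqNgt pX_gt0 /=.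
by rewrite (padic_digits_mod z (leq_addr k i)) => /eqP.
Qed.

(** The quotient has at level i the residue of z taken k levels higher and divided by p^k; here k =
    n + 1, because the n-th residue is modulo p^(n+1). *)
Lemma padic_dvd_digits n z : (padic_digits z n = 0)%N -> padic_dvd n.+1 z.
Proof.
move=> zn; set k := n.+1.
have kd i : (p ^ k %| padic_digits z (i + k))%N.
  by rewrite /dvdn padic_digits_mod ?zn // /k addnS ltnW // ltnS leq_addl.
pose y i : 'Z_(p ^ i.+1) := (padic_digits z (i + k) %/ p ^ k)%N%:R.
have coh i j : @is_le (padic_sys p) i j -> @is_tr (padic_sys p) i j (y j) = y i.
  move=> ij; apply: val_inj; rewrite /is_tr /= !val_Zp_nat //.
  rewrite modn_dvdm ?dvdn_exp2l //.
  have ijk : (i + k <= j + k)%N by rewrite leq_add2r.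
  by rewrite -(padic_digits_mod z ijk) -addSn expnD -modn_divl modn_mod.
exists (InvLim coh); apply: padic_digits_inj => i.
rewrite padic_digitsM padic_digits_nat /padic_digits /= val_Zp_nat // modnMml modnMmr.
by rewrite mulnC divnK // (padic_digits_mod z (leq_addr k i)).
Qed.

(** Reducing modulo p^n once more covers n = 0, where the only residue is 0. *)
Definition padic_residue n x : 'I_(p ^ n) :=
  Ordinal (ltn_pmod (padic_digits x n.-1) (pX_gt0 n)).

Lemma padic_residueP n x y : padic_residue n x = padic_residue n y -> padic_dvd n (x - y).
Proof.
case: n => [|n]; first by exists (x - y); rewrite expn0 mul1r.
move=> /(congr1 val) /=; rewrite !modn_small ?padic_digits_lt // => xy.
apply: padic_dvd_digits; rewrite /padic_digits invlimDE invlimNE.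
by rewrite (val_inj xy : x n = y n) subrr.
Qed.

Lemma padic_dvd0 n : padic_dvd n (0 : Zp).
Proof. by exists 0; rewrite mulr0. Qed.

Lemma padic_dvdD n x y : padic_dvd n x -> padic_dvd n y -> padic_dvd n (x + y).
Proof. by move=> [u ->] [w ->]; exists (u + w); rewrite mulrDr. Qed.

Lemma padic_dvdN n x : padic_dvd n x -> padic_dvd n (- x).
Proof. by move=> [u ->]; exists (- u); rewrite mulrN. Qed.

Lemma padic_dvdB n x y : padic_dvd n x -> padic_dvd n y -> padic_dvd n (x - y).
Proof. by move=> hx hy; apply: padic_dvdD => //; apply: padic_dvdN. Qed.

Lemma padic_dvdMl n x y : padic_dvd n x -> padic_dvd n (y * x).
Proof. by move=> [u ->]; exists (y * u); rewrite mulrCA. Qed.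

Lemma padic_dvdMr n x y : padic_dvd n x -> padic_dvd n (x * y).
Proof. by rewrite mulrC; apply: padic_dvdMl. Qed.

Lemma padic_dvdM m n x y : padic_dvd m x -> padic_dvd n y -> padic_dvd (m + n)%N (x * y).
Proof. by move=> [u ->] [w ->]; exists (u * w); rewrite mulrACA -natrM -expnD. Qed.

Lemma padic_dvd_le m n x : (m <= n)%N -> padic_dvd n x -> padic_dvd m x.
Proof.
by move=> mn [u ->]; exists ((p ^ (n - m))%:R * u); rewrite mulrA -natrM -expnD subnKC.
Qed.

Lemma padic_dvd_sum n (T : Type) (r : seq T) (P : pred T) (u : T -> Zp) :
  (forall t, P t -> padic_dvd n (u t)) -> padic_dvd n (\sum_(t <- r | P t) u t).
Proof.
by move=> h; elim/big_ind: _ => // [|x y]; [apply: padic_dvd0 | apply: padic_dvdD].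
Qed.

Lemma padic_dvd_congM n x y x' y' : padic_dvd n (x - y) -> padic_dvd n (x' - y') ->
  padic_dvd n (x * x' - y * y').
Proof.
move=> h h'; have -> : x * x' - y * y' = (x - y) * x' + y * (x' - y').
  by rewrite mulrBl mulrBr addrA subrK.
by apply: padic_dvdD; [apply: padic_dvdMr | apply: padic_dvdMl].
Qed.

Lemma padic_dvd_congX n x y k : padic_dvd n (x - y) -> padic_dvd n (x ^+ k - y ^+ k).
Proof.
move=> h; elim: k => [|k IH]; first by rewrite !expr0 subrr; apply: padic_dvd0.
by rewrite !exprS; apply: padic_dvd_congM.
Qed.

Lemma padic_dvd_cong_prod n (T : Type) (r : seq T) (u v : T -> Zp) :
  (forall t, padic_dvd n (u t - v t)) -> padic_dvd n (\prod_(t <- r) u t - \prod_(t <- r) v t).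
Proof.
move=> h; elim: r => [|t r IH]; first by rewrite !big_nil subrr; apply: padic_dvd0.
by rewrite !big_cons; apply: padic_dvd_congM.
Qed.

Lemma padic_dvd_cancel k n x : padic_dvd (k + n)%N ((p ^ k)%:R * x) -> padic_dvd n x.
Proof.
move=> [u]; rewrite expnD natrM -mulrA => E; exists u.
apply/eqP; rewrite -subr_eq0; apply/eqP/(@padic_pX_eq0 k).
by rewrite mulrBr E subrr.
Qed.

Section Vectors.
Variable m : nat.
Implicit Types u w : 'rV[Zp]_m.

Definition vec_dvd n u := forall j, padic_dvd n (u 0 j).

Lemma vec_dvdP n u : vec_dvd n u <-> exists w, u = (p ^ n)%:R *: w.
Proof.
split=> [h|[w ->] j]; last by exists (w 0 j); rewrite mxE.
have [w hw] := choice h; exists (\row_j w j).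
by apply/rowP => j; rewrite !mxE.
Qed.

Lemma vec_dvdD n u w : vec_dvd n u -> vec_dvd n w -> vec_dvd n (u + w).
Proof. by move=> hu hw j; rewrite mxE; apply: padic_dvdD. Qed.

Lemma vec_dvdB n u w : vec_dvd n u -> vec_dvd n w -> vec_dvd n (u - w).
Proof. by move=> hu hw j; rewrite !mxE; apply: padic_dvdB. Qed.

Lemma vec_dvd_le n k u : (n <= k)%N -> vec_dvd k u -> vec_dvd n u.
Proof. by move=> nk hu j; apply: padic_dvd_le (hu j). Qed.

Lemma vec_dvd0 n : vec_dvd n (0 : 'rV[Zp]_m).
Proof. by move=> j; rewrite mxE; apply: padic_dvd0. Qed.

End Vectors.

(* Only the terms of the expansion which involve both arguments survive in
   f(x, y) - f(x, 0) - f(0, y) + f(0, 0). *)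
Lemma analytic_mixed_difference m (f : 'rV[Zp]_(m + m) -> 'rV[Zp]_m) (y0 : 'rV[Zp]_m) :
  analytic_at f (row_mx y0 y0) -> exists h c : nat, forall a b (u w : 'rV[Zp]_m),
    (h <= a)%N -> (h <= b)%N -> vec_dvd a u -> vec_dvd b w ->
    vec_dvd (a + b - c)%N (f (row_mx (y0 + u) (y0 + w)) - f (row_mx (y0 + u) y0)
      - f (row_mx y0 (y0 + w)) + f (row_mx y0 y0)).
Proof.
move=> [h hf].
have [k hk] := choice hf.
pose K := (\max_j k j)%N.
(* The loss is h for rescaling each of the two arguments to the unit polydisc, and K for the
   denominators of all coordinates. *)
exists h, (h + h + K)%N => a b u w ha hb /vec_dvdP [u' uE] /vec_dvdP [w' wE] j.
have [coef [_ hc]] := hk j.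
set s := (a - h)%N; set t := (b - h)%N.
pose X := (p ^ s)%:R *: u'; pose Y := (p ^ t)%:R *: w'.
have uX : u = (p ^ h)%:R *: X by rewrite uE scalerA -natrM -expnD subnKC.
have wY : w = (p ^ h)%:R *: Y by rewrite wE scalerA -natrM -expnD subnKC.
have yE (U W : 'rV[Zp]_m) : row_mx (y0 + (p ^ h)%:R *: U) (y0 + (p ^ h)%:R *: W) =
    row_mx y0 y0 + (p ^ h)%:R *: row_mx U W.
  by rewrite scale_row_mx add_row_mx.
have [D1 h1] := hc (row_mx X Y) (s + t)%N; have [D2 h2] := hc (row_mx X 0) (s + t)%N.
have [D3 h3] := hc (row_mx 0 Y) (s + t)%N; have [D4 h4] := hc (row_mx 0 0) (s + t)%N.
pose D := (D1 + D2 + D3 + D4)%N.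
have {}h1 := h1 D (leq_trans (leq_addr _ _) (leq_trans (leq_addr _ _) (leq_addr _ _))).
have {}h2 := h2 D (leq_trans (leq_addl _ _) (leq_trans (leq_addr _ _) (leq_addr _ _))).
have {}h3 := h3 D (leq_trans (leq_addl _ _) (leq_addr _ _)).
have {}h4 := h4 D (leq_addl _ _).
rewrite -!yE -?uX -?wY scaler0 addr0 in h1 h2 h3 h4.
pose S (Z : 'rV[Zp]_(m + m)) := \sum_(al : {ffun 'I_(m + m) -> 'I_D})
  coef (fun i => al i) * \prod_i Z 0 i ^+ al i.
rewrite -/(S _) in h1; rewrite -/(S _) in h2; rewrite -/(S _) in h3; rewrite -/(S _) in h4.
have hS : padic_dvd (s + t)%N (S (row_mx X Y) - S (row_mx X 0) - S (row_mx 0 Y) + S (row_mx 0 0)).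
  rewrite /S -!sumrB -big_split; apply: padic_dvd_sum => al _ /=.
  rewrite -!mulrBr -mulrDr; apply: padic_dvdMl.
  pose Ml (Z : 'rV[Zp]_m) := \prod_i Z 0 i ^+ al (lshift m i).
  pose Mr (Z : 'rV[Zp]_m) := \prod_i Z 0 i ^+ al (rshift m i).
  have ME Z Z' : \prod_i (row_mx Z Z') 0 i ^+ al i = Ml Z * Mr Z'.
    rewrite big_split_ord; congr (_ * _); apply: eq_bigr => i _ /=.
      by rewrite row_mxEl.
    by rewrite row_mxEr.
  (* The mixed difference of a monomial factors; one factor is divisible by p^s, the other by
     p^t. *)
  rewrite !ME; have -> : Ml X * Mr Y - Ml X * Mr 0 - Ml 0 * Mr Y + Ml 0 * Mr 0 =
      (Ml X - Ml 0) * (Mr Y - Mr 0).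
    by rewrite mulrBl !mulrBr opprB addrA addrAC.
  apply: padic_dvdM; apply: padic_dvd_cong_prod => i; apply: padic_dvd_congX;
    by rewrite !mxE subr0; apply: padic_dvdMr; exists 1; rewrite mulr1.
have {h1 h2 h3 h4} hT := padic_dvdD (padic_dvdB (padic_dvdB h1 h2) h3) (padic_dvdD h4 hS).
have {}hT : padic_dvd (s + t)%N ((p ^ k j)%:R * (f (row_mx (y0 + u) (y0 + w)) - f (row_mx (y0 + u) y0)
      - f (row_mx y0 (y0 + w)) + f (row_mx y0 y0)) 0 j).
  move: hT; rewrite !mxE.
  set A1 := f _ 0 j; set A2 := f _ 0 j; set A3 := f _ 0 j; set A4 := f _ 0 j.
  set S1 := S _; set S2 := S _; set S3 := S _; set S4 := S _; set q := (p ^ _)%:R.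
  suff -> : q * A1 - S1 - (q * A2 - S2) - (q * A3 - S3) + (q * A4 - S4 + (S1 - S2 - S3 + S4)) =
    q * (A1 - A2 - A3 + A4) by [].
  by rewrite /q; ring.
have le : (a + b - (h + h + K) <= s + t - k j)%N.
  have kK : (k j <= K)%N by apply: leq_bigmax.
  have -> : (s + t = a + b - (h + h))%N by rewrite /s /t; lia.
  by rewrite subnDA leq_sub2l.
apply: padic_dvd_le le _; have [kst|kst] := leqP (k j) (s + t)%N.
  by apply: (@padic_dvd_cancel (k j)); rewrite subnKC.
(* If the denominator exceeds the precision, the claim is only divisibility by p^0. *)
rewrite (eqP (ltnW kst : (_ - _ == 0)%N)); exists ((f (row_mx (y0 + u) (y0 + w)) - f (row_mx (y0 + u) y0)
      - f (row_mx y0 (y0 + w)) + f (row_mx y0 y0)) 0 j).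
by rewrite expn0 mul1r.
Qed.

End Padic.

(** * Index growth of the dimension subgroups, seen in a chart *)

Section Growth.
Variables (p : nat) (p_prime : prime p) (G : topGroupType).
Hypothesis G_compact : compact [set: G].
Local Notation Zp := (padic p).
Variables (m h c : nat) (D : set G) (xi : G -> 'rV[Zp]_m).
Hypothesis xi1 : xi 1%g = 0.
Hypothesis D1 : D 1%g.
Hypothesis xiM : forall a b g g', (h <= a)%N -> (h <= b)%N -> D g -> D g' ->
  vec_dvd a (xi g) -> vec_dvd b (xi g') ->
  vec_dvd (a + b - c)%N (xi (g * g')%g - xi g - xi g').
Hypothesis xi_cont : forall n, \forall g \near 1%g, D g /\ vec_dvd n (xi g).
Hypothesis xi_onto : forall W : set G, nbhs 1%g W ->
  exists n, forall v, vec_dvd n v -> exists g, [/\ D g, W g & xi g = v].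
Hypothesis xi_inj : forall g g', D g -> D g' -> xi g = xi g' -> g = g'.
Hypothesis dimsub_nbhs : forall n, nbhs 1%g (@dimsub p G n).

Let W n : set G := [set g | D g /\ vec_dvd n (xi g)].

Let W_le n k : (n <= k)%N -> W k `<=` W n.
Proof. by move=> nk g [Dg hg]; split=> //; apply: vec_dvd_le hg. Qed.

Let W_basis V : nbhs 1%g V -> exists n, W n `<=` V.
Proof.
move=> /xi_onto [n hn]; exists n => g [Dg /hn [g' [Dg' Vg' E]]].
by rewrite (xi_inj Dg Dg' (esym E)).
Qed.

(** From h on the estimate [xiM] applies; from c + 2 on its error i + i - c is at least i + 2,
    beyond the order i + 1 of the leading term p xi(g) of a p-th power. *)
Let i1 := maxn h c.+2.

Let ex_i0 : exists i0, (i1 <= i0)%N /\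
  [/\ forall g g', W i0 g -> W i0 g' -> W i1 (g^-1 * g')%g,
      forall g g', W i0 g -> W i0 g' -> W i1 (g * g')%g &
      forall n v, (i0 <= n)%N -> vec_dvd n v -> exists g, D g /\ xi g = v].
Proof.
have nW : nbhs 1%g (W i1) := xi_cont i1.
have [n1 hn1] : exists n, forall g g', W n g -> W n g' -> W i1 (g * g')%g.
  have := @mulg_continuous G (1%g, 1%g) (W i1).
  rewrite /= mulg1 => /(_ nW) [[V1 V2] /= [nV1 nV2] hV].
  have [n hn] := W_basis nV1; have [n' hn'] := W_basis nV2.
  exists (n + n')%N => g g' hg hg'; apply: (hV (g, g')); split=> /=.
    by apply/hn/(W_le (leq_addr n' n)).
  by apply/hn'/(W_le (leq_addl n n')).
have [n2 hn2] : exists n, forall g, W n g -> W n1 g^-1%g.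
  have := @invg_continuous G 1%g (W n1).
  rewrite invg1 => /(_ (xi_cont n1)) /W_basis [n hn].
  by exists n => g /hn.
have [n3 hn3] := xi_onto (filterT (F := nbhs (1%g : G))).
exists (i1 + n1 + n2 + n3)%N; split; first by rewrite -!addnA leq_addr.
split=> [g g' hg hg'|g g' hg hg'|n v hn hv].
- by apply: hn1; [apply: hn2; apply: W_le hg | apply: W_le hg']; lia.
- by apply: hn1; [apply: W_le hg | apply: W_le hg']; lia.
- by have [|g [Dg _ E]] := hn3 v; [apply: vec_dvd_le hv; lia | exists g].
Qed.

Let i0 := sval (cid ex_i0).
Let i10 : (i1 <= i0)%N. Proof. by have [] := svalP (cid ex_i0). Qed.
Let WVM g g' : W i0 g -> W i0 g' -> W i1 (g^-1 * g')%g.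
Proof. by have [_ []] := svalP (cid ex_i0) => + _ _; apply. Qed.
Let WM1 g g' : W i0 g -> W i0 g' -> W i1 (g * g')%g.
Proof. by have [_ []] := svalP (cid ex_i0) => _ + _; apply. Qed.
Let onto n v : (i0 <= n)%N -> vec_dvd n v -> exists g, D g /\ xi g = v.
Proof. by have [_ []] := svalP (cid ex_i0) => _ _; apply. Qed.

Let hi1 : (h <= i1)%N. Proof. exact: leq_maxl. Qed.
Let ci1 : (c.+2 <= i1)%N. Proof. exact: leq_maxr. Qed.

(** With g' = g q, [xiM] gives xi q = xi g' - xi g up to an error of higher order than the one known
    for xi q; so each round gains a power of p until l is reached. *)
Let W_coset l g g' : W i0 g -> W i0 g' -> vec_dvd l (xi g' - xi g) -> W l (g^-1 * g')%g.
Proof.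
move=> Wg Wg' hl; have [Dq hq] := WVM Wg Wg'.
set q := (g^-1 * g')%g in Dq hq *; have gq : g' = (g * q)%g by rewrite mulKVg.
split=> //; suff hj j : (i1 <= j)%N -> (j <= maxn i1 l)%N -> vec_dvd j (xi q).
  by apply: vec_dvd_le (hj _ (leq_maxl _ _) (leqnn _)); apply: leq_maxr.
elim: j => [|j IH]; first by move=> _ _ k; exists (xi q 0 k); rewrite mul1r.
rewrite leq_eqVlt => /predU1P[<- //|]; rewrite ltnS => ij jl.
have {}IH := IH ij (ltnW jl).
have Wg1 : vec_dvd i1 (xi g) := vec_dvd_le i10 Wg.2.
have := xiM hi1 (leq_trans hi1 ij) Wg.1 Dq Wg1 IH; rewrite -gq => hB.
have -> : xi q = xi g' - xi g - (xi g' - xi g - xi q) by rewrite opprB addrC subrK.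
apply: vec_dvdB; first by apply: vec_dvd_le hl; move: jl ij; clear; lia.
by apply: vec_dvd_le hB; move: ci1 ij; clear; lia.
Qed.

Let W_mul i g g' : (i0 <= i)%N -> W i g -> W i g' ->
  W i (g * g')%g /\ vec_dvd i.+2 (xi (g * g')%g - xi g - xi g').
Proof.
move=> ii Wg Wg'; have [Dq _] := WM1 (W_le ii Wg) (W_le ii Wg').
have hi : (h <= i)%N := leq_trans hi1 (leq_trans i10 ii).
have hB := xiM hi hi Wg.1 Wg'.1 Wg.2 Wg'.2.
have le : (i.+2 <= i + i - c)%N by move: ci1 i10 ii; clear; lia.
have {}hB := vec_dvd_le le hB; split=> //; split=> //.
rewrite -[xi (g * g')%g](subrK (xi g')) -[xi (g * g')%g - _](subrK (xi g)).
rewrite [_ - xi g' - xi g]addrAC; apply: vec_dvdD Wg'.2; apply: vec_dvdD Wg.2.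
by apply: vec_dvd_le hB; rewrite -addn2 leq_addr.
Qed.

Let W_pow i g n : (i0 <= i)%N -> W i g ->
  W i (g ^+ n)%g /\ vec_dvd i.+2 (xi (g ^+ n)%g - xi g *+ n).
Proof.
move=> ii Wg; elim: n => [|n [IH1 IH2]].
  rewrite expg0 mulr0n subr0 xi1; split; last exact: vec_dvd0.
  by split; rewrite ?xi1 //; apply: vec_dvd0.
have [h1 h2] := W_mul ii IH1 Wg.
rewrite expgSr; split=> //; rewrite mulrSr opprD addrA.
have -> : xi (g ^+ n * g)%g - xi g *+ n - xi g =
    (xi (g ^+ n * g)%g - xi (g ^+ n)%g - xi g) + (xi (g ^+ n)%g - xi g *+ n).
  by rewrite [RHS]addrA [_ - _ - xi g in RHS]addrAC subrK addrAC.
exact: vec_dvdD.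
Qed.

(** Choose x with p xi(x) = xi(z). Then x^p and z have the same coordinates modulo p^(i+2), and
    [W_coset] turns this into a statement on their quotient. *)
Let W_root i z : (i0 <= i)%N -> W i.+1 z ->
  exists2 x, W i x & W i.+2 ((x ^+ p)^-1 * z)%g.
Proof.
move=> ii Wz; have /vec_dvdP [y yE] := Wz.2.
have hy : vec_dvd i ((p ^ i)%:R *: y) by apply/vec_dvdP; exists y.
have [x [Dx xE]] := onto ii hy.
have Wx : W i x by split; rewrite ?xE.
have [h1 h2] := W_pow p ii Wx.
exists x => //; apply: W_coset; [exact: W_le h1| by apply: W_le Wz; apply: leqW|].
have -> : xi z = xi x *+ p by rewrite yE xE expnS natrM -scalerA scaler_nat.
by move=> j; have /padic_dvdN := h2 j; rewrite !mxE opprB.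
Qed.

(** Inside the step on k, a descending induction on j: for j >= N the ball lies in the open subgroup
    G_(p^(k+1)); below N, [W_root] writes z as x^p times an element of the next ball, where x is in
    G_(p^k) by the outer induction and x^p therefore in G_(p^(k+1)). *)
Let W_dimsub k : W (i0 + k)%N `<=` @dimsub p G (p ^ k).
Proof.
elim: k => [|k IH]; first by move=> g _; apply: dimsub01; rewrite expn0.
have [N hN] := W_basis (dimsub_nbhs (p ^ k.+1)).
suff hn n j : (i0 + k.+1 <= j)%N -> (N <= j + n)%N -> W j `<=` @dimsub p G (p ^ k.+1).
  by apply: (hn N); rewrite ?leq_addl.
elim: n j => [|n IHn] j jk jn; first by rewrite addn0 in jn; apply: subset_trans hN; apply: W_le.
case: j jk jn => [|j] jk jn; first by rewrite addnS in jk.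
have ij : (i0 + k <= j)%N by rewrite addnS in jk.
move=> z Wz; have [x Wx Wxz] := W_root (leq_trans (leq_addr _ _) ij) Wz.
rewrite -[z](mulKVg (x ^+ p)%g); apply: dimsubM.
  by rewrite expnS; apply: dimsubXp => //; apply: IH; apply: W_le Wx.
by apply: (IHn _ (leqW jk) _ _ Wxz); rewrite addSnnS.
Qed.

Lemma dimsub_index_growth : exists C M : nat, forall k, exists (T : finType) (t : T -> G),
  (#|T| <= C * M ^ k)%N /\ forall g, exists s, dimsub p (p ^ k) ((t s)^-1 * g)%g.
Proof.
have [V [oV V1] VW] : exists2 V : set G, open V /\ V 1%g & V `<=` W i0.
  by have : nbhs 1%g (W i0) := xi_cont i0; rewrite nbhsE => -[V [oV V1] VW]; exists V.
have [s hs] := compact_finite_index G_compact V1 oV.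
(* There are [size s] translates of the ball of index i0 covering G, and m coordinates modulo p^(i0
   + k) inside it. *)
exists (size s * (p ^ i0) ^ m)%N, (p ^ m)%N => k.
pose n := (i0 + k)%N.
pose res (w : G) : {ffun 'I_m -> 'I_(p ^ n)} := [ffun j => padic_residue p_prime n (xi w 0 j)].
pose rep (r : {ffun 'I_m -> 'I_(p ^ n)}) := xget 1%g [set w | W i0 w /\ res w = r].
exists ('I_(size s) * {ffun 'I_m -> 'I_(p ^ n)})%type, (fun t : 'I_(size s) * {ffun 'I_m -> 'I_(p ^ n)} => nth 1%g s t.1 * rep t.2)%g; split.
  rewrite card_prod card_ffun !card_ord -mulnA leq_mul2l; apply/orP; right.
  by rewrite -!expnM -expnD leq_exp2l ?prime_gt1 // /n mulnDl [(k * m)%N]mulnC.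
move=> g; have [e es Ve] := hs g.
set w := (e^-1 * g)%g in Ve; have Ww := VW _ Ve.
have [Wr rE] : W i0 (rep (res w)) /\ res (rep (res w)) = res w.
  exact: (@xgetPex _ 1%g [set w' | W i0 w' /\ res w' = res w] (ex_intro _ w (conj Ww erefl))).
have es' : (index e s < size s)%N by rewrite index_mem.
exists (Ordinal es', res w) => /=; rewrite nth_index // invgM -mulgA.
apply: W_dimsub; apply: (W_coset Wr Ww) => j; rewrite !mxE.
apply: (padic_residueP (p_prime := p_prime)).
by have /ffunP /(_ j) := rE; rewrite !ffunE => ->.
Qed.

End Growth.

(** A chart around 1 is recentred so that 1 has coordinates 0. Since 1 is neutral, multiplication
    restricted to either axis is the identity in coordinates, and its mixed difference is xi(g g') -
    xi(g) - xi(g'). *)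
Lemma analytic_growth (p : nat) (p_prime : prime p) (G : topGroupType) :
  compact [set: G] -> padic_analytic p G ->
  (forall n, nbhs 1%g (@dimsub p G n)) ->
  exists C M : nat, forall k, exists (T : finType) (t : T -> G),
  (#|T| <= C * M ^ k)%N /\ forall g, exists s, dimsub p (p ^ k) ((t s)^-1 * g)%g.
Proof.
move=> cG [m [atlas [ch cov _ am _]]] dn.
have [c ac c1] := cov 1%g; have [oD cK cC cB] := ch c ac.
have c11 : chart_dom c (1 * 1)%g by rewrite mulg1.
have := am c c c 1%g 1%g ac ac ac c1 c1 c11.
set f := (fun z => _); move=> /(analytic_mixed_difference p_prime) [h [e he]].
pose y0 := chart_map c 1%g.
pose xi g := chart_map c g - y0.
have xiK g : chart_map c g = y0 + xi g by rewrite addrC subrK.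
have fE g g' : chart_dom c g -> chart_dom c g' ->
    f (row_mx (y0 + xi g) (y0 + xi g')) = chart_map c (g * g')%g.
  by move=> Dg Dg'; rewrite /f row_mxKl row_mxKr -!xiK !cK.
have xi1 : xi 1%g = 0 by rewrite /xi subrr.
apply: (@dimsub_index_growth p p_prime G cG m h e (chart_dom c) xi) => //.
- move=> a b g g' ha hb Dg Dg' hg hg'.
  have := he a b _ _ ha hb hg hg'; have y01 : y0 = y0 + xi 1%g by rewrite xi1 addr0.
  rewrite -/y0.
  have -> : f (row_mx (y0 + xi g) y0) = chart_map c g.
    by rewrite [X in row_mx _ X]y01 fE // mulg1.
  have -> : f (row_mx y0 (y0 + xi g')) = chart_map c g'.
    by rewrite [X in row_mx X _]y01 fE // mul1g.
  have -> : f (row_mx y0 y0) = y0.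
    by rewrite [X in row_mx _ X]y01 [X in row_mx X _]y01 fE // mulg1.
  rewrite fE //.
  suff -> : chart_map c (g * g')%g - chart_map c g - chart_map c g' + y0 =
    xi (g * g')%g - xi g - xi g' by [].
  rewrite /xi; set A := chart_map c (g * g')%g; set B := chart_map c g; set C := chart_map c g'.
  by rewrite !opprB [A - y0 + (y0 - B)]addrA subrK [y0 - C]addrC addrA.
- move=> n; have nD : nbhs 1%g (chart_dom c) by apply: open_nbhs_nbhs.
  have := cC 1%g n c1; apply: filterS2 nD => g Dg [x xE]; split=> //.
  apply/vec_dvdP; exists x; by rewrite /xi xE addrC addKr.
- move=> W nW; have [n hn] := cB 1%g W c1 nW; exists n => v /vec_dvdP [x ->].
  have [g [Dg Wg gE]] := hn x; exists g; split=> //; by rewrite /xi gE addrC addKr.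
- by move=> g g' Dg Dg' /addIr E; rewrite -(cK _ Dg) -(cK _ Dg') E.
Qed.

(** * Minimal presentations *)

Section CompactGroups.
Variable G : topGroupType.
Hypothesis G_compact : compact [set: G].

Lemma rmulg_continuous (g : G) : continuous (fun x : G => (x * g)%g).
Proof.
move=> x; apply: (cvg_comp (fun y : G => (y, g)) (fun z : G * G => (z.1 * z.2)%g) _
  (@mulg_continuous G (x, g))).
by apply: cvg_pair; [apply: cvg_id | apply: cvg_cst].
Qed.

Lemma conjg_open (g : G) (H : set G) : open H -> open [set x : G | H (x ^ g)%g].
Proof.
move=> oH; have /(_ g^-1%g) := @open_lmulg G _ [set x | H (x * g)%g].
have -> : [set x : G | H (x ^ g)%g] = [set x | [set x | H (x * g)%g] (g^-1 * x)%g].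
  by apply/seteqP; split=> x /=; rewrite conjgE mulgA.
apply; apply: (open_comp (f := fun x : G => (x * g)%g) (D := H)) oH.
by move=> x _; apply: rmulg_continuous.
Qed.

(** The intersection of all conjugates of H. A conjugate depends only on a coset of H, so finitely
    many of them suffice and the intersection is open. *)
Lemma opnsub_core (H : set G) : is_subgroup H -> open H ->
  exists U : opnsub G, forall x, U x -> H x.
Proof.
move=> sH oH; have [H1 HV] := sH.
have HVg a : H a -> H a^-1%g by move=> Ha; rewrite -[(a^-1)%g]mul1g; apply: (HV).
have HM a b : H a -> H b -> H (a * b)%g.
  by move=> Ha Hb; rewrite -[b]invgK; apply: (HV) => //; apply: (HVg).
have [s hs] := compact_finite_index G_compact H1 oH.
pose N := [set x : G | forall g, H (x ^ g)%g].
have NE : N = [set x : G | forall g, g \in s -> H (x ^ g)%g].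
  apply/seteqP; split=> x /= hx g; first by move=> _; apply: hx.
  have [e es He] := hs g.
  have -> : (x ^ g = (x ^ e) ^ (e^-1 * g))%g by rewrite -conjgM mulKVg.
  by rewrite conjgE; exact: (HM _ _ (HVg _ He) (HM _ _ (hx e es) He)).
have oN : open N.
  rewrite NE; elim: s {hs NE} => [|g s IH].
    by rewrite (_ : [set x | _] = setT) ?predeqE //; exact: openT.
  rewrite (_ : [set x | _] = [set x : G | H (x ^ g)%g] `&` [set x : G | forall g, g \in s -> H (x ^ g)%g]).
    by apply: openI => //; apply: conjg_open.
  apply/seteqP; split=> x /= hx.
    by split=> [|g' gs]; apply: hx; rewrite inE ?eqxx // gs orbT.
  by move=> g'; rewrite inE => /predU1P[->|]; [exact: hx.1 | exact: hx.2].
have nN : is_normal N.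
  split; [split=> [g|x y Nx Ny g]|move=> x g Nx g'] => /=.
  - by rewrite conj1g.
  - by rewrite conjMg conjVg; apply: (HV).
  - by rewrite -conjgM; apply: Nx.
have fN := compact_finite_index G_compact nN.1.1 oN.
by exists (OpnSub oN nN fN) => x /(_ 1%g); rewrite conjg1.
Qed.

End CompactGroups.

Section ImageOpen.
Variables (F G : topGroupType) (phi : contHomType F G).
Hypotheses (F_compact : compact [set: F]) (G_hausdorff : hausdorff_space G).
Hypothesis phi_surj : forall g, exists z, phi z = g.

(** The image is compact, hence closed, and has finite index, so it is open as the complement of
    finitely many closed cosets. *)
Lemma opnsub_image (V : opnsub F) : exists U : opnsub G,
  forall g, U g <-> exists2 z, V z & phi z = g.
Proof.
pose C := [set g | exists2 z, V z & phi z = g].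
have nC : is_normal C.
  split; [split=> [|_ _ [x Vx <-] [y Vy <-]]|move=> _ g [x Vx <-]] => /=.
  - by exists 1%g; [apply: opnsub1 | apply: gmulf1].
  - by exists (x * y^-1)%g; [apply/opnsubM/opnsubV | rewrite gmulfM gmulfV].
  - have [z <-] := phi_surj g.
    by exists (x ^ z)%g; [apply: opnsubJ | rewrite /conjg !gmulfM gmulfV].
have [C1 CV] := nC.1.
have [s hs] := opnsub_finite V.
have fC : exists s : seq G, forall g, exists2 x, x \in s & C (x^-1 * g)%g.
  exists (map phi s) => g; have [z <-] := phi_surj g.
  have [x xs Vx] := hs z; exists (phi x); first exact: map_f.
  by exists (x^-1 * z)%g; rewrite ?gmulfM ?gmulfV.
have cV : closed (V : set F).
  rewrite -[V : set F]setCK; apply: open_closedC.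
  rewrite (_ : ~` _ = \bigcup_(g in ~` (V : set F)) [set x | V (g^-1 * x)%g]).
    by apply: bigcup_open => g _; apply/open_lmulg/opnsub_open.
  apply/seteqP; split=> [g Vg|x [g Vg /= Vgx] Vx]; first by exists g => //=; rewrite mulVg; apply: opnsub1.
  apply: Vg; have -> : g = (x * (g^-1 * x)^-1)%g by rewrite invgM invgK mulKVg.
  by apply/opnsubM/opnsubV.
have cC : closed C.
  apply: compact_closed => //.
  have -> : C = phi @` (V : set F) by apply/seteqP; split=> g [z Vz <-]; exists z.
  apply: continuous_compact.
    by apply: continuous_subspaceT; apply: cts_fun.
  exact: (subclosed_compact cV F_compact).
have oC : open C.
  have [t ht] := fC.
  pose l := [seq g <- t | `[< ~ C g >]].
  have -> : C = [set x | forall g, g \in l -> ~ C (g^-1 * x)%g].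
    have CVg a : C a -> C a^-1%g by move=> Ha; rewrite -[(a^-1)%g]mul1g; apply: (CV).
    apply/seteqP; split=> x /= hx.
      move=> g; rewrite mem_filter => /andP[/asboolP nCg _] Cgx; apply: nCg.
      have -> : g = (x * (g^-1 * x)^-1)%g by rewrite invgM invgK mulKVg.
      exact: (CV).
    have [g gt Cgx] := ht x; apply: contrapT => nCx.
    apply: (hx g) => //; rewrite mem_filter gt andbT; apply/asboolP => Cg; apply: nCx.
    by rewrite -[x](mulKVg g) -[(g^-1 * x)%g]invgK; apply: (CV) => //; apply: (CVg).
  elim: l => [|g l IH]; first by rewrite (_ : [set x | _] = setT) ?predeqE //; exact: openT.
  rewrite (_ : [set x | _] = [set x : G | (~` C) (g^-1 * x)%g] `&` [set x | forall g, g \in l -> ~ C (g^-1 * x)%g]).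
    by apply: openI => //; apply: open_lmulg; apply: closed_openC.
  apply/seteqP; split=> x /= hx.
    by split=> [|g' gs]; apply: hx; rewrite inE ?eqxx // gs orbT.
  by move=> g'; rewrite inE => /predU1P[->|]; [exact: hx.1 | exact: hx.2].
by exists (OpnSub oC nC fC).
Qed.

End ImageOpen.

(* An element outside a maximal subgroup of a p-group generates the quotient,
   which is cyclic of order p. *)
Lemma maximal_character (p : nat) (gT : finGroupType) (Q M : {group gT}) :
  prime p -> (p.-group Q)%g -> maximal M Q -> (forall q, q \in Q) ->
  exists2 chi : gT -> 'F_p, {morph chi : a b / (a * b)%g >-> a + b} &
    (forall q, q \in M -> chi q = 0) /\ exists x, chi x != 0.
Proof.
move=> pp pQ maxM QT.
have MQ := proper_sub (maxgroupp maxM).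
have nMQ : Q \subset 'N(M)%g := normal_norm (p_maximal_normal pQ maxM).
have iM : #|Q : M|%g = p := p_maximal_index pQ maxM.
have nM q : q \in 'N(M)%g by apply: (fintype.subsetP nMQ).
have [x xQ xM] : exists2 x, x \in Q & x \notin M.
  by have /properP[_ [x xQ xM]] := maxgroupp maxM; exists x.
have oX : #[coset M x]%g = p.
  apply/prime_nt_dvdP => //; last by rewrite -iM -card_quotient // order_dvdG // mem_quotient.
  by rewrite order_eq1; apply: contra xM => /eqP h; apply: coset_idr.
have genX : <[coset M x]>%g = (Q / M)%g.
  by apply/eqP; rewrite eqEcard cycle_subG mem_quotient //= card_quotient // iM -oX.
have ex q : exists c, coset M q = (coset M x ^+ c)%g.
  have : coset M q \in <[coset M x]>%g by rewrite genX mem_quotient.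
  by move=> /cycleP.
have [c hc] := choice ex.
have chiE a b : (coset M x ^+ a = coset M x ^+ b)%g -> a%:R = b%:R :> 'F_p.
  move=> /eqP; rewrite eq_expg_mod_order oX => /eqP E.
  by apply: val_inj; rewrite /= !val_Fp_nat.
exists (fun q => (c q)%:R) => [a b|].
  by rewrite -natrD; apply: chiE; rewrite expgD -(hc (a * b)%g) -(hc a) -(hc b) coset_morphM.
split=> [q qM|].
  by apply: (chiE _ 0%N); rewrite -(hc q) expg0 coset_id.
exists x; rewrite (chiE _ 1%N) ?oner_eq0 //.
by rewrite -(hc x) expg1.
Qed.

(** * Functoriality of completed group algebras and Fox calculus *)

Section CgaMap.
Variables (p : nat) (F G : topGroupType) (phi : contHomType F G).

Lemma quo_mapM U : {morph @quo_map F G phi U : a b / (a * b)%g}.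
Proof.
move=> a b; rewrite -[a]quo_reprK -[b]quo_reprK -quo_piM !quo_mapE gmulfM.
exact: quo_piM.
Qed.

Lemma cga_mapB : zmod_morphism (@cga_map p F G phi).
Proof. by move=> x y; apply: invlimP => U; apply: galg_mapB. Qed.
Lemma cga_mapM : monoid_morphism (@cga_map p F G phi).
Proof.
split=> [|x y]; apply: invlimP => U; first exact: (galg_map1 _ (@quo_mapM U)).
exact: (galg_mapM (@quo_mapM U)).
Qed.
Lemma cga_mapZ : scalable (@cga_map p F G phi).
Proof. by move=> k x; apply: invlimP => U; apply: galg_mapZ. Qed.
HB.instance Definition _ := GRing.isZmodMorphism.Build _ _ (@cga_map p F G phi) cga_mapB.
HB.instance Definition _ := GRing.isMonoidMorphism.Build _ _ (@cga_map p F G phi) cga_mapM.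
HB.instance Definition _ := GRing.isScalable.Build _ _ _ _ (@cga_map p F G phi) cga_mapZ.

Lemma cga_aug_map (x : cga p F) : cga_aug (cga_map phi x) = cga_aug x.
Proof.
rewrite (cga_aug_at (opnT G)) (cga_aug_at (opnsub_preim phi (opnT G))).
exact: galg_aug_map.
Qed.

Lemma cga_map_ideal_pow n (x : cga p F) : ideal_pow (@aug_ideal p F) n x ->
  ideal_pow (@aug_ideal p G) n (cga_map phi x).
Proof.
by apply: ideal_pow_morph => y y0; rewrite /aug_ideal /= cga_aug_map.
Qed.

End CgaMap.

Section NcpsFox.
Variables (p d : nat).
Implicit Types g h : ncps p d.

Lemma ncps_sumE (T : Type) (r : seq T) (E : T -> ncps p d) w :
  (\sum_(t <- r) E t) w = \sum_(t <- r) E t w.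
Proof. by elim: r => [|t r IH]; rewrite ?big_nil // !big_cons -IH. Qed.

Lemma fox_mulX j k g : fox j (g * ncX p k) = if k == j then g else 0.
Proof.
apply/funext => w; rewrite /fox ncpsME size_rcons.
rewrite (bigD1 (Ordinal (ltnW (ltnSn (size w).+1)))) //= big1 ?addr0.
  rewrite -cats1 take_size_cat // drop_size_cat // /ncX eqseq_cons andbT eq_sym.
  by case: (k == j); rewrite ?mulr1 ?mulr0.
move=> i /eqP iw; rewrite /ncX; case: eqP; rewrite ?mulr0 // => /(congr1 size).
rewrite size_drop size_rcons /= => E; case: iw; apply: val_inj => /=.
by have kw := ltn_ord i; rewrite -(subKn (ltnSE kw)) E subn1.
Qed.

Lemma fox_sumX j (b : 'I_d -> ncps p d) : fox j (\sum_k b k * ncX p k) = b j.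
Proof.
apply/funext => w; rewrite /fox ncps_sumE -[LHS]/(\sum_k fox j (b k * ncX p k) w).
rewrite (bigD1 j) //= fox_mulX eqxx big1 ?addr0 // => k /negPf kj.
by rewrite fox_mulX kj.
Qed.

Lemma ncps_nil_nat n : (n%:R : ncps p d) [::] = n%:R.
Proof. by elim: n => // n IH; rewrite -[n.+1]addn1 !natrD -IH. Qed.

End NcpsFox.

Section Presentation.
Variables (p : nat) (p_prime : prime p) (G F : topGroupType).
Variables (d : nat) (sigma : 'I_d -> F) (phi : contHomType F G).
Variable theta : {rmorphism ncps p d -> cga p F}.
Hypothesis theta_iso : magnus_iso sigma theta.
Hypothesis phi_surj : forall g, exists z, phi z = g.
Local Notation AF := (cga p F).
Local Notation AG := (cga p G).
Local Notation IF := (@aug_ideal p F).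
Local Notation IG := (@aug_ideal p G).

Let x j : AF := gel p (sigma j) - 1.
Let xb j : AG := gel p (phi (sigma j)) - 1.

Let thetaX j : theta (ncX p j) = x j.
Proof. by rewrite /x -theta_iso.2 rmorphD rmorph1 addrC addKr. Qed.

Let phix j : cga_map phi (x j) = xb j.
Proof. by rewrite /x rmorphB rmorph1 /= cga_map_gel. Qed.

Let phiM a j : cga_map phi (a * x j) = cga_map phi a * xb j.
Proof. by rewrite rmorphM /= phix. Qed.

Let xI j : IF (x j). Proof. exact: aug_ideal_gel. Qed.

Lemma cga_aug_theta g : cga_aug (theta g) = g [::].
Proof.
have h g' : g' [::] = 0 -> cga_aug (theta g') = 0.
  move=> /foxE ->; rewrite !rmorph_sum big1 // => j _ /=.
  by rewrite !rmorphM /= thetaX (xI j) mulr0.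
have := h (g - (g [::] : nat)%:R).
rewrite !rmorphB !rmorph_nat natr_Zp => hg; apply/eqP; rewrite -subr_eq0; apply/eqP/hg.
rewrite -[LHS]/(g [::] - ((g [::] : nat)%:R : ncps p d) [::]).
by rewrite ncps_nil_nat natr_Zp subrr.
Qed.

Let theta_inv : exists ti, cancel theta ti /\ cancel ti theta.
Proof. by have [[ti h1 h2] _] := theta_iso; exists ti. Qed.

Let ti := sval (cid theta_inv).
Let tiK : cancel theta ti. Proof. exact: (svalP (cid theta_inv)).1. Qed.
Let thetaK : cancel ti theta. Proof. exact: (svalP (cid theta_inv)).2. Qed.

Definition cga_fox j y := theta (fox j (ti y)).

Lemma cga_fox_theta j g : cga_fox j (theta g) = theta (fox j g).
Proof. by rewrite /cga_fox tiK. Qed.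

Lemma cga_foxE y : IF y -> y = \sum_j cga_fox j y * x j.
Proof.
rewrite /aug_ideal /= => y0.
have t0 : ti y [::] = 0 by rewrite -cga_aug_theta thetaK.
rewrite -{1}[y]thetaK {1}(foxE t0) rmorph_sum; apply: eq_bigr => j _ /=.
by rewrite rmorphM /= thetaX.
Qed.

Lemma cga_fox_sum j (b : 'I_d -> AF) : cga_fox j (\sum_k b k * x k) = b j.
Proof.
have -> : \sum_k b k * x k = theta (\sum_k ti (b k) * ncX p k).
  by rewrite rmorph_sum; apply: eq_bigr => k _ /=; rewrite rmorphM /= thetaX thetaK.
by rewrite cga_fox_theta fox_sumX thetaK.
Qed.

(** Provides the generation hypothesis of the earlier sections: augmentation can be read at level U,
    so a lift of a to F_p[[F]] has a Fox expansion, which is projected back. *)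
Lemma presF_gen (U : opnsub F) (a : galg 'F_p (quo U)) : galg_aug a = 0 ->
  exists b : 'I_d -> galg 'F_p (quo U), a = \sum_j b j * cga_at U (x j).
Proof.
move=> a0; pose y : AF := \sum_q a q *: gel p (repr q).
have yE : cga_at U y = a.
  rewrite [RHS]gdelta_sum /y raddf_sum; apply: eq_bigr => q _.
  by apply: etrans (cga_atZ U (a q) (gel p (repr q))) _; rewrite cga_at_gel quo_reprK.
have /cga_foxE yF : IF y by rewrite /aug_ideal /= (cga_aug_at U) yE.
exists (fun j => cga_at U (cga_fox j y)); rewrite -{1}yE {1}yF.
apply: etrans (raddf_sum (@cga_at p F U) _ _ _) _; exact: eq_bigr.
Qed.

(** The lift goes all the way to F_p[[F]], where Fox derivatives exist; the expansion is then mapped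
    to G. *)
Lemma presG_gen (U : opnsub G) (a : galg 'F_p (quo U)) : galg_aug a = 0 ->
  exists b : 'I_d -> galg 'F_p (quo U), a = \sum_j b j * cga_at U (xb j).
Proof.
move=> a0.
have lift q : exists z, quo_pi U (phi z) = q.
  by have [z zE] := phi_surj (repr q); exists z; rewrite zE quo_reprK.
have [z zE] := choice lift.
pose y : AF := \sum_q a q *: gel p (z q).
have yE : cga_at U (cga_map phi y) = a.
  rewrite [RHS]gdelta_sum /y raddf_sum.
  apply: etrans (raddf_sum (@cga_at p G U) _ _ _) _; apply: eq_bigr => q _.
  rewrite -[X in cga_at U X = _]/(cga_map phi (a q *: gel p (z q))) cga_mapZ cga_map_gel.
  by rewrite cga_atZ cga_at_gel zE.
have /cga_foxE yF : IF y by rewrite /aug_ideal /= -(cga_aug_map phi) (cga_aug_at U) yE.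
exists (fun j => cga_at U (cga_map phi (cga_fox j y))); rewrite -{1}yE {1}yF.
rewrite raddf_sum; apply: etrans (raddf_sum (@cga_at p G U) _ _ _) _.
by apply: eq_bigr => j _; exact: (congr1 (@cga_at p G U) (phiM _ j)).
Qed.

Let tF n := ipow_two_sided p F n.
Let tG n := ipow_two_sided p G n.

Lemma cga_foxB j y z : IF y -> IF z -> cga_fox j (y - z) = cga_fox j y - cga_fox j z.
Proof.
move=> /cga_foxE {1}-> /cga_foxE {1}->; rewrite -sumrB.
under eq_bigr do rewrite -mulrBl.
by rewrite cga_fox_sum.
Qed.

Lemma cga_foxMl j a y : IF y -> cga_fox j (a * y) = a * cga_fox j y.
Proof.
move=> /cga_foxE {1}->; rewrite big_distrr /=.
by under eq_bigr do rewrite mulrA; rewrite cga_fox_sum.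
Qed.

(** The product rule for Fox derivatives. The constant term of w is removed first, because the
    expansion [cga_foxE] holds on the augmentation ideal. *)
Lemma cga_foxMr j w y : IF y ->
  cga_fox j (y * w) = cga_aug w *: cga_fox j y + y * cga_fox j (w - cga_aug w *: 1).
Proof.
move=> Iy; have /cga_foxE wE : IF (w - cga_aug w *: 1).
  by rewrite /aug_ideal /= rmorphB /= cga_augZ rmorph1 mulr1 subrr.
have yw : y * w = \sum_k (cga_aug w *: cga_fox k y + y * cga_fox k (w - cga_aug w *: 1)) * x k.
  rewrite -{1}(subrK (cga_aug w *: 1) w) mulrDr addrC -scalerAr mulr1.
  rewrite {1}(cga_foxE Iy) {1}wE scaler_sumr big_distrr -big_split; apply: eq_bigr => k _ /=.
  by rewrite mulrDl scalerAl mulrA.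
by rewrite {1}yw cga_fox_sum.
Qed.

Lemma cga_fox_ideal_pow n j y : ideal_pow IF n.+1 y -> ideal_pow IF n (cga_fox j y).
Proof. by move=> /(ipow_gen presF_gen) [b hb ->]; rewrite cga_fox_sum. Qed.

(** * Exactness of the Fox complex *)

Section Relations.
Variables (r : nat) (rho : 'I_r -> F) (v : 'I_r -> nat).
Hypothesis rels : relation_system p phi rho v.

Let J i j : AG := cga_map phi (cga_fox j (gel p (rho i) - 1)).

Section Kernel.
Variable n : nat.
Hypothesis n_gt0 : (0 < n)%N.
Hypotheses (F_compact : compact [set: F]) (G_hausdorff : hausdorff_space G).

(** An ideal standing for the kernel of F_p[[F]] -> F_p[[G]] enlarged by a power of the augmentation
    ideal: the Fox derivatives are, modulo I^n, combinations of the rows of J with coefficients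
    independent of j. The condition on the image of y absorbs the term y D(w) of the product rule
    and so makes T stable under right multiplication. *)
Let T : set AF := [set y | [/\ IF y, ideal_pow IG n (cga_map phi y) &
  exists u : 'I_r -> AG, forall j,
    ideal_pow IG n (cga_map phi (cga_fox j y) - \sum_i u i * J i j)]].

Let T_two_sided : two_sided T.
Proof.
have tI := aug_ideal_two_sided p F.
split=> [|y z [Iy Py [u hu]] [Iz Pz [w hw]]|a y [Iy Py [u hu]]|a y [Iy Py [u hu]]].
- have I0 := two_sided0 tI; split=> //; first by rewrite rmorph0; apply: (two_sided0 (tG n)).
  exists (fun=> 0) => j; rewrite big1 ?subr0 => [|i _]; last by rewrite mul0r.
  have -> : cga_fox j 0 = 0 by have := cga_foxB j I0 I0; rewrite !subrr.
  by rewrite rmorph0; apply: (two_sided0 (tG n)).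
- split; first exact: (two_sidedB tI).
    by rewrite rmorphB; apply: (two_sidedB (tG n)).
  exists (fun i => u i - w i) => j; rewrite cga_foxB // rmorphB /=.
  under eq_bigr do rewrite mulrBl.
  have E (A B C D : AG) : A - B - (C - D) = (A - C) - (B - D).
    by rewrite !opprB addrACA [RHS]addrACA; congr (_ + _); apply: addrC.
  rewrite sumrB E; exact: (two_sidedB (tG n)).
- split; first exact: (two_sidedMl tI).
    by rewrite rmorphM; apply: (two_sidedMl (tG n)).
  exists (fun i => cga_map phi a * u i) => j; rewrite cga_foxMl // rmorphM /=.
  under eq_bigr do rewrite -mulrA.
  by rewrite -big_distrr -mulrBr; apply: (two_sidedMl (tG n)).
- split; first exact: (two_sidedMr tI).
    by rewrite rmorphM; apply: (two_sidedMr (tG n)).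
  exists (fun i => cga_aug a *: u i) => j; rewrite cga_foxMr // rmorphD rmorphM /= cga_mapZ.
  under eq_bigr do rewrite -scalerAl.
  rewrite -scaler_sumr addrAC -scalerBr; apply: (two_sidedD (tG n)).
    exact: (subspaceZ (ipow_subspace p G n)).
  exact: (two_sidedMr (tG n)).
Qed.

Let T_ipow : ideal_pow IF n.+1 `<=` T.
Proof.
move=> y Jy; have tI := aug_ideal_two_sided p F; split.
- by rewrite -(ideal_pow1 tI); apply: (ideal_pow_le tI) Jy.
- exact/cga_map_ideal_pow/(ideal_pow_le tI (leqnSn n)).
- exists (fun=> 0) => j; rewrite big1 ?subr0 => [|i _]; last by rewrite mul0r.
  exact/cga_map_ideal_pow/cga_fox_ideal_pow.
Qed.

Let T_rho i : T (gel p (rho i) - 1).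
Proof.
have [Rrho _ _] := rels.
split; first exact: aug_ideal_gel.
  by rewrite rmorphB rmorph1 /= cga_map_gel (Rrho i) gel1 subrr; apply: (two_sided0 (tG n)).
exists (fun k => (k == i)%:R) => j; rewrite (bigD1 i) //= eqxx mul1r big1 ?addr0.
  by rewrite subrr; apply: (two_sided0 (tG n)).
by move=> k /negPf ->; rewrite mul0r.
Qed.

(** The elements g with g - 1 in T form a normal subgroup. It contains F_(n+1) and the relations, so
    the relation system puts R inside it. *)
Let T_R z : phi z = 1%g -> T (gel p z - 1).
Proof.
move=> z1; have [_ _ /(_ n n_gt0) [hR _]] := rels.
have nN := is_normal_ideal T_two_sided.
have : normal_gen (rho @` [set i | (v i <= n)%N] `|` @dimsub p F n.+1) z.
  rewrite hR; exists z, 1%g; split=> //; [exact: dimsub1g | by rewrite mulg1].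
move=> hz; apply: (hz [set g | T (gel p g - 1)]); split=> // y [[i _ <-]|hy].
  exact: T_rho.
exact: T_ipow.
Qed.

(** Let V be the normal subgroup of z with z - 1 in T. It is open because T contains I^(n+1), and
    contains R by [T_R], so F / V is the quotient of G by the image U of V. A congruence in
    F_p[G / U] can then be lifted to F_p[[F]] modulo T. *)
Lemma presentation_kernel y : ideal_pow IG n.+1 (cga_map phi y) -> T y.
Proof.
move=> hy.
have [W hW] := ipow_open presF_gen n.+1.
have WT z : W z -> T (gel p z - 1).
  move=> Wz; apply: T_ipow; apply: hW.
  have W1 : quo_pi W z = 1%g.
    by rewrite -quo_pi1; apply/esym/quo_piE; rewrite invg1 mul1g.
  have -> : cga_at W (gel p z - 1) = 0 by rewrite cga_atB cga_at_gel W1; apply: subrr.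
  exact: (two_sided0 (ideal_pow_two_sided (@galg_aug_two_sided _ _) _)).
have [V hV] := opnsub_sup (is_normal_ideal T_two_sided) WT.
have [U hU] := opnsub_image F_compact G_hausdorff phi_surj V.
have [l hl] := gel_span presF_gen n.+1 y.
apply: (two_sided_subr T_two_sided (T_ipow hl)).2.
apply: (@ideal_pow_lift p F _ (fun z => quo_pi U (phi z)) _ _ T n.+1 T_two_sided T_ipow).
- by move=> a b; rewrite gmulfM quo_piM.
- move=> q; have [z zE] := phi_surj (repr q).
  by exists z; rewrite zE quo_reprK.
- move=> z; rewrite -quo_pi1 => /esym/quo_piE; rewrite invg1 mul1g => /hU [w /hV Tw wz].
  have E : phi (z * w^-1)%g = (phi z * (phi w)^-1)%g by rewrite gmulfM gmulfV.
  have Tzw : T (gel p (z * w^-1)%g - 1) by apply: T_R; rewrite E wz mulgV.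
  have [[N1 NV] _] := is_normal_ideal T_two_sided.
  have Tw' := NV _ _ N1 Tw; have := NV _ _ Tzw Tw'.
  by rewrite /= mul1g invgK mulgKV.
- have -> : \sum_(z <- l) gdelta 'F_p (quo_pi U (phi z)) =
      cga_at U (cga_map phi (\sum_(z <- l) gel p z)).
    rewrite raddf_sum; apply/esym; apply: etrans (raddf_sum (@cga_at p G U) _ _ _) _.
    by apply: eq_bigr => z _; exact: (congr1 (@cga_at p G U) (cga_map_gel p phi z)).
  apply: cga_at_ideal_pow; apply: (two_sided_subr (tG n.+1) _).1 hy.
  by rewrite -rmorphB; apply: cga_map_ideal_pow.
Qed.

End Kernel.

Hypotheses (F_compact : compact [set: F]) (G_hausdorff : hausdorff_space G).

(** Lift the g j approximately to y j in F_p[[F]]; the Fox derivatives of the sum of the y j x j are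
    the y j themselves, and [presentation_kernel] describes them. For n = 0 the congruence is
    empty. *)
Lemma presentation_exact n (g : 'I_d -> AG) : ideal_pow IG n.+1 (\sum_j g j * xb j) ->
  exists u : 'I_r -> AG, forall j, ideal_pow IG n (g j - \sum_i u i * J i j).
Proof.
case: n => [|n] hg; first by exists (fun=> 0).
have liftG a : exists y : AF, ideal_pow IG n.+1 (a - cga_map phi y).
  have [l hl] := gel_span presG_gen n.+1 a.
  have lift z : exists w, phi w = z.
    by have [w wE] := phi_surj z; exists w.
  have [w wE] := choice lift.
  exists (\sum_(z <- l) gel p (w z)); rewrite raddf_sum.
  rewrite (eq_bigr (fun z => gel p z)) // => z _.
  by apply: etrans (cga_map_gel p phi (w z)) _; rewrite wE.
have [y hy] := choice (fun j => liftG (g j)).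
have /(presentation_kernel (ltn0Sn n) F_compact G_hausdorff) [_ _ [u hu]] :
    ideal_pow IG n.+2 (cga_map phi (\sum_j y j * x j)).
  apply: (two_sided_subr (tG n.+2) _).1 hg.
  rewrite raddf_sum -sumrB; apply: (two_sided_sum (tG n.+2)) => j _.
  have -> : g j * xb j - cga_map phi (y j * x j) = (g j - cga_map phi (y j)) * xb j.
    by rewrite mulrBl; congr (_ - _); apply: phiM.
  by apply: (ipow_mulx (fun j => phi (sigma j))).
exists u => j; apply: (two_sided_trans (tG n.+1) (hy j)).
by have := hu j; rewrite cga_fox_sum.
Qed.

(** Row i of J paired with the generators is the Fox expansion of rho i - 1, which becomes 0 in
    F_p[[G]]. *)
Lemma presentation_complex (u : 'I_r -> AG) : \sum_j (\sum_i u i * J i j) * xb j = 0.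
Proof.
have [Rrho _ _] := rels.
under eq_bigr do rewrite big_distrl /=.
rewrite exchange_big big1 // => i _ /=.
under eq_bigr do rewrite -mulrA.
rewrite -big_distrr /= (_ : \sum_j _ = cga_map phi (gel p (rho i) - 1)).
  by rewrite rmorphB rmorph1 /= cga_map_gel (Rrho i) gel1 subrr mulr0.
rewrite [in RHS](cga_foxE (aug_ideal_gel p (rho i))) raddf_sum; apply: eq_bigr => j _.
by apply/esym/phiM.
Qed.

(** * Levels of the relations and the dimension count *)

Section Level.
Hypothesis G_pro_p : pro_p p G.
Hypothesis s_min : min_top_gen (fun j => phi (sigma j)).

(** A relation of level at most 1 would have a nonzero linear term in some x_j. By minimality the
    other generators lie in a proper maximal subgroup M of a finite quotient of G; a nonzero
    character to F_p vanishing on M is then forced by the relation to vanish on generator j as well,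
    hence everywhere. *)
Lemma level_gt1 i : (1 < v i)%N.
Proof.
have [Rrho lev _] := rels; have [_ [lvl max_lvl]] := lev i.
have [G_compact G_haus G_basis G_pgr] := G_pro_p.
set y : AF := gel p (rho i) - 1.
have Iy : IF y by apply: aug_ideal_gel.
apply: contrapT => /negP; rewrite -leqNgt => v1.
have [j augj] : exists j, cga_aug (cga_fox j y) != 0.
  apply: contrapT => /forallNP h; have : (2 <= v i)%N; last by rewrite ltnNge v1.
  apply: max_lvl; rewrite /dimsub -[[set h | _] _]/(ideal_pow IF 2 y) (cga_foxE Iy).
  apply: (two_sided_sum (tF 2)) => j _; apply: (ipow_mulx sigma).
  rewrite ideal_pow1; last exact: aug_ideal_two_sided.
  by rewrite /aug_ideal /=; apply/eqP; have /negP := h j; rewrite negbK.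
set H := subgroup_gen ((fun j => phi (sigma j)) @` [set i | i != j]).
have [g ngH] : exists g, ~ closure H g.
  apply: contrapT => /forallNP h; apply: (s_min.2 j); apply/seteqP; split=> // g _.
  by apply: contrapT; apply: h.
have sH : is_subgroup H.
  by split=> [K [[K1 _] _]|a b Ha Hb K [[K1 KV] KX]] //; apply: (KV); [apply: Ha|apply: Hb].
have [U hU] : exists U : opnsub G, forall h, H h -> ~ U (g^-1 * h)%g.
  have [V nV VH] : exists2 V : set G, nbhs g V & V `&` H = set0.
    apply: contrapT => h; apply: ngH => V nV; apply/set0P/eqP => VH; apply: h.
    by exists V => //; rewrite setIC.
  have nV1 : nbhs 1%g [set x | V (g * x)%g].
    by apply: (@lmulg_continuous G g 1%g V); rewrite mulg1.
  have [L sL [oL LV]] := G_basis _ nV1.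
  have [U UL] := opnsub_core G_compact sL oL.
  exists U => h Hh /UL/LV /=; rewrite mulKVg => Vh.
  by have : (V `&` H) h by []; rewrite VH.
pose sb k := quo_pi U (phi (sigma k)).
pose Hq := [set q : quo U | `[< exists2 h, H h & quo_pi U h = q >]]%SET.
have gHq : group_set Hq.
  apply/group_setP; split=> [|a b]; rewrite !finset.inE.
    by apply/asboolP; exists 1%g; [apply: sH.1 | apply: quo_pi1].
  move=> /asboolP [h Hh <-] /asboolP [k Hk <-]; apply/asboolP; exists (h * k)%g.
    have := sH.2 h k^-1%g Hh; rewrite invgK; apply.
    by rewrite -[(k^-1)%g]mul1g; apply: sH.2 => //; apply: sH.1.
  exact: quo_piM.
pose Q := [set: quo U]%G.
have gnq : quo_pi U g \notin Group gHq.
  apply/negP; rewrite -[_ \in Group gHq]/(quo_pi U g \in Hq) finset.inE.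
  by move=> /asboolP [h Hh /esym/quo_piE]; apply: hU.
have [E|[M maxM HM]] := maximal_exists (finset.subsetT (Group gHq)).
  by move: gnq; rewrite E finset.inE.
have pQ : (p.-group Q)%g by rewrite /pgroup cardsT; apply: G_pgr.
have [chi chiM [chi0 [q0 chiq]]] : exists2 chi : quo U -> 'F_p,
    {morph chi : a b / (a * b)%g >-> a + b} &
    (forall q, q \in M -> chi q = 0) /\ exists x, chi x != 0.
  by apply: maximal_character p_prime pQ maxM _ => q; rewrite finset.inE.
(* The linear extension of chi is a derivation with respect to the augmentation; its value on b (s_k
   - 1) is the augmentation of b times chi(s_k). *)
pose lam (a : galg 'F_p (quo U)) : 'F_p := \sum_q a q * chi q.
have lamD a b : lam (a + b) = lam a + lam b.
  by rewrite /lam -big_split; apply: eq_bigr => q _; rewrite ffunE mulrDl.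
have lam_sum (r' : seq 'I_d) (c : 'I_d -> galg 'F_p (quo U)) :
    lam (\sum_(k <- r') c k) = \sum_(k <- r') lam (c k).
  elim: r' => [|k r' IH]; last by rewrite !big_cons lamD IH.
  by rewrite !big_nil /lam big1 // => q _; rewrite ffunE mul0r.
have lam_delta q : lam (gdelta 'F_p q) = chi q.
  rewrite /lam (bigD1 q) //= ffunE eqxx mul1r big1 ?addr0 // => h /negPf hq.
  by rewrite ffunE hq mul0r.
have lamM a b : lam (a * b) = galg_aug a * lam b + lam a * galg_aug b.
  rewrite /lam /galg_aug; under eq_bigr do rewrite galgME big_distrl /=.
  rewrite exchange_big big_distrl [X in _ = _ + X]big_distrl -big_split /=.
  apply: eq_bigr => q _; rewrite (reindex_inj (mulgI q)) /=.
  rewrite !big_distrr -big_split /=; apply: eq_bigr => q' _.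
  have E (k1 k2 k3 k4 : 'F_p) : k1 * k2 * (k3 + k4) = k1 * (k2 * k4) + k1 * k3 * k2.
    by rewrite mulrDr addrC mulrA; congr (_ + _); apply: mulrAC.
  by rewrite mulKg chiM E.
have lam_x k (b : galg 'F_p (quo U)) : lam (b * cga_at U (xb k)) = galg_aug b * chi (sb k).
  rewrite lamM -cga_aug_at (aug_ideal_gel p (phi (sigma k)) : cga_aug _ = 0) mulr0 addr0.
  congr (_ * _); have -> : cga_at U (xb k) = gdelta 'F_p (sb k) + (-1) *: gdelta 'F_p 1%g.
    by rewrite scaleN1r.
  rewrite lamD lam_delta (_ : lam _ = 0) ?addr0 // /lam big1 // => q _.
  have chi1 : chi 1%g = 0 by apply: chi0; apply: group1.
  rewrite galgZE ffunE; case: eqP => [->|_]; first by rewrite chi1 mulr0.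
  by rewrite mulr0 mul0r.
have chis k : k != j -> chi (sb k) = 0.
  move=> kj; apply: chi0; apply: (fintype.subsetP HM).
  rewrite -[_ \in Group gHq]/(sb k \in Hq) finset.inE; apply/asboolP.
  exists (phi (sigma k)) => // K [_ KX]; apply: KX; by exists k.
(* Applied to the Fox expansion of rho i - 1, whose image is 0, [lam] leaves only the term at j,
   with nonzero coefficient. *)
have chij : chi (sb j) = 0.
  have : lam (cga_at U (cga_map phi y)) = 0.
    rewrite /y rmorphB rmorph1 -[X in cga_at U (X - 1)]/(cga_map phi (gel p (rho i))).
    rewrite cga_map_gel (Rrho i) gel1 subrr /lam big1 // => q _.
    by rewrite ffunE mul0r.
  rewrite (cga_foxE Iy) raddf_sum (raddf_sum (@cga_at p G U)) lam_sum.
  rewrite (eq_bigr (fun k => cga_aug (cga_fox k y) * chi (sb k))); last first.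
    move=> k _; apply: etrans (congr1 (fun b => lam (cga_at U b)) (phiM (cga_fox k y) k)) _.
    apply: etrans (lam_x k (cga_at U (cga_map phi (cga_fox k y)))) _.
    by rewrite -cga_aug_at cga_aug_map.
  rewrite (bigD1 j) //= big1 ?addr0 => [/eqP|k kj]; last by rewrite chis ?mulr0.
  by rewrite mulf_eq0 (negPf augj) /= => /eqP.
(* Now chi kills all generators, so [lam] kills the augmentation ideal and chi is zero. *)
case/eqP: chiq.
have aug0 : galg_aug (gdelta 'F_p q0 - 1) = 0 by rewrite rmorphB rmorph1 /= galg_aug_delta subrr.
have [b bE] := presG_gen aug0.
have <- : lam (gdelta 'F_p q0) = chi q0 := lam_delta q0.
rewrite -(subrK 1 (gdelta 'F_p q0)) lamD bE lam_sum big1 => [|k _].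
  have -> : (1 : galg 'F_p (quo U)) = gdelta 'F_p 1%g by [].
  by rewrite add0r lam_delta; apply: chi0; apply: group1.
rewrite lam_x; have [->|kj] := eqVneq k j; first by rewrite chij mulr0.
by rewrite chis ?mulr0.
Qed.

Section Dimensions.
Variable cc : nat -> nat.
Hypothesis hcc : forall m, has_dim_quo [set: AG] (ideal_pow IG m) (cc m).
Variable n : nat.

Let sG m := ipow_subspace p G m.
(** For the map J at index n + 1, the quotient WJ / W0 is its kernel and SU / SJ its image; by
    exactness SU / SJ is also the kernel of the map to I / I^(n+1) given by the generators. *)
Let SJ : set {ffun 'I_d -> AG} := [set g | forall j, ideal_pow IG n (g j)].
Let SU : set {ffun 'I_d -> AG} := [set g |
  exists u : 'I_r -> AG, forall j, ideal_pow IG n (g j - \sum_i u i * J i j)].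
Let WJ : set {ffun 'I_r -> AG} := [set g | forall j, ideal_pow IG n (\sum_i g i * J i j)].
Let W0 : set {ffun 'I_r -> AG} := [set g | forall i, ideal_pow IG (n.+1 - v i) (g i)].

Let Jfun (g : {ffun 'I_r -> AG}) : {ffun 'I_d -> AG} := [ffun j => \sum_i g i * J i j].

Let Jfun_linear : linear Jfun.
Proof.
move=> k g g'; apply/ffunP => j; rewrite !ffunE scaler_sumr -big_split.
by apply: eq_bigr => i _; rewrite !ffunE mulrDl scalerAl.
Qed.

Let JL : {linear {ffun 'I_r -> AG} -> {ffun 'I_d -> AG}} :=
  HB.pack Jfun (GRing.isLinear.Build _ _ _ _ Jfun Jfun_linear).

Let Xfun (g : {ffun 'I_d -> AG}) : AG := \sum_j g j * xb j.

Let Xfun_linear : linear Xfun.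
Proof.
move=> k g g'; rewrite /Xfun scaler_sumr -big_split.
by apply: eq_bigr => j _; rewrite !ffunE mulrDl scalerAl.
Qed.

Let XL : {linear {ffun 'I_d -> AG} -> AG} :=
  HB.pack Xfun (GRing.isLinear.Build _ _ _ _ Xfun Xfun_linear).

Let WJE g : WJ g <-> SJ (Jfun g).
Proof. by split=> h j; have := h j; rewrite ffunE. Qed.

Let sSJ : is_subspace SJ.
Proof. exact: (@subspace_prod _ _ _ (fun _ => ideal_pow IG n) (fun _ => sG n)). Qed.

Let sW0 : is_subspace W0.
Proof.
exact: (@subspace_prod _ _ _ (fun i => ideal_pow IG (n.+1 - v i)) (fun i => sG (n.+1 - v i))).
Qed.

Let sWJ : is_subspace WJ.
Proof.
have -> : WJ = JL @^-1` SJ by apply/seteqP; split=> g /WJE.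
exact: subspace_preim.
Qed.

Let sSU : is_subspace SU.
Proof.
split=> [|k g g' [u hu] [u' hu']].
  exists (fun=> 0) => j; rewrite ffunE big1 ?subr0; first exact: (two_sided0 (tG n)).
  by move=> i _; rewrite mul0r.
exists (fun i => k *: u i + u' i) => j.
have -> : (k *: g + g') j - \sum_i (k *: u i + u' i) * J i j =
    k *: (g j - \sum_i u i * J i j) + (g' j - \sum_i u' i * J i j).
  rewrite !ffunE; under eq_bigr do rewrite mulrDl -scalerAl.
  by rewrite big_split -scaler_sumr opprD addrACA scalerBr.
exact: (sG n).2.
Qed.

(** The map J is well defined on the quotients: a Fox derivative of a relation of level v lies in
    I^(v-1), and (n + 1 - v) + (v - 1) >= n. *)
Let W0J : W0 `<=` WJ.
Proof.
move=> g hg j; have [_ lev _] := rels.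
apply: (two_sided_sum (tG n)) => i _.
have [_ [lvl _]] := lev i; have v1 := ltnW (level_gt1 i).
have hJ : ideal_pow IG (v i).-1 (J i j).
  apply/cga_map_ideal_pow/cga_fox_ideal_pow; rewrite prednK //; exact: lvl.
apply: (ipow_mono _ (ideal_powM (aug_ideal_two_sided p G) (hg i) hJ)).
by rewrite -ltnS -addnS prednK // addnC -leq_subLR.
Qed.

Let SJU : SJ `<=` SU.
Proof.
move=> g hg; exists (fun=> 0) => j; rewrite big1 ?subr0 // => i _; by rewrite mul0r.
Qed.

Let XLE g : ideal_pow IG n.+1 (XL g) <-> SU g.
Proof.
split=> [|[u hu]]; first exact: presentation_exact.
have -> : XL g = \sum_j (g j - \sum_i u i * J i j) * xb j.
  under eq_bigr do rewrite mulrBl.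
  by rewrite sumrB presentation_complex subr0.
apply: (two_sided_sum (tG n.+1)) => j _.
exact: (ipow_mulx (fun j => phi (sigma j))).
Qed.

(** Rank and nullity twice, with m the rank of J and b the dimension of I / I^(n+1): the sum of the
    c (n + 1 - v i) is e + m, d c_n is m + b, and c_(n+1) is b + 1. *)
Lemma dim_e_relation :
  (dim_e v J n.+1 + d * cc n + 1 = \sum_i cc (n.+1 - v i)%N + cc n.+1)%N.
Proof.
have full T' : [set g : {ffun 'I_T' -> AG} | forall i, [set: AG] (g i)] = setT.
  by apply/seteqP; split.
have dimr : has_dim_quo [set: {ffun 'I_r -> AG}] W0 (\sum_i cc (n.+1 - v i)%N)%N.
  have := @has_dim_prod _ AG r (fun=> setT) (fun i => ideal_pow IG (n.+1 - v i))
    (fun i => cc (n.+1 - v i)) (fun=> @subspace_setT _ AG) (fun i => sG (n.+1 - v i))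
    (fun i => hcc (n.+1 - v i)).
  by rewrite full.
have dimd : has_dim_quo [set: {ffun 'I_d -> AG}] SJ (d * cc n)%N.
  have := @has_dim_prod _ AG d (fun=> setT) (fun=> ideal_pow IG n)
    (fun=> cc n) (fun=> @subspace_setT _ AG) (fun=> sG n) (fun=> hcc n).
  by rewrite full sum_nat_const card_ord.
have [e' [m [he hm ->]]] := has_dim_tower (@subspace_setT _ _) sWJ sW0 W0J (fun _ _ => Logic.I) dimr.
have [m' [b [hm' hb E]]] := has_dim_tower (@subspace_setT _ _) sSU sSJ SJU (fun _ _ => Logic.I) dimd.
rewrite (dim_quoE sWJ sW0 he : dim_e v J n.+1 = e') E.
have hmU : has_dim_quo SU SJ m.
  apply: (has_dim_transport (T := JL) sSU sSJ SJU _ _ _ (@subspace_setT _ _) hm).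
  - move=> g _; exists g => j; rewrite ffunE subrr; exact: (two_sided0 (tG n)).
  - by move=> g _; split=> /WJE.
  - move=> g [u hu]; exists (finfun u) => // j; have := hu j; rewrite !ffunE.
    by under [in X in _ -> X]eq_bigr do rewrite ffunE.
have <- := has_dim_uniq sSU sSJ hmU hm'.
have I1 : ideal_pow IG n.+1 `<=` IG.
  by move=> y Jy; rewrite -(ideal_pow1 (aug_ideal_two_sided p G)); apply: ipow_mono Jy.
have sI : is_subspace IG by rewrite -(ideal_pow1 (aug_ideal_two_sided p G)).
have hbI : has_dim_quo IG (ideal_pow IG n.+1) b.
  apply: (has_dim_transport (T := XL) sI (sG n.+1) I1 _ _ _ (@subspace_setT _ _) hb).
  - move=> g _; apply: (two_sided_sum (aug_ideal_two_sided p G)) => j _.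
    by apply: (two_sidedMl (aug_ideal_two_sided p G)); apply: aug_ideal_gel.
  - by move=> g _; apply: XLE.
  - move=> y /(aug_ideal_gen presG_gen) [w ->]; exists (finfun w) => //.
    rewrite /= /Xfun; under [X in _ - X]eq_bigr do rewrite ffunE.
    by rewrite subrr; apply: (two_sided0 (tG n.+1)).
have h1 : has_dim_quo [set: AG] IG 1%N.
  have augE y (k : 'F_p) : cga_aug (y - k *: 1 : AG) = cga_aug y - k.
    by rewrite rmorphB /= cga_augZ rmorph1 mulr1.
  exists (fun=> 1) => // y _; exists [ffun=> cga_aug y]; split=> [|c].
    by rewrite big_ord1 /aug_ideal /= augE ffunE subrr.
  rewrite big_ord1 /aug_ideal /= augE => /eqP; rewrite subr_eq0 => /eqP ->.
  by apply/ffunP => i; rewrite ffunE; congr (c _); apply: val_inj; case: i => -[].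
have hcn := has_dim_add (@subspace_setT _ AG) sI (sG n.+1) I1 (fun _ _ => Logic.I) hbI h1.
rewrite (has_dim_uniq (@subspace_setT _ AG) (sG n.+1) (hcc n.+1) hcn).
by rewrite -!addnA addnCA.
Qed.

End Dimensions.

End Level.

End Relations.

End Presentation.

(** * Generating series *)

Definition natR (R : realType) (n : nat) : R := n%:R.

Section NatR.
Variable R : realType.
Lemma natR_nmod : nmod_morphism (@natR R).
Proof. by split=> // m n; rewrite /natR natrD. Qed.
Lemma natR_monoid : monoid_morphism (@natR R).
Proof. by split=> // m n; rewrite /natR natrM. Qed.
HB.instance Definition _ := GRing.isNmodMorphism.Build _ _ (@natR R) natR_nmod.
HB.instance Definition _ := GRing.isMonoidMorphism.Build _ _ (@natR R) natR_monoid.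
End NatR.

Section Series.
Variables (R : realType) (t : R).
Hypotheses (t_gt0 : 0 < t) (t_lt1 : t < 1).

Let t_ge0 : 0 <= t := ltW t_gt0.
Let t1_gt0 : 0 < 1 - t. Proof. by rewrite subr_gt0. Qed.

(** Partial sums of the expansion of (1 - t)^-(m+1). Pascal's rule bounds a partial sum S by t S
    plus the sum for the previous m. *)
Lemma sum_bin_bounded m : exists B : R, forall N,
  \sum_(0 <= n < N) 'C(n + m, m)%:R * t ^+ n <= B.
Proof.
elim: m => [|m [B hB]].
  exists (1 - t)^-1 => N; under eq_bigr do rewrite addn0 bin0 mul1r.
  rewrite -[X in X <= _](mulfK (lt0r_neq0 t1_gt0)) ler_piMl ?invr_ge0 ?(ltW t1_gt0) //.
  have -> : (\sum_(0 <= n < N) t ^+ n) * (1 - t) = 1 - t ^+ N.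
    elim: N => [|N IH]; first by rewrite big_geq // mul0r expr0 subrr.
    by rewrite big_nat_recr //= mulrDl IH exprS; ring.
  by rewrite gerBl exprn_ge0.
exists (B / (1 - t)) => N; rewrite ler_pdivlMr //.
set S := \sum_(0 <= n < N) _.
have St : S <= t * S + \sum_(0 <= n < N) 'C(n + m, m)%:R * t ^+ n.
  rewrite {1}/S; under eq_bigr do rewrite addnS binS natrD mulrDl.
  rewrite big_split /= lerD2r /S big_distrr /=.
  case: N {S} => [|N]; first by rewrite !big_geq.
  rewrite big_nat_recl // add0n bin_small // mul0r add0r [leRHS]big_nat_recr //=.
  rewrite -[leLHS]addr0 lerD //; last by rewrite mulr_ge0 // mulr_ge0 // exprn_ge0.
  rewrite le_eqVlt; apply/orP; left; apply/eqP; apply: eq_bigr => i _.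
  by rewrite exprS mulrCA addSnnS.
by have := hB N; move: St; rewrite mulrBr mulr1 [S * t]mulrC; lra.
Qed.

Lemma cvg_nonneg_series (u : nat -> R) (B : R) : (forall n, 0 <= u n) ->
  (forall N, \sum_(1 <= n < N) u n <= B) -> cvgn (fun N => \sum_(1 <= n < N) u n).
Proof.
move=> u0 uB; apply: nondecreasing_is_cvgn.
  move=> m n mn; rewrite -(subnK mn); elim: (n - m)%N => [//|k IH].
  apply: le_trans IH _; rewrite addSn; case: (k + m)%N => [|j]; first by rewrite !big_geq.
  by rewrite [leRHS]big_nat_recr //= lerDl.
by exists B => _ [N _ <-].
Qed.

(** For p^k <= n < p^(k+1), monotonicity bounds c n by C M^(k+1), and the crude M <= p^M gives
    M^(k+1) <= p^M n^M. Finally n^M is at most M! times a binomial coefficient, where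
    [sum_bin_bounded] applies. *)
Lemma poly_growth_cvg (p : nat) (c : nat -> nat) C M : prime p ->
  (forall m n, (m <= n)%N -> (c m <= c n)%N) -> (forall k, (c (p ^ k) <= C * M ^ k)%N) ->
  cvgn (fun N => \sum_(1 <= n < N) (c n)%:R * t ^+ n).
Proof.
move=> pp c_mono hc; have p1 := prime_gt1 pp.
have cn n : (0 < n)%N -> (c n <= C * p ^ M * M`! * 'C(n + M, M))%N.
  move=> n0; have /andP[k1 k2] := trunc_log_bounds p1 n0.
  set k := trunc_log p n in k1 k2.
  apply: leq_trans (c_mono _ _ (ltnW k2)) _; apply: leq_trans (hc _) _.
  have Mp : (M <= p ^ M)%N by apply/ltnW/ltn_expl.
  have h1 : (M ^ k.+1 <= p ^ M * n ^ M)%N.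
    rewrite -expnMn; apply: (@leq_trans ((p ^ k.+1) ^ M)).
      by rewrite -!expnM mulnC expnM; case: k {k1 k2} => [|k]; rewrite leq_exp2r.
    case: M {Mp hc} => [|M']; first by rewrite !expn0.
    by rewrite leq_exp2r // expnS leq_mul2l k1 orbT.
  have h2 : (n ^ M <= M`! * 'C(n + M, M))%N.
    rewrite mulnC bin_ffact ffact_prod -[X in (n ^ X)%N]card_ord -prod_nat_const.
    apply: leq_prod => i _; rewrite -addnBA ?leq_addr //; exact: ltnW.
  apply: (leq_trans (leq_mul (leqnn C) h1)).
  by rewrite -!mulnA !leq_mul2l h2 !orbT.
have [B hB] := sum_bin_bounded M.
set K := (C * p ^ M * M`!)%N in cn.
apply: (@cvg_nonneg_series _ (K%:R * B)) => [n|N].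
  by rewrite mulr_ge0 // exprn_ge0.
apply: le_trans (_ : \sum_(0 <= n < N) K%:R * ('C(n + M, M)%:R * t ^+ n) <= _); last first.
  by rewrite -big_distrr ler_wpM2l.
case: N => [|N]; first by rewrite !big_geq.
rewrite [leRHS]big_nat_recl // -[leLHS]add0r lerD ?mulr_ge0 ?exprn_ge0 //.
rewrite big_add1 /=; apply: ler_sum => n _.
by rewrite mulrA -natrM ler_wpM2r ?exprn_ge0 // ler_nat cn.
Qed.

Lemma Pfac_layer p k : (0 < k)%N -> (0 < p)%N ->
  Pfac p k t = (map_poly (@natR R) (layer_poly p k)).[t]^-1.
Proof.
move=> k0 p0; have tk m : (0 < m)%N -> 1 - t ^+ m != 0.
  by move=> m0; rewrite subr_eq0 eq_sym lt_eqF // exprn_ilt1 // -?lt0n.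
have -> : (map_poly (@natR R) (layer_poly p k)).[t] = \sum_(i < p) (t ^+ k) ^+ i.
  rewrite /layer_poly rmorph_sum horner_sum; apply: eq_bigr => i _ /=.
  by rewrite map_polyXn hornerXn mulnC exprM.
have E : (1 - t ^+ (k * p)%N) = (1 - t ^+ k) * \sum_(i < p) (t ^+ k) ^+ i.
  have := subrX1 (t ^+ k) p; rewrite -exprM => h.
  by rewrite -opprB h -mulNr opprB.
rewrite /Pfac E invfM mulrA divff ?mul1r //; exact: tk.
Qed.

Lemma cvg_bigsum (I : Type) (s : seq I) (u : I -> nat -> R) (l : I -> R) :
  (forall i, u i @ \oo --> l i) ->
  (fun N => \sum_(i <- s) u i N) @ \oo --> \sum_(i <- s) l i.
Proof.
move=> ul; elim: s => [|i s IH].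
  by under eq_fun do rewrite big_nil; rewrite big_nil; apply: cvg_cst.
by under eq_fun do rewrite big_cons; rewrite big_cons; apply: cvgD.
Qed.

Section Identity.
Variables (p : nat) (d r : nat) (v : 'I_r -> nat) (a h c e : nat -> nat).
Hypothesis p_prime : prime p.
Hypothesis v_gt1 : forall i, (1 < v i)%N.
Hypothesis cE : forall n, c n = (\sum_(i < n) h i)%N.
Hypothesis hE : forall N n, (n < N)%N ->
  h n = ((\prod_(1 <= k < N) layer_poly p k ^+ a k)`_n)%R.
Hypothesis eE : forall n, (0 < n)%N ->
  (e n + d * c n.-1 + 1 = \sum_i c (n - v i)%N + c n)%N.
Variables (C M : nat).
Hypothesis c_growth : forall k, (c (p ^ k) <= C * M ^ k)%N.

Let cs N : R := \sum_(1 <= n < N) (c n)%:R * t ^+ n.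
Let hs N : R := \sum_(0 <= n < N) (h n)%:R * t ^+ n.

Let c0 : c 0%N = 0%N. Proof. by rewrite cE big_ord0. Qed.
Let cS n : c n.+1 = (c n + h n)%N. Proof. by rewrite !cE big_ord_recr. Qed.
Let h0 : h 0%N = 1%N.
Proof. by rewrite (hE (ltn0Sn 0)) big_geq // coef1. Qed.

Let cs_cvg : cvgn cs.
Proof.
apply: poly_growth_cvg c_growth => // m n mn.
by rewrite -(subnK mn); elim: (n - m)%N => // k IH; rewrite addSn cS (leq_trans IH) ?leq_addr.
Qed.

Let c_lim := limn cs.

Let cs_lim : cs @ \oo --> c_lim. Proof. exact: cs_cvg. Qed.

Let csr N : cs N.+1 = cs N + (c N)%:R * t ^+ N.
Proof.
rewrite /cs; case: N => [|N]; first by rewrite !big_geq // c0 mul0r addr0.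
by rewrite big_nat_recr.
Qed.

(** Comes from c (n + 1) = c n + h n. Convergence of the series of h is deduced from that of c
    through this identity. *)
Let csS N : cs N.+1 = t * (cs N + hs N).
Proof.
elim: N => [|N IH]; first by rewrite /cs /hs !big_geq // addr0 mulr0.
have hsr : hs N.+1 = hs N + (h N)%:R * t ^+ N by rewrite /hs big_nat_recr.
by rewrite csr {1}IH hsr csr cS natrD exprS; ring.
Qed.

Let hs_lim : hs @ \oo --> c_lim / t - c_lim.
Proof.
have -> : hs = (fun N => cs N.+1 / t - cs N).
  by apply/funext => N; rewrite csS mulrC mulKf ?lt0r_neq0 // addrC addKr.
apply: cvgB cs_lim; apply: cvgMl; rewrite (@cvg_shiftS _ cs); exact: cs_lim.
Qed.

(** Truncated subtraction is harmless: the terms with n <= w vanish because c 0 = 0. *)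
Let shift_lim w : (fun N => \sum_(1 <= n < N) (c (n - w)%N)%:R * t ^+ n) @ \oo --> t ^+ w * c_lim.
Proof.
elim: w => [|w IH].
  by rewrite expr0 mul1r; under eq_fun do under eq_bigr do rewrite subn0.
rewrite -(@cvg_shiftS _ (fun N => \sum_(1 <= n < N) (c (n - w.+1)%N)%:R * t ^+ n)).
have -> : (fun N => \sum_(1 <= n < N.+1) (c (n - w.+1)%N)%:R * t ^+ n) =
    (fun N => t * \sum_(1 <= n < N) (c (n - w)%N)%:R * t ^+ n).
  apply/funext => N; rewrite big_add1 /=; case: N => [|N]; first by rewrite !big_geq // mulr0.
  rewrite big_nat_recl // subSS sub0n c0 mul0r add0r big_distrr /= big_add1 /=.
  by apply: eq_bigr => i _; rewrite subSS exprS mulrCA.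
by rewrite exprS -mulrA; apply: cvgMr.
Qed.

Let geo_lim : (fun N => \sum_(1 <= n < N) t ^+ n) @ \oo --> t / (1 - t).
Proof.
rewrite -(@cvg_shiftS _ (fun N => \sum_(1 <= n < N) t ^+ n)).
have -> : (fun N => \sum_(1 <= n < N.+1) t ^+ n) = (fun N => (t / (1 - t)) * (1 - t ^+ N)).
  apply/funext => N; rewrite big_add1 /=; elim: N => [|N IH].
    by rewrite big_geq // expr0 subrr mulr0.
  by rewrite big_nat_recr //= IH exprS; field; rewrite lt0r_neq0.
have : (fun N => (t / (1 - t)) * (1 - t ^+ N)) @ \oo --> t / (1 - t) * (1 - 0).
  apply: cvgMr; apply: cvgB; first exact: cvg_cst.
  by apply: cvg_expr; rewrite ger0_norm.
by rewrite subr0 mulr1.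
Qed.

Let es N : R := \sum_(1 <= n < N) (e n)%:R * t ^+ n.

Let es_lim : es @ \oo --> \sum_i t ^+ v i * c_lim + c_lim - d%:R * (t * c_lim) - t / (1 - t).
Proof.
have -> : es = (fun N => (\sum_i \sum_(1 <= n < N) (c (n - v i)%N)%:R * t ^+ n) + cs N
    - d%:R * (\sum_(1 <= n < N) (c (n - 1)%N)%:R * t ^+ n) - \sum_(1 <= n < N) t ^+ n).
  apply/funext => N; rewrite exchange_big big_distrr /= -big_split -!sumrB.
  apply: eq_big_nat => n /andP[n0 _] /=.
  have := congr1 (fun m => m%:R : R) (eE n0); rewrite /= !natrD natrM natr_sum -subn1.
  rewrite -big_distrl /= => E.
  have -> : (e n)%:R = \sum_i (c (n - v i)%N)%:R + (c n)%:R - 1%:R - d%:R * (c (n - 1)%N)%:R :> R.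
    by rewrite -E; ring.
  by ring.
apply: cvgB geo_lim; apply: cvgB; last by apply: cvgMr; rewrite -{2}[t]expr1; apply: shift_lim.
apply: cvgD cs_lim; apply: cvg_bigsum => i; exact: shift_lim.
Qed.

Let c_lim_gt0 : 0 < c_lim.
Proof.
have c1 : c 1%N = 1%N by rewrite cS c0 h0.
apply: lt_le_trans (t_gt0) _.
have -> : t = cs 2 by rewrite /cs big_nat1 c1 mul1r expr1.
apply: nondecreasing_cvgn_le cs_cvg _ => m n mn.
rewrite /cs -(subnK mn); elim: (n - m)%N => [//|k IH].
apply: le_trans IH _; rewrite addSn; case: (k + m)%N => [|j]; first by rewrite !big_geq.
by rewrite [leRHS]big_nat_recr //= lerDl mulr_ge0 // exprn_ge0.
Qed.

Let h_lim := c_lim / t - c_lim.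

Let h_limE : h_lim = c_lim * (1 - t) / t.
Proof. by rewrite /h_lim; field; rewrite lt0r_neq0. Qed.

Let h_lim_gt0 : 0 < h_lim.
Proof. by rewrite h_limE divr_gt0 // mulr_gt0. Qed.

Let jp N : {poly nat} := \prod_(1 <= k < N) layer_poly p k ^+ a k.
Let jt N : R := (map_poly (@natR R) (jp N)).[t].

Let jc N n : nat := ((jp N)`_n)%R.

Let jtE N : jt N = \sum_(i < size (jp N)) (jc N i)%:R * t ^+ i.
Proof.
rewrite /jt (@horner_coef_wide _ (size (jp N))) ?size_poly //.
by apply: eq_bigr => i _; rewrite coef_map.
Qed.

Let hs_mono m n : (m <= n)%N -> hs m <= hs n.
Proof.
move=> mn; rewrite /hs -(subnK mn); elim: (n - m)%N => [//|k IH].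
by rewrite addSn (le_trans IH) // big_nat_recr //= lerDl mulr_ge0 // exprn_ge0.
Qed.

Let jp_coef_mono N n : (jc N n <= jc N.+1 n)%N.
Proof.
have mono1 k (P : {poly nat}) : leq (P`_n)%R ((layer_poly p k * P)`_n)%R.
  rewrite coef_layer_polyM (bigD1 (Ordinal (prime_gt0 p_prime))) //= mul0n subn0.
  exact: leq_addr.
case: N => [|N]; first by rewrite /jc /jp !big_geq.
have -> : jc N.+2 n = ((layer_poly p N.+1 ^+ a N.+1 * jp N.+1)`_n)%R.
  by rewrite /jc {1}/jp big_nat_recr //= mulrC.
elim: (a N.+1) => [|m IH]; first by rewrite expr0 mul1r.
by rewrite exprS -mulrA (leq_trans IH) ?mono1.
Qed.

Let jp_coef_le N n : (jc N n <= h n)%N.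
Proof.
rewrite (@hE (N + n.+1)%N n) ?leq_addl // -/(jc (N + n.+1)%N n).
set k := n.+1; elim: k => [|m IH]; first by rewrite addn0.
by rewrite addnS (leq_trans IH).
Qed.

(** A squeeze: the N-th partial product has the correct coefficients below N and coefficients at
    most h n everywhere, so its value lies between the N-th partial sum of the h n t^n and the full
    sum. *)
Let jt_lim : jt @ \oo --> h_lim.
Proof.
suff H : \forall N \near \oo, hs N <= jt N <= h_lim.
  by apply: (squeeze_cvgr H hs_lim); apply: cvg_cst.
apply: nearW => N; apply/andP; split.
  have -> : hs N = \sum_(i < N) (jc N i)%:R * t ^+ i.
    by rewrite /hs big_mkord; apply: eq_bigr => i _; rewrite (hE (ltn_ord i)).
  rewrite jtE.
  have wide m : (size (jp N) <= m)%N ->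
      \sum_(i < size (jp N)) (jc N i)%:R * t ^+ i = \sum_(i < m) (jc N i)%:R * t ^+ i.
    move=> sm; rewrite (big_ord_widen m (fun i => (jc N i)%:R * t ^+ i) sm) big_mkcond.
    by apply: eq_bigr => i _; case: ltnP => // si; rewrite /jc nth_default // mul0r.
  rewrite (wide _ (leq_maxr N _)).
  rewrite (big_ord_widen _ (fun i => (jc N i)%:R * t ^+ i) (leq_maxl N (size (jp N)))) big_mkcond.
  by apply: ler_sum => i _; case: ifP => // _; rewrite mulr_ge0 // exprn_ge0.
apply: (@le_trans _ _ (hs (size (jp N)))).
  rewrite jtE /hs big_mkord; apply: ler_sum => i _.
  by rewrite ler_wpM2r ?exprn_ge0 // ler_nat.
have <- : limn hs = h_lim by apply: cvg_lim.
apply: nondecreasing_cvgn_le; first by move=> m n; apply: hs_mono.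
by apply: cvgP hs_lim.
Qed.

Let ps N : R := \prod_(1 <= n < N) Pfac p n t ^+ a n.

Let ps_lim : ps @ \oo --> h_lim^-1.
Proof.
have -> : ps = (fun N => (jt N)^-1).
  apply/funext => N; rewrite /ps /jt /jp rmorph_prod horner_prod -prodfV.
  apply: eq_big_nat => k /andP[k0 _].
  rewrite (Pfac_layer k0 (prime_gt0 p_prime)) exprVn; congr (_^-1); apply/esym.
  apply: etrans (congr1 (horner^~ t) (rmorphXn (map_poly (@natR R)) _ _)) _.
  exact: horner_exp.
by apply: cvgV => //; rewrite lt0r_neq0.
Qed.

Let rs N : R := \sum_(2 <= k < N) #|[pred i | v i == k]|%:R * t ^+ k.

Let rs_lim : rs @ \oo --> \sum_i t ^+ v i.
Proof.
apply: cvg_near_cst; exists (\max_i v i).+1 => // N /= hN.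
have vN i : (2 <= v i < N)%N by rewrite v_gt1 (leq_trans _ hN) // ltnS leq_bigmax.
rewrite /rs.
have -> : \sum_i t ^+ v i = \sum_i \sum_(2 <= k < N | v i == k) t ^+ k.
  apply: eq_bigr => i _.
  rewrite big_mkcond (bigD1_seq (v i)) ?iota_uniq ?mem_index_iota //= eqxx.
  by rewrite big1 ?addr0 // => k /negPf ki; rewrite eq_sym ki.
under [RHS]eq_bigr do rewrite big_mkcond.
rewrite exchange_big /=; apply: eq_bigr => k _.
by rewrite -big_mkcond sumr_const mulr_natl.
Qed.

Lemma series_identity :
  [/\ cvgn rs, cvgn ps, cvgn es, cvgn cs &
      limn rs - d%:R * t + 1 = limn ps + limn es / limn cs].
Proof.
split; [exact: cvgP rs_lim|exact: cvgP ps_lim|exact: cvgP es_lim|exact: cs_cvg|].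
rewrite (cvg_lim _ rs_lim) // (cvg_lim _ ps_lim) // (cvg_lim _ es_lim) // -/c_lim.
rewrite h_limE -big_distrl /=; field.
by rewrite !lt0r_neq0.
Qed.

End Identity.
End Series.

Theorem theorem6 (R : realType) (p : nat) (p_prime : prime p)
  (G : topGroupType) (G_pro_p : pro_p p G) (G_analytic : padic_analytic p G)
  (F : topGroupType) (d : nat) (sigma : 'I_d -> F) (phi : contHomType F G)
  (pres : minimal_presentation p sigma phi)
  (rho : 'I_(dimH2 p G) -> F) (v : 'I_(dimH2 p G) -> nat)
  (rels : relation_system p phi rho v)
  (theta : {rmorphism ncps p d -> cga p F}) (theta_iso : magnus_iso sigma theta)
  (f : 'I_(dimH2 p G) -> ncps p d)
  (fE : forall i, theta (f i) = gel p (rho i) - 1)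
  (t : R) (t_gt0 : 0 < t) (t_lt1 : t < 1) :
  let r k := #|[pred i | v i == k]| in
  let a n := dim_a p G n in
  let c n := dim_c p G n in
  let J i j := cga_map phi (theta (fox j (f i))) in
  let e n := dim_e v J n in
  let r_sum N := \sum_(2 <= k < N) (r k)%:R * t ^+ k in
  let P_prod N := \prod_(1 <= n < N) Pfac p n t ^+ a n in
  let e_sum N := \sum_(1 <= n < N) (e n)%:R * t ^+ n in
  let c_sum N := \sum_(1 <= n < N) (c n)%:R * t ^+ n in
  [/\ cvgn r_sum, cvgn P_prod, cvgn e_sum, cvgn c_sum &
      limn r_sum - d%:R * t + 1 = limn P_prod + limn e_sum / limn c_sum].
Proof.
have [F_free surj s_min] := pres.
have [[F_compact _ _ _] _] := F_free.
have [G_compact G_haus _ G_pgr] := G_pro_p.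
have phi_surj g : exists z, phi z = g by have [z _ zE] := surj g Logic.I; exists z.
have genG := presG_gen theta_iso phi_surj.
have v_gt1 := level_gt1 p_prime theta_iso phi_surj rels G_pro_p s_min.
pose h n := sval (cid (has_dim_gr genG n)).
have hP n : has_dim_quo _ _ (h n) := svalP (cid (has_dim_gr genG n)).
have sI n := ipow_subspace p G n.
have cP n := has_dim_ipow hP n.
have cE n : dim_c p G n = (\sum_(i < n) h i)%N.
  by apply: dim_quoE (cP n) => //; apply: sI.
have JE i j : cga_map phi (theta (fox j (f i))) =
    cga_map phi (cga_fox theta_iso j (gel p (rho i) - 1)).
  by rewrite -fE cga_fox_theta.
(* I^n is open, so G_n contains an open normal subgroup and is one itself; this makes the finite
   quotients G / G_N available. *)
have open_dimsub n : exists U : opnsub G, forall g, U g <-> dimsub p n g.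
  have [W hW] := ipow_open genG n.
  apply: (@opnsub_sup G (@dimsub p G n) W (dimsub_normal p G n)) => g Wg; apply: hW.
  have W1 : quo_pi W g = 1%g.
    by rewrite -quo_pi1; apply/esym/quo_piE; rewrite invg1 mul1g.
  have -> : cga_at W (gel p g - 1) = 0 by rewrite cga_atB cga_at_gel W1; apply: subrr.
  exact: (two_sided0 (ideal_pow_two_sided (@galg_aug_two_sided _ _) _)).
have nbhs_dimsub n : nbhs 1%g (@dimsub p G n).
  have [U hU] := open_dimsub n.
  rewrite nbhsE; exists (U : set G); last by move=> g /hU.
  by split; [apply: opnsub_open | apply: opnsub1].
have [C [M growth]] := analytic_growth p_prime G_compact G_analytic nbhs_dimsub.
apply: (@series_identity R t t_gt0 t_lt1 p d _ v _ h _ _ p_prime v_gt1 cE _ _ C M).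
- move=> N n nN; have [U hU] := open_dimsub N.
  have := has_dim_gr_at p_prime genG hU (G_pgr U) nN.
  exact: (has_dim_uniq (sI n) (sI n.+1) (hP n)).
- case=> // n _; rewrite /=.
  have -> : (fun i j => cga_map phi (theta (fox j (f i)))) =
      (fun i j => cga_map phi (cga_fox theta_iso j (gel p (rho i) - 1))).
    by apply/funext => i; apply/funext => j; apply: JE.
  have cP' m : has_dim_quo [set: cga p G] (ideal_pow (@aug_ideal p G) m) (dim_c p G m).
    by rewrite cE; apply: cP.
  exact: (dim_e_relation p_prime theta_iso phi_surj rels F_compact G_haus G_pro_p s_min cP' n).
(* Elements meeting all cosets of G_(p^k) span F_p[[G]] modulo I^(p^k), so the codimension is at
   most their number. *)
- move=> k; have [T [b [cardT hb]]] := growth k; apply: leq_trans cardT.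
  have [y yP] := choice hb.
  have [|m mT hm] := @has_dim_span _ _ [set: cga p G] (ideal_pow (@aug_ideal p G) (p ^ k))
      T (fun s => gel p (b s)) (@subspace_setT _ _) (sI (p ^ k)%N) (fun _ _ => Logic.I) (fun _ => Logic.I).
    move=> w _; have [l hl] := gel_span genG (p ^ k) w.
    (* Each group element of the approximation l is replaced by its representative; the coefficient
       counts, modulo p, how often one occurs. *)
    exists (fun s => \sum_(g <- l | y g == s) 1).
    apply: (two_sided_trans (ipow_two_sided p G _) hl).
    have -> : \sum_s (\sum_(g <- l | y g == s) 1) *: gel p (b s) = \sum_(g <- l) gel p (b (y g)).
      under eq_bigr do rewrite scaler_suml.
      rewrite (exchange_big_dep predT) //=; apply: eq_bigr => g _.
      by rewrite (big_pred1 (y g)) ?scale1r // => s; rewrite eq_sym.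
    rewrite -sumrB; apply: (two_sided_sum (ipow_two_sided p G _)) => g _.
    exact/(gel_ideal_sub _ _ (ipow_two_sided p G _))/yP.
  by rewrite (dim_quoE (@subspace_setT _ _) (sI (p ^ k)%N) hm : dim_c p G (p ^ k)%N = m).
Qed.
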